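(* Let $n\ge 1$. For all $w\in\mathfrak{S}_{n+1}$ we have $\mathcal{T}(I_w,P_w)=\mathcal{T}_w$, where $(I_w,P_w)$ is the support $\tau$-tilting pair over the preprojective algebra $\Pi_n$ associated with $w$, $\mathcal{T}(I_w,P_w)$ is the triangulation of $\Delta_n\times\Delta_1$ corresponding to this pair, and $\mathcal{T}_w$ is the triangulation of $\Delta_n\times\Delta_1$ associated with the permutation $w$.
   Context: Preprojective algebra: $K$ is a field; $Q_n$ is the quiver with vertices $1,\dots,n$ and arrows $\alpha_i\colon i\to i+1$, $\beta_i\colon i+1\to i$ for $1\le i\le n-1$. Arrows are composed left to right ($\xrightarrow{\gamma}\xrightarrow{\delta}=\gamma\delta$). $\Pi_n$ is $KQ_n$ modulo the relations $\beta_i\alpha_i=\alpha_{i+1}\beta_{i+1}$ for $1\le i\le n-2$ and $\alpha_1\beta_1=0=\beta_{n-1}\alpha_{n-1}$ (so $\Pi_1=K$). Modules are finite-dimensional right modules, $e_i$ is the idempotent at vertex $i$, and $P_i=e_i\Pi_n$. $\tau$-tilting: a pair $(M,P)$ of $\Pi_n$-modules with $P$ projective is $\tau$-rigid if $\operatorname{Hom}(M,\tau M)=0$ ($\tau$ the Auslander–Reiten translate) and $\operatorname{Hom}(P,M)=0$; it is support $\tau$-tilting if moreover $|M|+|P|=n$, where $|X|$ is the number of isomorphism classes of indecomposable summands. Pairs are taken to be basic. An indecomposable $\tau$-rigid pair is one of the form $(M,0)$ with $M$ indecomposable or $(0,P)$ with $P$ indecomposable. The $g$-vector of $(M,P)$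 is $(r_i-s_i)_{i=1}^n$ where $\bigoplus_i P_i^{s_i'}\to\bigoplus_i P_i^{r_i}\to M\to0$ is a minimal projective presentation and $\bigoplus_i P_i^{s_i}=P\oplus\bigoplus_iP_i^{s_i'}$. Words: indecomposable $\tau$-rigid pairs over $\Pi_n$ are in bijection with words $X=x_0x_1\cdots x_n$ in the letters $a,b$ using both letters: the word of a pair is the unique such $X$ for which the $g$-vector $(g_1,\dots,g_n)$ satisfies $g_i=1$ if $x_{i-1}x_i=ab$, $g_i=-1$ if $x_{i-1}x_i=ba$, and $g_i=0$ otherwise. Prism: $a_i=(e_i,1,0)$, $b_i=(e_i,0,1)\in\mathbb{R}^{n+3}$ for $0\le i\le n$ with $e_0,\dots,e_n$ the standard basis of $\mathbb R^{n+1}$; $\Delta_n\times\Delta_1$ is their convex hull. For a word $X=x_0x_1\cdots x_n$ of length $n+1$ in the letters $a,b$ using both letters, $\Delta_X$ is the $n$-simplex with vertex set $\{a_i: x_i=a\}\cup\{b_i: x_i=b\}$; these are exactly the $n$-simplices with vertices among the $a_i,b_i$ not contained in the boundary (the internal $n$-simplices). A triangulation of $\Delta_n\times\Delta_1$ (using only the vertices $a_i,b_i$) is determined by its internal $n$-simplices. For a support $\tau$-tilting pair $(M,P)$, $\mathcal{T}(M,P)$ is the triangulation whose internal $n$-simplices are the $\Delta_X$, with $X$ running over the words of the indecomposable direct summands of $(M,P)$. Permutations: $\mathfrak{S}_{n+1}$ is the symmetric group on $\{0,1,\dots,n\}$, and $s_i$ is the transposition $(i-1\ \ i)$ for $1\le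 i\le n$. A permutation is written in one-line notation $w=i_0i_1\cdots i_n$ (so $w$ sends $k$ to $i_k$). Products are read from left to right: $w's_i$ is obtained from the one-line notation of $w'$ by exchanging the values $i-1$ and $i$. Define $\mathcal{T}_w$ to be the triangulation whose $(n+1)$-simplices have vertex sets $\{a_{i_0},\dots,a_{i_j},b_{i_j},\dots,b_{i_n}\}$ for $0\le j\le n$. Let $I_i=\Pi_n(1-e_i)\Pi_n$, and for a reduced expression $w=s_{i_1}\cdots s_{i_k}$ let $I_w=I_{i_1}\cdots I_{i_k}$ (product of ideals; $I_e=\Pi_n$), regarded as a right $\Pi_n$-module. It is known that $I_w$ does not depend on the reduced expression and is a support $\tau$-tilting module; $P_w$ is the basic projective module such that $(I_w,P_w)$ is a support $\tau$-tilting pair. *)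

(* Defs.v *)
From HB Require Import structures.
From mathcomp Require Import all_boot all_order all_fingroup all_algebra.
From mathcomp Require Import generic_quotient ring_quotient.
From mathcomp Require Import finmap.
From mathcomp.multinomials Require Import monalg.
From mathcomp Require Import boolp functions reals.

Set Implicit Arguments.
Unset Strict Implicit.
Unset Printing Implicit Defensive.

Import GRing.Theory Num.Theory.

Local Open Scope ring_scope.

Section AdditiveSpan.
Variable V : zmodType.

Inductive addspan (S : V -> Prop) : V -> Prop :=
| addspan_gen x : S x -> addspan S x
| addspan0 : addspan S 0
| addspanB x y : addspan S x -> addspan S y -> addspan S (x - y).

Lemma addspanD (S : V -> Prop) x y :
  addspan S x -> addspan S y -> addspan S (x + y).
Proof.
move=> hx hy; rewrite -[y]opprK -[- y]sub0r.
by apply: addspanB => //; apply: addspanB => //; apply: addspan0.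
Qed.

Lemma addspan_morph (S : V -> Prop) (f : V -> V) :
  zmod_morphism f -> (forall x, S x -> addspan S (f x)) ->
  forall x, addspan S x -> addspan S (f x).
Proof.
move=> fB fS x; elim=> {x} [x /fS //| |x y _ hx _ hy].
  by have := fB 0 0; rewrite !subrr => ->; apply: addspan0.
by rewrite fB; apply: addspanB.
Qed.

End AdditiveSpan.

(* Path algebras; the product [p q] means: first [p], then [q]. *)

Record quiver := Quiver {
  vertex : finType;
  arrow : finType;
  src : arrow -> vertex;
  tgt : arrow -> vertex }.

Section PathAlgebra.
Variables (K : fieldType) (Q : quiver).

Fixpoint is_walk (x : vertex Q) (p : seq (arrow Q)) : bool :=
  if p is a :: p' then (src a == x) && is_walk (tgt a) p' else true.

Record qpath := QPath {
  qpath_val : vertex Q * seq (arrow Q);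
  _ : is_walk qpath_val.1 qpath_val.2 }.
HB.instance Definition _ := [isSub for qpath_val].
HB.instance Definition _ := [Choice of qpath by <:].

Definition psrc (p : qpath) : vertex Q := (val p).1.
Definition ptgt (p : qpath) : vertex Q := last (val p).1 (map (@tgt Q) (val p).2).

Lemma is_walk_cat x p q :
  is_walk x (p ++ q) = is_walk x p && is_walk (last x (map (@tgt Q) p)) q.
Proof. by elim: p x => //= a p IHp x; rewrite IHp andbA. Qed.

Definition pconcat (p q : qpath) : option qpath :=
  if ptgt p == psrc q then insub ((val p).1, (val p).2 ++ (val q).2) else None.

Fact stationary_subproof (x : vertex Q) : is_walk x [::]. Proof. by []. Qed.
Definition stationary (x : vertex Q) : qpath := Sub (x, [::]) (stationary_subproof x).

Fact arrow_subproof (a : arrow Q) : is_walk (src a) [:: a].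
Proof. by rewrite /= eqxx. Qed.
Definition arrow_path (a : arrow Q) : qpath := Sub (src a, [:: a]) (arrow_subproof a).

Definition path_algebra : Type := {malg K[qpath]}.
HB.instance Definition _ := GRing.Lmodule.on path_algebra.

Definition pa_path (p : qpath) : path_algebra := << p >>.
Definition pa_comp (p q : qpath) : path_algebra :=
  if pconcat p q is Some r then pa_path r else 0.
(* The ring operations are locked to keep conversion tests from unfolding them. *)
Fact pa_key : unit. Proof. by []. Qed.
Definition pa_one : path_algebra :=
  locked_with pa_key (\sum_(x : vertex Q) pa_path (stationary x)).

(* The linear extension to the path algebra of a map [F] on paths *)
Definition pa_ext (V : lmodType K) (f : path_algebra) (F : qpath -> V) : V :=
  \sum_(p <- msupp f) f@_p *: F p.

Definition pa_mul : path_algebra -> path_algebra -> path_algebra :=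
  locked_with pa_key
    (fun f g => pa_ext f (fun p => pa_ext g (fun q => pa_comp p q))).

Lemma pa_oneE : pa_one = \sum_(x : vertex Q) pa_path (stationary x).
Proof. by rewrite /pa_one unlock. Qed.

Lemma pa_mulE f g :
  pa_mul f g = pa_ext f (fun p => pa_ext g (fun q => pa_comp p q)).
Proof. by rewrite /pa_mul unlock. Qed.

Lemma pa_extEw (V : lmodType K) (d : {fset qpath}) f (F : qpath -> V) :
  (msupp f `<=` d)%fset -> pa_ext f F = \sum_(p <- d) f@_p *: F p.
Proof.
move=> sfd; rewrite /pa_ext (big_fset_incl _ sfd) // => p _ /mcoeff_outdom ->.
by rewrite scale0r.
Qed.

Lemma pa_extD (V : lmodType K) f g (F : qpath -> V) :
  pa_ext (f + g) F = pa_ext f F + pa_ext g F.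
Proof.
pose d := (msupp f `|` msupp g)%fset.
rewrite (pa_extEw F (d := d)) ?msuppD_le //.
rewrite (pa_extEw F (f := f) (d := d)) ?fsubsetUl //.
rewrite (pa_extEw F (f := g) (d := d)) ?fsubsetUr //.
by rewrite -big_split; apply: eq_bigr => p _; rewrite mcoeffD scalerDl.
Qed.

Lemma pa_extZ (V : lmodType K) c f (F : qpath -> V) :
  pa_ext (c *: f) F = c *: pa_ext f F.
Proof.
rewrite (pa_extEw F (d := msupp f)) ?msuppZ_le // scaler_sumr.
by apply: eq_bigr => p _; rewrite mcoeffZ scalerA.
Qed.

Lemma pa_ext0 (V : lmodType K) (F : qpath -> V) : pa_ext 0 F = 0.
Proof. by rewrite -(scale0r 0) pa_extZ scale0r. Qed.

Lemma pa_ext_sum (V : lmodType K) (I : Type) (r : seq I) (f : I -> path_algebra)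
    (F : qpath -> V) :
  pa_ext (\sum_(i <- r) f i) F = \sum_(i <- r) pa_ext (f i) F.
Proof.
by elim/big_rec2: _ => [|i y1 y2 _ <-]; rewrite ?pa_ext0 ?pa_extD.
Qed.

Lemma pa_ext_path (V : lmodType K) p (F : qpath -> V) : pa_ext (pa_path p) F = F p.
Proof.
rewrite /pa_ext /pa_path msuppU oner_eq0 big_seq_fset1 mcoeffUU.
by rewrite scale1r.
Qed.

Lemma pa_ext_comp (V : lmodType K) f (F : qpath -> path_algebra) (G : qpath -> V) :
  pa_ext (pa_ext f F) G = pa_ext f (fun p => pa_ext (F p) G).
Proof.
by rewrite {2}/pa_ext pa_ext_sum; apply: eq_bigr => p _; rewrite pa_extZ.
Qed.

Lemma eq_pa_ext (V : lmodType K) f (F G : qpath -> V) :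
  F =1 G -> pa_ext f F = pa_ext f G.
Proof. by move=> eqFG; apply: eq_bigr => p _; rewrite eqFG. Qed.

Lemma pa_ext_addF (V : lmodType K) f (F G : qpath -> V) :
  pa_ext f (fun p => F p + G p) = pa_ext f F + pa_ext f G.
Proof. by rewrite -big_split; apply: eq_bigr => p _; rewrite scalerDr. Qed.

Lemma pa_ext_scaleF (V : lmodType K) f c (F : qpath -> V) :
  pa_ext f (fun p => c *: F p) = c *: pa_ext f F.
Proof.
by rewrite scaler_sumr; apply: eq_bigr => p _; rewrite !scalerA mulrC.
Qed.

Lemma pa_ext_id f : pa_ext f pa_path = f.
Proof.
rewrite [RHS]monalgE; apply: eq_bigr => p _; apply/malgP => q.
by rewrite mcoeffZ !mcoeffU mulrnAr mulr1.
Qed.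

Lemma pa_comp_subst p q (F : qpath -> path_algebra) :
  pa_ext (pa_comp p q) F = if pconcat p q is Some r then F r else 0.
Proof. by rewrite /pa_comp; case: pconcat => [r|]; rewrite ?pa_ext0 ?pa_ext_path. Qed.

Lemma pconcatP p q : ptgt p = psrc q ->
  exists2 r, pconcat p q = Some r &
    \val r = ((\val p).1, (\val p).2 ++ (\val q).2).
Proof.
move=> epq; rewrite /pconcat epq eqxx; case: insubP => [r _ er|].
  by exists r.
by rewrite is_walk_cat (valP p) -/(ptgt p) epq (valP q).
Qed.

Lemma psrc_concat p q r : pconcat p q = Some r -> psrc r = psrc p.
Proof.
rewrite /pconcat; case: eqP => // epq; case: insubP => // r' _ er' [<-].
by rewrite /psrc er'.
Qed.

Lemma ptgt_concat p q r : pconcat p q = Some r -> ptgt r = ptgt q.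
Proof.
rewrite /pconcat; case: eqP => // epq; case: insubP => // r' _ er' [<-].
by rewrite /ptgt er' /= map_cat last_cat -/(ptgt p) epq.
Qed.

Lemma pconcatA p q r :
  obind (pconcat p) (pconcat q r) = obind (pconcat^~ r) (pconcat p q).
Proof.
have [eqr|nqr] := eqVneq (ptgt q) (psrc r); last first.
  have -> : pconcat q r = None by rewrite /pconcat (negPf nqr).
  case epq: (pconcat p q) => [s|] //=.
  by rewrite /pconcat (ptgt_concat epq) (negPf nqr).
have [epq|npq] := eqVneq (ptgt p) (psrc q); last first.
  have -> : pconcat p q = None by rewrite /pconcat (negPf npq).
  case eqr': (pconcat q r) => [s|] //=.
  by rewrite /pconcat (psrc_concat eqr') (negPf npq).
have [s es vs] := pconcatP eqr; have [t et vt] := pconcatP epq.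
rewrite es et /=.
have [u -> vu] : exists2 u, pconcat p s = Some u & \val u = ((\val p).1, (\val p).2 ++ (\val s).2).
  by apply: pconcatP; rewrite (psrc_concat es).
have [v -> vv] : exists2 v, pconcat t r = Some v & \val v = ((\val t).1, (\val t).2 ++ (\val r).2).
  by apply: pconcatP; rewrite (ptgt_concat et).
by congr Some; apply: val_inj; rewrite vu vv vs vt /= catA.
Qed.

Lemma pa_mulA : associative pa_mul.
Proof.
move=> f g h; rewrite !pa_mulE [RHS]pa_ext_comp; apply: eq_pa_ext => p.
rewrite !pa_ext_comp; apply: eq_pa_ext => q.
rewrite pa_ext_comp pa_comp_subst.
transitivity (pa_ext h (fun r => if obind (pconcat p) (pconcat q r) is Some s
                                 then pa_path s else 0)).
  by apply: eq_pa_ext => r; rewrite pa_comp_subst; case: (pconcat q r).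
under eq_pa_ext do rewrite pconcatA.
case: (pconcat p q) => [s|] /=; first exact: eq_pa_ext.
by rewrite /pa_ext big1 // => ? _; rewrite scaler0.
Qed.

Lemma pa_mul1f : left_id pa_one pa_mul.
Proof.
move=> f; rewrite pa_mulE pa_oneE pa_ext_sum.
under eq_bigr do rewrite pa_ext_path.
rewrite -[RHS]pa_ext_id exchange_big; apply: eq_bigr => p _.
rewrite -scaler_sumr; congr (_ *: _).
rewrite (bigD1 (psrc p)) //= big1 => [|x nx].
  have [r er vr] := @pconcatP (stationary (psrc p)) p erefl.
  rewrite addr0 /pa_comp er; congr pa_path; apply: val_inj; rewrite vr /=.
  by case: (p) => -[].
by rewrite /pa_comp /pconcat /ptgt /= (negPf nx).
Qed.

Lemma pa_mulf1 : right_id pa_one pa_mul.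
Proof.
move=> f; rewrite pa_mulE pa_oneE -[RHS]pa_ext_id; apply: eq_pa_ext => p.
rewrite pa_ext_sum; under eq_bigr do rewrite pa_ext_path.
rewrite (bigD1 (ptgt p)) //= big1 => [|x nx].
  have [r er vr] := @pconcatP p (stationary (ptgt p)) erefl.
  rewrite addr0 /pa_comp er; congr pa_path; apply: val_inj; rewrite vr /= cats0.
  by case: (p) => -[].
by rewrite /pa_comp /pconcat /psrc /= eq_sym (negPf nx).
Qed.

Lemma pa_mulDl : left_distributive pa_mul +%R.
Proof. by move=> f g h; rewrite !pa_mulE pa_extD. Qed.

Lemma pa_mulDr : right_distributive pa_mul +%R.
Proof.
move=> f g h; rewrite !pa_mulE -pa_ext_addF; apply: eq_pa_ext => p.
exact: pa_extD.
Qed.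

HB.instance Definition _ := GRing.Zmodule_isPzRing.Build path_algebra
  pa_mulA pa_mul1f pa_mulf1 pa_mulDl pa_mulDr.

Lemma pa_scaleAl (c : K) (f g : path_algebra) : c *: (f * g) = (c *: f) * g.
Proof. by rewrite -[f * g]/(pa_mul f g) -[RHS]/(pa_mul _ g) !pa_mulE pa_extZ. Qed.

Lemma pa_scaleAr (c : K) (f g : path_algebra) : c *: (f * g) = f * (c *: g).
Proof.
rewrite -[f * g]/(pa_mul f g) -[RHS]/(pa_mul f _) !pa_mulE -pa_ext_scaleF.
by apply: eq_pa_ext => p; rewrite pa_extZ.
Qed.

End PathAlgebra.

Definition ideal_gen (A : pzRingType) (S : A -> Prop) : A -> Prop :=
  addspan (fun x => exists u r v : A, S r /\ x = u * r * v).

Lemma ideal_genMl (A : pzRingType) (S : A -> Prop) a x :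
  ideal_gen S x -> ideal_gen S (a * x).
Proof.
apply: addspan_morph => [y z|y [u [r [v [Sr ->]]]]]; first exact: mulrBr.
by apply: addspan_gen; exists (a * u), r, v; rewrite !mulrA.
Qed.

Lemma ideal_genMr (A : pzRingType) (S : A -> Prop) a x :
  ideal_gen S x -> ideal_gen S (x * a).
Proof.
apply: (addspan_morph (f := *%R^~ a)) => [y z|y [u [r [v [Sr ->]]]]].
  exact: mulrBl.
by apply: addspan_gen; exists u, r, (v * a); rewrite !mulrA.
Qed.

Section BoundQuiverAlgebra.
Variables (K : fieldType) (Q : quiver) (rel : path_algebra K Q -> Prop).
Local Notation KQ := (path_algebra K Q).

Definition rel_ideal : KQ -> bool := fun x => `[< ideal_gen rel x >].

Lemma rel_idealP x : reflect (ideal_gen rel x) (x \in rel_ideal).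
Proof. exact: asboolP. Qed.

Fact rel_ideal_zmod_closed : zmod_closed rel_ideal.
Proof.
split=> [|x y /rel_idealP hx /rel_idealP hy]; apply/rel_idealP.
  exact: addspan0.
exact: addspanB.
Qed.
HB.instance Definition _ := GRing.isZmodClosed.Build KQ rel_ideal rel_ideal_zmod_closed.
Definition rel_zmod : zmodClosed KQ := GRing.ZmodClosed.clone KQ rel_ideal _.

Definition bound_algebra : Type := {ideal_quot rel_zmod}.
HB.instance Definition _ := GRing.Zmodule.on bound_algebra.
HB.instance Definition _ := EqQuotient.on bound_algebra.

Fact ba_key : unit. Proof. by []. Qed.
Definition ba_pi : KQ -> bound_algebra :=
  locked_with ba_key (fun x => (\pi_bound_algebra x)%qT).
Definition ba_one : bound_algebra := ba_pi 1.
Definition ba_mul : bound_algebra -> bound_algebra -> bound_algebra :=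
  locked_with ba_key (fun x y => ba_pi (repr x * repr y)).
Definition ba_scale : K -> bound_algebra -> bound_algebra :=
  locked_with ba_key (fun c x => ba_pi (c *: repr x)).

Lemma ba_piE x : ba_pi x = (\pi_(Quotient.quot rel_zmod) x)%qT.
Proof. by rewrite /ba_pi unlock. Qed.

Lemma ba_mulE x y : ba_mul x y = ba_pi (repr x * repr y).
Proof. by rewrite /ba_mul unlock. Qed.

Lemma ba_scaleE c x : ba_scale c x = ba_pi (c *: repr x).
Proof. by rewrite /ba_scale unlock. Qed.

Lemma ba_piP x y : ideal_gen rel (x - y) <-> ba_pi x = ba_pi y.
Proof.
rewrite !ba_piE; split=> [/rel_idealP|/eqP] h; last first.
  by apply/rel_idealP; rewrite [_ \in _](Quotient.idealrBE rel_zmod).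
by apply/eqP; rewrite -[_ == _](Quotient.idealrBE rel_zmod).
Qed.

Lemma ba_piK x : ba_pi (repr x) = x.
Proof. by rewrite ba_piE; apply: reprK. Qed.

Lemma ba_reprP x : ideal_gen rel (x - repr (ba_pi x)).
Proof. by apply: (proj2 (ba_piP _ _)); rewrite ba_piK. Qed.

Lemma ba_piB x y : ba_pi (x - y) = ba_pi x - ba_pi y.
Proof. by rewrite !ba_piE; apply: raddfB. Qed.

Lemma ba_piD x y : ba_pi (x + y) = ba_pi x + ba_pi y.
Proof. by rewrite !ba_piE; apply: raddfD. Qed.

Lemma ba_piM x y : ba_pi (x * y) = ba_mul (ba_pi x) (ba_pi y).
Proof.
rewrite ba_mulE; apply: (proj1 (ba_piP _ _)).
have hx := ba_reprP x; have hy := ba_reprP y.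
set x' := repr _ in hx *; set y' := repr _ in hy *.
have -> : x * y - x' * y' = x * (y - y') + (x - x') * y'.
  by rewrite mulrBr mulrBl addrA subrK.
by apply: addspanD; [apply: ideal_genMl | apply: ideal_genMr].
Qed.

Lemma ba_piZ c x : ba_pi (c *: x) = ba_scale c (ba_pi x).
Proof.
rewrite ba_scaleE; apply: (proj1 (ba_piP _ _)).
have hx := ba_reprP x; set x' := repr _ in hx *.
rewrite -scalerBr -[x - x']mul1r pa_scaleAl.
exact: ideal_genMl.
Qed.

Lemma ba_ind (P : bound_algebra -> Prop) :
  (forall x, P (ba_pi x)) -> forall x, P x.
Proof. by move=> Ppi x; rewrite -[x]ba_piK. Qed.

Fact ba_mulA : associative ba_mul.
Proof.
elim/ba_ind=> x; elim/ba_ind=> y; elim/ba_ind=> z.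
by rewrite -!ba_piM mulrA.
Qed.
Fact ba_mul1x : left_id ba_one ba_mul.
Proof. by elim/ba_ind=> x; rewrite -ba_piM mul1r. Qed.
Fact ba_mulx1 : right_id ba_one ba_mul.
Proof. by elim/ba_ind=> x; rewrite -ba_piM mulr1. Qed.
Fact ba_mulDl : left_distributive ba_mul +%R.
Proof.
elim/ba_ind=> x; elim/ba_ind=> y; elim/ba_ind=> z.
by rewrite -ba_piD -!ba_piM mulrDl ba_piD.
Qed.
Fact ba_mulDr : right_distributive ba_mul +%R.
Proof.
elim/ba_ind=> x; elim/ba_ind=> y; elim/ba_ind=> z.
by rewrite -ba_piD -!ba_piM mulrDr ba_piD.
Qed.
HB.instance Definition _ := GRing.Zmodule_isPzRing.Build bound_algebra
  ba_mulA ba_mul1x ba_mulx1 ba_mulDl ba_mulDr.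

Fact ba_scaleA a b x : ba_scale a (ba_scale b x) = ba_scale (a * b) x.
Proof. by elim/ba_ind: x => x; rewrite -!ba_piZ scalerA. Qed.
Fact ba_scale1 : left_id 1 ba_scale.
Proof. by elim/ba_ind=> x; rewrite -ba_piZ scale1r. Qed.
Fact ba_scaleDr : right_distributive ba_scale +%R.
Proof.
move=> a; elim/ba_ind=> x; elim/ba_ind=> y.
by rewrite -ba_piD -!ba_piZ scalerDr ba_piD.
Qed.
Fact ba_scaleDl x : {morph ba_scale^~ x : a b / a + b}.
Proof. by elim/ba_ind: x => x a b; rewrite -!ba_piZ scalerDl ba_piD. Qed.
HB.instance Definition _ := GRing.Zmodule_isLmodule.Build K bound_algebra
  ba_scaleA ba_scale1 ba_scaleDr ba_scaleDl.

Lemma ba_pi1 : ba_pi 1 = 1. Proof. by []. Qed.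

Lemma ba_pi_mul x y : ba_pi (x * y) = ba_pi x * ba_pi y.
Proof. exact: ba_piM. Qed.

Lemma ba_pi_scale c x : ba_pi (c *: x) = c *: ba_pi x.
Proof. exact: ba_piZ. Qed.

Lemma ba_scaleAl (c : K) (x y : bound_algebra) : c *: (x * y) = (c *: x) * y.
Proof.
elim/ba_ind: x => x; elim/ba_ind: y => y.
by rewrite -ba_pi_mul -ba_pi_scale pa_scaleAl ba_pi_mul ba_pi_scale.
Qed.

Lemma ba_scaleAr (c : K) (x y : bound_algebra) : c *: (x * y) = x * (c *: y).
Proof.
elim/ba_ind: x => x; elim/ba_ind: y => y.
by rewrite -ba_pi_mul -ba_pi_scale pa_scaleAr ba_pi_mul ba_pi_scale.
Qed.

End BoundQuiverAlgebra.

Section PreprojectiveAlgebra.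
Variables (K : fieldType) (n : nat).

(* Vertices and arrows are numbered from 0: vertex [i : 'I_n] is the vertex   *)
(* i + 1 of Q_n, [inl i] is alpha_(i+1) and [inr i] is beta_(i+1).            *)
Fact vlow_subproof (i : 'I_n.-1) : (i < n)%N.
Proof. exact: leq_trans (ltn_ord i) (leq_pred n). Qed.
Fact vhigh_subproof (i : 'I_n.-1) : (i.+1 < n)%N.
Proof. by case: i => i; rewrite /=; case: n. Qed.
Definition vlow (i : 'I_n.-1) : 'I_n := Ordinal (vlow_subproof i).
Definition vhigh (i : 'I_n.-1) : 'I_n := Ordinal (vhigh_subproof i).

Definition double_A : quiver :=
  @Quiver 'I_n ('I_n.-1 + 'I_n.-1)%type
    (fun a => match a with inl i => vlow i | inr i => vhigh i end)
    (fun a => match a with inl i => vhigh i | inr i => vlow i end).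

Definition pa_alpha (i : 'I_n.-1) : path_algebra K double_A :=
  pa_path K (@arrow_path double_A (inl i)).
Definition pa_beta (i : 'I_n.-1) : path_algebra K double_A :=
  pa_path K (@arrow_path double_A (inr i)).

Variant preproj_rel : path_algebra K double_A -> Prop :=
| preproj_rel_mid (i j : 'I_n.-1) of j = i.+1 :> nat :
    preproj_rel (pa_beta i * pa_alpha i - pa_alpha j * pa_beta j)
| preproj_rel_first (i : 'I_n.-1) of i = 0%N :> nat :
    preproj_rel (pa_alpha i * pa_beta i)
| preproj_rel_last (i : 'I_n.-1) of i.+1 = n.-1 :
    preproj_rel (pa_beta i * pa_alpha i).

Definition preproj : Type := bound_algebra preproj_rel.
HB.instance Definition _ := GRing.PzRing.on preproj.
HB.instance Definition _ := GRing.Lmodule.on preproj.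

Definition idem (i : 'I_n) : preproj :=
  ba_pi preproj_rel (pa_path K (@stationary double_A i)).

End PreprojectiveAlgebra.

Lemma right_regular_scaleE (R : pzRingType) (a : R^c) (x : (R^c)^o) :
  a *: x = (x : R) * (a : R) :> R.
Proof. by []. Qed.

Section Submodule.
Variables (R : pzRingType) (V : lmodType R).

Record submodule := Submodule {
  in_subm :> V -> Prop;
  subm0 : in_subm 0;
  submD : forall x y, in_subm x -> in_subm y -> in_subm (x + y);
  submZ : forall a x, in_subm x -> in_subm (a *: x) }.

Variable U : submodule.

Record submod_type := SubmodType { submod_val : V; _ : `[< U submod_val >] }.
HB.instance Definition _ := [isSub for submod_val].
HB.instance Definition _ := [Choice of submod_type by <:].

Fact submod_closed_subproof : subsemimod_closed (fun x : V => `[< U x >]).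
Proof.
split; first split; first by apply/asboolP/subm0.
  by move=> x y /asboolP hx /asboolP hy; apply/asboolP/submD.
by move=> a x /asboolP hx; apply/asboolP/submZ.
Qed.
HB.instance Definition _ :=
  GRing.SubChoice_isSubLmodule.Build R V (fun x : V => `[< U x >]) submod_type
    submod_closed_subproof.

End Submodule.
Coercion submod_lmod (R : pzRingType) (V : lmodType R) (U : submodule V) : lmodType R :=
  submod_type U.

Section ModuleNotions.
Variable R : pzRingType.

Definition zero_mod (M : lmodType R) : Prop := forall x : M, x = 0.

Definition iso_mod (M N : lmodType R) : Prop :=
  exists f : {linear M -> N}, bijective f.

Definition summand (N M : lmodType R) : Prop :=
  exists L : lmodType R, iso_mod (N * L)%type M.

Definition indecomposable (M : lmodType R) : Prop :=
  ~ zero_mod M /\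
  forall N L : lmodType R, iso_mod (N * L)%type M -> zero_mod N \/ zero_mod L.

Definition basic (M : lmodType R) : Prop :=
  forall N : lmodType R, indecomposable N -> ~ summand (N * N)%type M.

Definition surj_lin (M N : lmodType R) (f : {linear M -> N}) : Prop :=
  forall y, exists x, f x = y.

Definition projective (P : lmodType R) : Prop :=
  forall (M N : lmodType R) (g : {linear M -> N}) (h : {linear P -> N}),
    surj_lin g -> exists h' : {linear P -> M}, forall x, g (h' x) = h x.

Definition nb_indec (M : lmodType R) (m : nat) : Prop :=
  exists N : 'I_m -> lmodType R,
    [/\ forall k, indecomposable (N k) /\ summand (N k) M,
        forall k l, iso_mod (N k) (N l) -> k = l
      & forall L, indecomposable L -> summand L M -> exists k, iso_mod L (N k)].

(* [ker f] is a superfluous (small) submodule of [M] *)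
Definition small_kernel (M N : lmodType R) (f : {linear M -> N}) : Prop :=
  forall L : submodule M,
    (forall x, exists y z, [/\ L y, f z = 0 & x = y + z]) -> forall x, L x.

(* [P1 -f-> P0 -p-> M -> 0] is exact, with [P0 -> M] and [P1 -> ker p]        *)
(* projective covers as soon as [P0] and [P1] are projective.                 *)
Definition minimal_presentation (P1 P0 M : lmodType R)
    (f : {linear P1 -> P0}) (p : {linear P0 -> M}) : Prop :=
  [/\ surj_lin p, forall x, p x = 0 <-> exists y, f y = x,
      small_kernel p & small_kernel f].

Definition no_hom (M N : lmodType R) : Prop :=
  forall (f : {linear M -> N}) x, f x = 0.

End ModuleNotions.

(* Right [A]-modules are modules over the converse ring [A^c]; [(A^c)^o] is   *)
(* the right regular module, on which [a : A^c] acts by [x |-> x * a].        *)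
Definition rmod (A : pzRingType) : Type := lmodType A^c.

Section RightModules.
Variable A : pzRingType.
Local Notation rmod := (rmod A).

(* [\bigoplus_i P_i^(r i)] with [P_i = e_i A] *)
Section ProjectiveSum.
Variables (V : finType) (e : V -> A) (r : V -> nat).
Local Notation index := {i : V & 'I_(r i)}.

Definition in_proj_sum (f : {ffun index -> (A^c)^o}) : Prop :=
  forall k : index, exists a : A, f k = e (tag k) * a.

Fact proj_sum0 : in_proj_sum 0.
Proof. by move=> k; exists 0; rewrite ffunE mulr0. Qed.
Fact proj_sumD f g : in_proj_sum f -> in_proj_sum g -> in_proj_sum (f + g).
Proof.
move=> hf hg k; have [a ha] := hf k; have [b hb] := hg k.
by exists (a + b); rewrite ffunE ha hb mulrDr.
Qed.
Fact proj_sumZ (a : A^c) f : in_proj_sum f -> in_proj_sum (a *: f).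
Proof.
move=> hf k; have [b hb] := hf k; exists (b * (a : A)).
by rewrite ffunE right_regular_scaleE hb -mulrA.
Qed.

Definition proj_sum : rmod := Submodule proj_sum0 proj_sumD proj_sumZ.
End ProjectiveSum.

(* The left module [Hom_A(P, A)], with [(a h)(x) = a h(x)] *)
Section HomToRegular.
Variable P : rmod.

Definition in_hom_reg (h : P -> A^o) : Prop := linear (h : P -> (A^c)^o).

Fact hom_reg0 : in_hom_reg 0.
Proof. by move=> a x y; rewrite scaler0 addr0. Qed.
Fact hom_regD g h : in_hom_reg g -> in_hom_reg h -> in_hom_reg (g + h).
Proof.
move=> hg hh a x y.
rewrite -[LHS]/(g (a *: x + y) + h (a *: x + y)) hg hh.
rewrite -[(g + h) x]/(g x + h x) -[(g + h) y]/(g y + h y).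
by rewrite scalerDr addrACA.
Qed.
Fact hom_regZ b h : in_hom_reg h -> in_hom_reg (b *: h).
Proof.
move=> hh a x y; rewrite -[LHS]/((b : A) * (h (a *: x + y) : A)) hh.
rewrite -[X in _ * X]/((h x : A) * (a : A) + (h y : A)) mulrDr mulrA.
by [].
Qed.

Definition hom_reg_submod : submodule (P -> A^o) :=
  Submodule hom_reg0 hom_regD hom_regZ.
Definition hom_reg : lmodType A := hom_reg_submod.
End HomToRegular.

Fact hom_reg_comp_subproof (P1 P0 : rmod) (f : {linear P1 -> P0}) (h : hom_reg P0) :
  `[< in_hom_reg (fun x : P1 => submod_val h (f x)) >].
Proof.
apply/asboolP => a x y; rewrite linearP.
exact: (asboolP _ (valP h)).
Qed.
(* [Hom_A(f, A) : Hom_A(P0, A) -> Hom_A(P1, A)] *)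
Definition hom_reg_comp (P1 P0 : rmod) (f : {linear P1 -> P0}) (h : hom_reg P0) :
    hom_reg P1 :=
  @SubmodType _ _ (hom_reg_submod P1) _ (hom_reg_comp_subproof f h).

Lemma hom_reg_compZ (P1 P0 : rmod) (f : {linear P1 -> P0}) (a : A) h :
  hom_reg_comp f (a *: h) = a *: hom_reg_comp f h.
Proof. by apply/val_inj/funext => x. Qed.

Section Ideals.
Variables (V : finType) (e : V -> A).

(* The two-sided ideal [A (1 - e_i) A], as a submodule of the right regular module *)
Fact vertex_ideal0 i : ideal_gen (eq (1 - e i)) 0.
Proof. exact: addspan0. Qed.
Fact vertex_idealD i (x y : (A^c)^o) : ideal_gen (eq (1 - e i)) x ->
  ideal_gen (eq (1 - e i)) y -> ideal_gen (eq (1 - e i)) (x + y : A).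
Proof. exact: addspanD. Qed.
Fact vertex_idealZ i (a : A^c) (x : (A^c)^o) : ideal_gen (eq (1 - e i)) x ->
  ideal_gen (eq (1 - e i)) (a *: x : A).
Proof. exact: ideal_genMr. Qed.

Definition vertex_ideal (i : V) : submodule (A^c)^o :=
  @Submodule _ (A^c)^o _ (vertex_ideal0 i) (@vertex_idealD i) (@vertex_idealZ i).

Section IdealProduct.
Variables I J : submodule (A^c)^o.
Definition in_ideal_prod : A -> Prop :=
  addspan (fun z : A => exists x y : A, [/\ I x, J y & z = x * y]).

Fact ideal_prod0 : in_ideal_prod 0. Proof. exact: addspan0. Qed.
Fact ideal_prodD (x y : (A^c)^o) : in_ideal_prod x -> in_ideal_prod y ->
  in_ideal_prod (x + y : A).
Proof. exact: addspanD. Qed.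
Fact ideal_prodZ (a : A^c) (x : (A^c)^o) : in_ideal_prod x ->
  in_ideal_prod (a *: x : A).
Proof.
apply: (addspan_morph (f := fun z : A => z * (a : A))) => [y z|z [y [t [Iy Jt ->]]]].
  exact: mulrBl.
apply: addspan_gen; exists y, (t * a : A); split => //; last by rewrite mulrA.
exact: (submZ (s := J) a Jt).
Qed.
Definition ideal_prod : submodule (A^c)^o :=
  @Submodule _ (A^c)^o _ ideal_prod0 ideal_prodD ideal_prodZ.
End IdealProduct.

Definition unit_ideal : submodule (A^c)^o :=
  @Submodule _ (A^c)^o (fun=> True) I (fun _ _ _ _ => I) (fun _ _ _ => I).

(* [I_(i_1) ... I_(i_k)] for the sequence [s] of the [i_j] *)
Definition word_ideal (s : seq V) : submodule (A^c)^o :=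
  foldr (fun i J => ideal_prod (vertex_ideal i) J) unit_ideal s.

End Ideals.
End RightModules.

Section PreprojectiveModules.
Variables (K : fieldType) (n : nat).
Local Notation A := (preproj K n).
Local Notation rmod := (rmod A).
Local Notation proj_sum := (proj_sum (@idem K n)).

Definition scal (c : K) : A := c *: (1 : A).

Definition fin_dim (M : rmod) : Prop :=
  exists s : seq M, forall x : M, exists c : 'I_(size s) -> K,
    x = \sum_(i < size s) (scal (c i) : A^c) *: s`_i.

(* The right module [D L = Hom_K(L, K)], with [(phi a)(x) = phi (a x)] *)
Section Dual.
Variable L : lmodType A.

Definition in_dual (phi : L -> K) : Prop :=
  forall (c : K) (x y : L), phi (scal c *: x + y) = c * phi x + phi y.

Record dual := Dual { dual_val : L -> K; _ : `[< in_dual dual_val >] }.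
HB.instance Definition _ := [isSub for dual_val].
HB.instance Definition _ := [Choice of dual by <:].

Fact dual_zmod_closed : zmod_closed (fun phi : L -> K => `[< in_dual phi >]).
Proof.
split=> [|f g /asboolP hf /asboolP hg]; apply/asboolP => c x y.
  by rewrite mulr0 addr0.
rewrite -[LHS]/(f (_ *: x + y) - g (_ *: x + y)) hf hg.
rewrite -[(f - g) x]/(f x - g x) -[(f - g) y]/(f y - g y).
by rewrite mulrBr opprD addrACA.
Qed.
HB.instance Definition _ :=
  GRing.SubChoice_isSubZmodule.Build (L -> K) (fun phi : L -> K => `[< in_dual phi >])
    dual dual_zmod_closed.

Fact dual_scale_subproof (a : A^c) (phi : dual) :
  `[< in_dual (fun x => dual_val phi ((a : A) *: x)) >].
Proof.
apply/asboolP => c x y; rewrite -(asboolP _ (valP phi)) scalerDr !scalerA.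
congr (dual_val phi (_ *: x + _)).
by rewrite -[RHS]ba_scaleAl mul1r -[LHS]ba_scaleAr mulr1.
Qed.
Definition dual_scale (a : A^c) (phi : dual) : dual := Dual (dual_scale_subproof a phi).

Fact dual_scaleA a b phi : dual_scale a (dual_scale b phi) = dual_scale (a * b) phi.
Proof. by apply/val_inj/funext => x /=; rewrite scalerA. Qed.
Fact dual_scale1 : left_id 1 dual_scale.
Proof. by move=> phi; apply/val_inj/funext => x /=; rewrite scale1r. Qed.
Fact dual_scaleDr : right_distributive dual_scale +%R.
Proof. by move=> a phi psi; apply/val_inj/funext. Qed.
Fact dual_scaleDl phi : {morph dual_scale^~ phi : a b / a + b}.
Proof.
move=> a b; apply/val_inj/funext => x /=; rewrite scalerDl.
have /asboolP/(_ 1) := valP phi; rewrite /scal scale1r => h.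
by rewrite -[X in dual_val phi (X + _)]scale1r h mul1r.
Qed.
HB.instance Definition _ := GRing.Zmodule_isLmodule.Build A^c dual
  dual_scaleA dual_scale1 dual_scaleDr dual_scaleDl.
End Dual.

(* [tau M = D (Tr M)] where [Tr M] is the cokernel of [Hom_A(f, A)] for a     *)
(* minimal projective presentation [P1 -f-> P0 -> M -> 0]; the dual of this   *)
(* cokernel is the module of functionals that vanish on the image.            *)
Section ARTranslate.
Variables (P1 P0 : rmod) (f : {linear P1 -> P0}).

Definition in_ar_translate (phi : dual (hom_reg P1)) : Prop :=
  forall h : hom_reg P0, dual_val phi (hom_reg_comp f h) = 0.

Fact ar_translate0 : in_ar_translate 0. Proof. by []. Qed.
Fact ar_translateD phi psi :
  in_ar_translate phi -> in_ar_translate psi -> in_ar_translate (phi + psi).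
Proof.
move=> h1 h2 h; rewrite -[LHS]/(dual_val phi _ + dual_val psi _).
by rewrite h1 h2 addr0.
Qed.
Fact ar_translateZ (a : A^c) phi :
  in_ar_translate phi -> in_ar_translate (a *: phi).
Proof.
move=> hphi h; rewrite -(hphi ((a : A) *: h)) hom_reg_compZ.
by [].
Qed.

Definition ar_translate : rmod :=
  Submodule ar_translate0 ar_translateD ar_translateZ.
End ARTranslate.

Definition tau_rigid_pair (M P : rmod) : Prop :=
  [/\ projective P,
      exists (r s : 'I_n -> nat)
             (f : {linear proj_sum s -> proj_sum r}) (p : {linear proj_sum r -> M}),
        minimal_presentation f p /\ no_hom M (ar_translate f)
    & no_hom P M].

Definition support_tau_tilting (M P : rmod) : Prop :=
  [/\ fin_dim M /\ fin_dim P, basic M /\ basic P, tau_rigid_pair M P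
    & exists m p : nat, [/\ nb_indec M m, nb_indec P p & (m + p)%N = n]].

Definition gvector (M P : rmod) (g : 'I_n -> int) : Prop :=
  exists (r s' s : 'I_n -> nat)
         (f : {linear proj_sum s' -> proj_sum r}) (p : {linear proj_sum r -> M}),
    [/\ minimal_presentation f p,
        iso_mod (P * proj_sum s')%type (proj_sum s)
      & forall i, g i = (r i)%:Z - (s i)%:Z].

(* [I_w] for a reduced expression [s] of [w] *)
Definition preproj_ideal (s : seq 'I_n) : rmod := word_ideal (@idem K n) s.

End PreprojectiveModules.

(* A word x_0 ... x_n in the letters a = [true] and b = [false] *)
Definition abword n := {ffun 'I_n.+1 -> bool}.

Section Words.
Variable n : nat.

Definition both_letters (X : abword n) : Prop :=
  (exists i, X i = true) /\ (exists i, X i = false).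

(* [prev_ix i] and [next_ix i] are i - 1 and i for i = 1, ..., n, where i is  *)
(* represented by the ordinal of value i - 1.                                 *)
Definition prev_ix (i : 'I_n) : 'I_n.+1 := widen_ord (leqnSn n) i.
Definition next_ix (i : 'I_n) : 'I_n.+1 := lift ord0 i.

Definition word_gvector (X : abword n) (i : 'I_n) : int :=
  if X (prev_ix i) && ~~ X (next_ix i) then 1
  else if ~~ X (prev_ix i) && X (next_ix i) then -1 else 0.

Definition word_of_pair (K : fieldType) (M P : rmod (preproj K n)) (X : abword n) : Prop :=
  both_letters X /\ gvector M P (word_gvector X).

Definition indec_summand_word (K : fieldType) (M P : rmod (preproj K n)) (X : abword n) : Prop :=
  exists N L : rmod (preproj K n),
    [/\ summand N M, summand L P,
        indecomposable N /\ zero_mod L \/ zero_mod N /\ indecomposable L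
      & word_of_pair N L X].

Definition simple_transp (i : 'I_n) : 'S_n.+1 := tperm (prev_ix i) (next_ix i).

(* In MathComp [(s * t) x = t (s x)]: products are read from left to right. *)
Definition is_expression (s : seq 'I_n) (w : 'S_n.+1) : Prop :=
  w = (\prod_(i <- s) simple_transp i)%g.

Definition reduced_expression (s : seq 'I_n) (w : 'S_n.+1) : Prop :=
  is_expression s w /\ forall t, is_expression t w -> (size s <= size t)%N.

End Words.

Section Prism.
Variables (R : realType) (n : nat).

(* [(i, true)] is the vertex a_i and [(i, false)] is the vertex b_i *)
Definition prism_vertex : finType := ('I_n.+1 * bool)%type.
Local Notation point := 'rV[R]_(n.+1 + 2).

Definition vertex_point (v : prism_vertex) : point :=
  row_mx (delta_mx 0 v.1) (delta_mx 0 (if v.2 then 0 else 1)).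

Definition in_conv (s : {set prism_vertex}) (x : point) : Prop :=
  exists c : prism_vertex -> R,
    [/\ forall v, 0 <= c v, \sum_(v in s) c v = 1
      & x = \sum_(v in s) c v *: vertex_point v].

Definition in_prism : point -> Prop := in_conv setT.

(* The union of the proper faces *)
Definition in_boundary (x : point) : Prop :=
  in_prism x /\ exists u : 'cV[R]_(n.+1 + 2),
    (forall y, in_prism y -> (y *m u) 0 0 <= (x *m u) 0 0) /\
    (exists2 y, in_prism y & (y *m u) 0 0 < (x *m u) 0 0).

Definition aff_indep (s : {set prism_vertex}) : Prop :=
  forall c : prism_vertex -> R, \sum_(v in s) c v = 0 ->
    \sum_(v in s) c v *: vertex_point v = 0 -> forall v, v \in s -> c v = 0.

(* A triangulation is given by the vertex sets of all its (nonempty) simplices *)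
Record triangulation (T : {set {set prism_vertex}}) : Prop := {
  tri_simplex : forall s : {set prism_vertex}, s \in T -> s != set0 /\ aff_indep s;
  tri_face : forall s t : {set prism_vertex}, s \in T -> t \subset s -> t != set0 -> t \in T;
  tri_inter : forall (s t : {set prism_vertex}) x, s \in T -> t \in T ->
    in_conv s x -> in_conv t x -> in_conv (s :&: t) x;
  tri_cover : forall x, in_prism x -> exists2 s, s \in T & in_conv s x }.

Definition internal_simplex (s : {set prism_vertex}) : Prop :=
  ~ (forall x, in_conv s x -> in_boundary x).

Definition word_simplex (X : abword n) : {set prism_vertex} :=
  [set (i, X i) | i : 'I_n.+1].

(* [T] is the triangulation T(M, P) *)
Definition triangulation_of_pair (K : fieldType) (M P : rmod (preproj K n))
    (T : {set {set prism_vertex}}) : Prop :=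
  triangulation T /\
  forall s, (s \in T /\ #|s| = n.+1 /\ internal_simplex s) <->
            exists2 X : abword n, indec_summand_word M P X & s = word_simplex X.

Definition perm_simplex (w : 'S_n.+1) (j : 'I_n.+1) : {set prism_vertex} :=
  [set (w k, true) | k : 'I_n.+1 & (k <= j)%N] :|:
  [set (w k, false) | k : 'I_n.+1 & (j <= k)%N].

(* T_w: the faces of its (n+1)-simplices *)
Definition perm_triangulation (w : 'S_n.+1) : {set {set prism_vertex}} :=
  [set s | (s != set0) && [exists j, s \subset perm_simplex w j]].

End Prism.

(* Main.v *)
Require Import Defs.
From HB Require Import structures.
From mathcomp Require Import all_boot all_order all_fingroup all_algebra.
From mathcomp Require Import generic_quotient ring_quotient.
From mathcomp Require Import zify lra.
From mathcomp Require Import boolp reals.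

Set Implicit Arguments.
Unset Strict Implicit.
Unset Printing Implicit Defensive.

Import GRing.Theory Num.Theory.

(** Write alpha and beta for the sums of all arrows alpha_i and beta_i, e_c
    for the idempotent at vertex c, counted from 1, and A for the algebra.
    The relations say that alpha and beta commute, so A is spanned by the
    monomials e_c beta^p alpha^q, which vanish unless p < c and c + q <= n.
    Counting the paths of a given source and given numbers of letters is
    compatible with the relations inside these bounds ([kcoef_ideal]), hence
    the remaining monomials form a basis ([pcoef_mono], [mono_expand]).

    The ideal I_w is spanned by those e_c beta^p alpha^q for which at most p
    of the values w 0, ..., w (c - 1) are at least the end vertex c + q - p
    ([word_idealP]).  This goes by induction on the reduced word: by the
    exchange property the first letter k is an ascent of the remaining
    permutation, and multiplying by the ideal of the vertex k changes the
    family of monomials exactly at that vertex.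

    Therefore I_w is the direct sum of the right modules e_j I_w.  A nonzero
    e_j I_w has a simple socle, spanned by the longest path from j, so that
    its endomorphisms which fix the socle are bijective; this gives the part
    of the Krull-Schmidt theorem that is needed: the indecomposable summands
    of I_w are the nonzero e_j I_w ([indec_summand_part], [part_indec]).

    Let X_j be the word whose letter at u is a exactly when the position of u
    in w is less than j.  The monomials of e_j I_w fill the region above a
    lattice walk that follows the letters of X_j.  The minimal generators sit
    at its corners ab and the minimal relations at its valleys ba
    ([pres_minimal]), so the g-vector of e_j I_w is the one of X_j; it is an
    invariant because minimal presentations are unique
    ([presentation_unique]).  If e_j I_w = 0, then X_j = b...ba...a has the
    g-vector of the pair formed by 0 and the projective at the vertex
    n + 1 - j ([om_notin_cut]).  That projective is a summand of P: the
    summands of P are indecomposable projectives at vertices which annihilate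
    I_w, and the condition |I_w| + |P| = n forces all of these vertices to
    occur ([summand_P_exists]).  So the words of the summands of the pair are
    exactly X_1, ..., X_n ([indec_summand_wordP]).

    On the side of the prism, the simplex of X_j is the common facet of two
    consecutive cells of T_w.  A point of the prism determines weights that
    are supported on one cell ([stair_uniq]); this makes T_w a triangulation
    and identifies its internal n-simplices as those of the X_j
    ([perm_triangulationP], [internal_cells]).  Any triangulation which
    contains these n-simplices equals T_w ([triangulation_unique]): an edge
    that does not fit into any cell of T_w crosses one of them at its
    midpoint. *)

(** * Reduced words and rank functions of permutations *)

Section RankFunction.
Variables (n : nat).
Implicit Types (w : 'S_n.+1) (s : seq 'I_n).

Definition word_perm s : 'S_n.+1 := (\prod_(i <- s) simple_transp i)%g.

Lemma word_perm_cons k s : word_perm (k :: s) = (simple_transp k * word_perm s)%g.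
Proof. by rewrite /word_perm big_cons. Qed.

Lemma simple_transp_val (k : 'I_n) (x : 'I_n.+1) : simple_transp k x =
  (if x == k :> nat then k.+1 else if x == k.+1 :> nat then k : nat else x) :> nat.
Proof.
rewrite /simple_transp; case: tpermP => [->|->|h1 h2]; rewrite /= ?/bump /=.
- by rewrite eqxx.
- by rewrite eqxx ifF //; lia.
have n1 : (x == k :> nat) = false by apply/eqP => e; apply: h1; apply: val_inj.
have n2 : (x == k.+1 :> nat) = false by apply/eqP => e; apply: h2; apply: val_inj.
by rewrite n1 n2.
Qed.

Lemma simple_transp_fix (k : 'I_n) (x : 'I_n.+1) : x != k :> nat -> x != k.+1 :> nat ->
  simple_transp k x = x.
Proof. by move=> h1 h2; apply: val_inj => /=;
  rewrite simple_transp_val (negPf h1) (negPf h2). Qed.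

(** The letter of the word that swaps the two values can be deleted; it is
    found by following the two values through the word. *)
Lemma exchange_property s (x y : 'I_n.+1) : x < y -> word_perm s y < word_perm s x ->
  exists t, size t < size s /\ word_perm t = (tperm x y * word_perm s)%g.
Proof.
elim: s x y => [|k s IH] x y lxy; first by rewrite /word_perm big_nil !perm1; lia.
rewrite word_perm_cons !permM.
have hk : next_ix k = (prev_ix k).+1 :> nat by rewrite /= /bump.
have [/andP[/eqP ex /eqP ey]|nxy] := boolP ((x == prev_ix k) && (y == next_ix k)).
  by exists s; split => //; rewrite mulgA ex ey tperm2 mul1g.
have lxy' : simple_transp k x < simple_transp k y.
  by move: nxy; rewrite -!val_eqE /= /bump /= !simple_transp_val; do !case: eqP => /=; lia.
move=> /(IH _ _ lxy')[t [st et]]; exists (k :: t); split=> //.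
rewrite word_perm_cons et !mulgA; congr (_ * _)%g.
by rewrite [RHS]conjgC tpermJ.
Qed.

(** If the first letter were a descent of the rest of the word, the exchange
    property would shorten the whole word by two letters. *)
Lemma reduced_cons k s w : reduced_expression (k :: s) w ->
  reduced_expression s (word_perm s) /\
  word_perm s (prev_ix k) < word_perm s (next_ix k).
Proof.
move=> [ew min]; have {}ew : w = word_perm (k :: s) := ew.
have {}min t : word_perm t = w -> size (k :: s) <= size t by move=> et; apply: min.
rewrite word_perm_cons in ew; split.
  split=> // t et; have {}et : word_perm s = word_perm t := et.
  by have := min (k :: t); rewrite ltnS; apply; rewrite word_perm_cons ew et.
rewrite ltnNge leq_eqVlt negb_or; apply/andP; split.
  by rewrite (inj_eq val_inj) (inj_eq perm_inj) -val_eqE /= /bump /=; lia.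
have lpn : prev_ix k < next_ix k by rewrite /= /bump.
apply/negP => /(exchange_property lpn) [t [st et]].
have := min t; rewrite ew et => /(_ erefl) /=; lia.
Qed.

Definition perm_rank w i v : nat := \sum_(t < i) (w (inord t) < v).

Lemma perm_rankS w i v : perm_rank w i.+1 v = perm_rank w i v + (w (inord i) < v).
Proof. by rewrite /perm_rank big_ord_recr. Qed.
Lemma perm_rank0 w v : perm_rank w 0 v = 0. Proof. by rewrite /perm_rank big_ord0. Qed.

Lemma perm_rank_bounds w i d v :
  perm_rank w i v <= perm_rank w (i + d) v <= perm_rank w i v + d.
Proof.
elim: d => [|d IH]; first by rewrite !addn0 leqnn.
by rewrite addnS perm_rankS; case: (_ < v); move: IH; lia.
Qed.

Lemma perm_rank_incr w i i' v : i <= i' ->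
  perm_rank w i v <= perm_rank w i' v <= perm_rank w i v + (i' - i).
Proof. by move=> h; rewrite -{1 2}(subnKC h) perm_rank_bounds. Qed.

Lemma perm_rank_le w i v : perm_rank w i v <= i.
Proof. by have := perm_rank_bounds w 0 i v; rewrite perm_rank0 add0n => /andP[]. Qed.

Lemma perm_rank_full w i : perm_rank w i n.+1 = i.
Proof. by elim: i => [|i IH]; rewrite ?perm_rank0 // perm_rankS IH ltn_ord addn1. Qed.

Lemma perm_rank_stepv w i v : i <= n.+1 -> v < n.+1 ->
  perm_rank w i v.+1 = perm_rank w i v + ((w^-1)%g (inord v) < i).
Proof.
move=> hi hv; elim: i hi => [|i IH] hi; first by rewrite !perm_rank0 ltn0.
rewrite !perm_rankS (IH (ltnW hi)) !ltnS; set u : 'I_n.+1 := (w^-1)%g _.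
have E : (w (inord i) == v :> nat) = (u == i :> nat).
  apply/eqP/eqP => h.
    by rewrite /u -h inord_val permK inordK.
  by rewrite -h inord_val /u permKV inordK.
move: E; case: (ltngtP u i); case: (ltngtP (w (inord i)) v) => //=; lia.
Qed.

Lemma perm_rankv0 w i : perm_rank w i 0 = 0.
Proof. by rewrite /perm_rank big1. Qed.

Lemma perm_rank_le_v w i v : i <= n.+1 -> v <= n.+1 -> perm_rank w i v <= v.
Proof.
move=> hi; elim: v => [|v IH] hv; first by rewrite perm_rankv0.
by rewrite perm_rank_stepv //; have := IH (ltnW hv); case: (_ < i); lia.
Qed.

(** A swap of the values at k and k + 1 only affects the count of the first
    k + 1 positions. *)
Lemma perm_rank_cons_neq w (k : 'I_n) i v : i != k.+1 -> i <= n.+1 ->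
  perm_rank (simple_transp k * w)%g i v = perm_rank w i v.
Proof.
have kn := ltn_ord k; move=> ne hi; have [h|h] := leqP i k.
  by apply: eq_bigr => t _; rewrite permM simple_transp_fix // inordK; have := ltn_ord t; lia.
have {ne h} h : k.+2 <= i by lia.
rewrite -(subnKC h); have hi' : k.+2 + (i - k.+2) <= n.+1 by lia.
elim: (i - _) hi' => [|d IH] hd; last first.
  by rewrite addnS 2!perm_rankS IH; [rewrite permM simple_transp_fix // inordK; lia | lia].
rewrite addn0 !perm_rankS.
have -> : perm_rank (simple_transp k * w)%g k v = perm_rank w k v.
  by apply: eq_bigr => t _; rewrite permM simple_transp_fix // inordK; have := ltn_ord t; lia.
have -> : inord k = prev_ix k by apply: val_inj; rewrite /= inordK // ltnS ltnW.
have -> : inord k.+1 = next_ix k by apply: val_inj; rewrite /= inordK /bump //= ltnS ltn_ord.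
by rewrite !permM /simple_transp tpermL tpermR -!addnA [X in _ + X]addnC.
Qed.

(** The only rank changed by the swap. At an ascent the larger value comes
    first afterwards, which makes the new rank the least one allowed by its
    two neighbours; the maximum reflects that a path leaving a vertex passes
    through one of the two adjacent vertices. *)
Lemma perm_rank_cons_eq w (k : 'I_n) v : w (prev_ix k) < w (next_ix k) ->
  perm_rank (simple_transp k * w)%g k.+1 v = maxn (perm_rank w k.+2 v).-1 (perm_rank w k v).
Proof.
move=> lt; have kn := ltn_ord k.
have E1 : inord k = prev_ix k by apply: val_inj; rewrite /= inordK // ltnS ltnW.
have E2 : inord k.+1 = next_ix k by apply: val_inj; rewrite /= inordK /bump //= ltnS ltn_ord.
rewrite !perm_rankS perm_rank_cons_neq; [|lia|lia].
rewrite E1 E2 permM /simple_transp tpermL.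
by case: (ltnP (w (prev_ix k)) v); case: (ltnP (w (next_ix k)) v); lia.
Qed.

End RankFunction.

(** The paths from the vertex c with p letters beta and q letters alpha that
    survive in the preprojective algebra: p steps down and q steps up, taken
    in any order, must stay inside the quiver. *)
Definition in_bounds (n c p q : nat) : bool := (p < c) && (c + q <= n).

Section IdealFilter.
Variables (n : nat).
(** At most p of the values w 0, ..., w (c - 1) are greater than or equal to
    c + q - p, the end vertex of the path. *)
Definition in_filter (w : 'S_n.+1) c p q :=
  in_bounds n c p q && (c <= p + perm_rank w c (c + q - p)).

Lemma perm_rank_id c v : c <= n.+1 -> perm_rank (1 : 'S_n.+1)%g c v = minn c v.
Proof.
move=> hc; elim: c hc => [|c IH] hc; first by rewrite perm_rank0 min0n.
by rewrite perm_rankS (IH (ltnW hc)) perm1 inordK //; case: (ltnP c v); lia.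
Qed.

Lemma in_filter_id c p q : in_filter 1%g c p q = in_bounds n c p q.
Proof.
rewrite /in_filter; case h: (in_bounds n c p q) => //=; move: h; rewrite /in_bounds => h.
by rewrite perm_rank_id; lia.
Qed.

(** Left multiplication by a path e_c beta^p alpha^q carries the filter of w
    into the filter of s_k w, except for the stationary path at the vertex
    of s_k, which is not in the ideal of that vertex. *)
Lemma in_filter_step (w : 'S_n.+1) (k : 'I_n) c p q P Q : w (prev_ix k) < w (next_ix k) ->
  in_bounds n c P Q -> p <= P -> q <= Q -> ~~ [&& c == k.+1, p == 0 & q == 0] ->
  in_filter w (c + q - p) (P - p) (Q - q) -> in_filter (simple_transp k * w)%g c P Q.
Proof.
move=> lt hb hp hq nk /andP[_]; rewrite /in_filter hb /=; move: hb; rewrite /in_bounds => hb.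
have -> : c + q - p + (Q - q) - (P - p) = c + Q - P by lia.
set v := c + Q - P => h.
have cn : c <= n.+1 by lia.
have up i i' : i <= i' ->
    perm_rank w i v <= perm_rank w i' v <= perm_rank w i v + (i' - i).
  exact: perm_rank_incr.
have [ec|nc] := eqVneq c k.+1; last first.
  rewrite perm_rank_cons_neq //; have [h1|/ltnW h1] := leqP c (c + q - p).
    by have := up _ _ h1; lia.
  by have := up _ _ h1; lia.
rewrite ec perm_rank_cons_eq //; rewrite ec eqxx /= in nk.
have [q0|q0] := posnP q; last first.
  have [h1|/ltnW h1] := leqP k.+2 (c + q - p); have := up _ _ h1; lia.
have [h1|/ltnW h1] := leqP k (c + q - p); have := up _ _ h1; lia.
Qed.

(** Conversely, a path of the new filter that starts at the vertex of s_k
    can be made to pass first through the next or the previous vertex,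
    whichever attains the maximum in the rank formula. *)
Lemma in_filter_consE (w : 'S_n.+1) (k : 'I_n) P Q : w (prev_ix k) < w (next_ix k) ->
  in_filter (simple_transp k * w)%g k.+1 P Q ->
  (0 < Q /\ in_filter w k.+2 P Q.-1) \/ (0 < P /\ in_filter w k P.-1 Q).
Proof.
move=> lt /andP[hb]; rewrite perm_rank_cons_eq //; have := hb; rewrite /in_bounds => hb'.
set v := k.+1 + Q - P => h; rewrite /in_filter /in_bounds.
have vn : v <= n.+1 by rewrite /v; lia.
have kn := ltn_ord k.
have h1 := @perm_rank_le_v n w k.+2 v; have h2 := @perm_rank_le n w k v.
have [l|l] := leqP (perm_rank w k.+2 v).-1 (perm_rank w k v).
  right; have P0 : 0 < P by lia.
  split=> //; have -> : k + Q - P.-1 = v by lia.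
  lia.
left; have Q0 : 0 < Q by lia.
split=> //; have -> : k.+2 + Q.-1 - P = v by lia.
have vn' : v <= n by rewrite /v; lia.
lia.
Qed.

End IdealFilter.

(** * Lattice walks of two-letter words *)

Section Walk.
Variables (n j : nat) (X : nat -> bool).

Definition count_a c := \sum_(u < c) (X u : nat).
Lemma count_a0 : count_a 0 = 0. Proof. by rewrite /count_a big_ord0. Qed.
Lemma count_aS c : count_a c.+1 = count_a c + X c. Proof. by rewrite /count_a big_ord_recr. Qed.
Lemma count_a_bounds c c' : c <= c' -> count_a c <= count_a c' <= count_a c + (c' - c).
Proof.
elim: c' => [|d IH] h; first by have -> : c = 0 by [lia]; rewrite leqnn leq_addr.
have [lt|ge] := ltnP d c; first by have -> : c = d.+1 by [lia]; rewrite leqnn leq_addr.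
by have := IH ge; rewrite count_aS; case: (X _); lia.
Qed.
Lemma count_a_le c : count_a c <= c.
Proof. by have := count_a_bounds (leq0n c); rewrite count_a0; lia. Qed.
Lemma count_a_j c : count_a n.+1 = j -> c <= n.+1 -> count_a c <= j <= count_a c + (n.+1 - c).
Proof. move=> hA; by move=> h; rewrite -hA; apply: count_a_bounds. Qed.
Lemma count_a_lt c u c' : c <= u -> u < c' -> X u -> count_a c < count_a c'.
Proof.
move=> h1 h2 Xu; have := count_a_bounds h1; have := count_a_bounds h2; rewrite count_aS Xu; lia.
Qed.
Lemma count_b_lt c u c' : c <= u -> u < c' -> ~~ X u -> c - count_a c < c' - count_a c'.
Proof.
move=> h1 h2 Xu; have := count_a_bounds h1; have := count_a_bounds h2.
by have := count_a_le c; rewrite count_aS (negPf Xu); lia.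
Qed.
Lemma count_a_run c c' : c <= c' -> (forall u, c <= u -> u < c' -> X u) ->
  count_a c' = count_a c + (c' - c).
Proof.
elim: c' => [|d IH] h H; first by have -> : c = 0 by [lia]; rewrite subnn addn0.
have [lt|ge] := ltnP d c; first by have -> : c = d.+1 by [lia]; rewrite subnn addn0.
by rewrite count_aS H // IH //; [lia | move=> u h1 h2; apply: H; lia].
Qed.
Lemma count_a_const c c' : c <= c' -> (forall u, c <= u -> u < c' -> ~~ X u) ->
  count_a c' = count_a c.
Proof.
elim: c' => [|d IH] h H; first by have -> : c = 0 by [lia].
have [lt|ge] := ltnP d c; first by have -> : c = d.+1 by [lia].
rewrite count_aS (negPf (H d _ _)) // addn0 IH // => u h1 h2; apply: H; lia.
Qed.

(** A word is read as a lattice walk: the letter a, encoded by true, lowers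
    the exponent of beta and the letter b raises the exponent of alpha. With
    j letters a in total the walk starts at (j, 0), and its point after c
    letters is the pair of exponents of a path from j to c. *)
Definition beta_exp c := j - count_a c.
Definition alpha_exp c := c - count_a c.

Lemma beta_exp_anti c c' : c <= c' -> beta_exp c' <= beta_exp c.
Proof. by move=> /count_a_bounds; rewrite /beta_exp; lia. Qed.
Lemma alpha_exp_mono c c' : c <= c' -> alpha_exp c <= alpha_exp c'.
Proof. by move=> h; have := count_a_bounds h; rewrite /alpha_exp; lia. Qed.
Lemma walk_content c : count_a n.+1 = j -> c <= n.+1 -> j + alpha_exp c = c + beta_exp c.
Proof. move=> hA; by move=> h; have := count_a_j hA h; have := count_a_le c;
  rewrite /beta_exp /alpha_exp; lia. Qed.

(** A place ab of the word, where the walk has a locally minimal pair of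
    exponents. The word is continued by a on the left and b on the right, so
    that a walk may have corners at 0 and at n + 1, outside of the quiver. *)
Definition corner c := [&& c <= n.+1, (c == 0) || X c.-1 & (c == n.+1) || ~~ X c].
Definition valley c := [&& 0 < c, c <= n, ~~ X c.-1 & X c].

(** The corner reached from a valley by going back over its run of letters
    b. *)
Fixpoint left_corner c := if c is c'.+1 then if X c' then c else left_corner c' else 0.
Lemma left_cornerP c : [/\ left_corner c <= c, (left_corner c == 0) || X (left_corner c).-1
  & forall u, left_corner c <= u -> u < c -> ~~ X u].
Proof.
elim: c => [|c [h1 h2 h3]] /=; first by split.
case Xc: (X c); first by split=> //= u h4 h5; lia.
split=> //; first lia.
move=> u h4 h5; have [lt|ge] := ltnP u c; first exact: h3.
by have -> : u = c by [lia]; rewrite Xc.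
Qed.

(** The fuel k bounds the number of letters read. *)
Fixpoint right_corner_from k c :=
  if k is k'.+1 then if X c then right_corner_from k' c.+1 else c else c.
Definition right_corner c := right_corner_from (n.+1 - c) c.
Lemma right_cornerP c : c <= n.+1 ->
  [/\ c <= right_corner c <= n.+1, (right_corner c == n.+1) || ~~ X (right_corner c)
  & forall u, c <= u -> u < right_corner c -> X u].
Proof.
move=> hc; rewrite /right_corner; have : c + (n.+1 - c) = n.+1 by lia.
move: (n.+1 - c) => k; clear hc; elim: k c => [|k IH] c e /=.
  split; [lia | by apply/orP; left; lia | move=> u; lia].
case Xc: (X c); last by split; [lia | by rewrite ?Xc /= orbT | move=> u; lia].
have [|h1 h2 h3] := IH c.+1; first lia.
split=> //; first lia.
move=> u h4 h5; have [lt|ge] := ltnP c u; first by apply: h3.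
by have -> : u = c by [lia].
Qed.

Lemma left_corner_spec c : valley c ->
  [/\ corner (left_corner c), left_corner c < c & count_a (left_corner c) = count_a c].
Proof.
case/and4P => c0 cn Xp Xc; have [h1 h2 h3] := left_cornerP c.
have lt : left_corner c < c.
  have [//|ge] := ltnP (left_corner c) c; have e : left_corner c = c by lia.
  by move: h2; rewrite e (negPf Xp) orbF; lia.
split=> //; last by rewrite (count_a_const h1 h3).
by rewrite /corner h2 (h3 _ (leqnn _) lt) orbT /=; lia.
Qed.

Lemma right_corner_spec c : valley c ->
  [/\ corner (right_corner c), c < right_corner c,
  right_corner c <= n.+1 & alpha_exp (right_corner c) = alpha_exp c].
Proof.
case/and4P => c0 cn Xp Xc; have [|h1 h2 h3] := @right_cornerP c; first lia.
have lt : c < right_corner c.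
  have [//|ge] := ltnP c (right_corner c); have e : right_corner c = c by lia.
  by move: h2; rewrite e Xc orbF; lia.
split=> //; [|lia|].
  by rewrite /corner h2 (h3 (right_corner c).-1) ?orbT; lia.
by have := count_a_run (ltnW lt) h3; have := count_a_le c; rewrite /alpha_exp; lia.
Qed.

Lemma right_corner_uniq c c' : c < c' -> corner c' -> (forall u, c <= u -> u < c' -> X u) ->
  right_corner c = c'.
Proof.
move=> lt /and3P[hn _ h] H; have [|/andP[h1 h1'] h2 h3] := @right_cornerP c; first lia.
case: (ltngtP (right_corner c) c') => // hlt.
  by move: h2; rewrite H ?orbF //; lia.
by move: h; rewrite h3 ?orbF //; lia.
Qed.

Lemma left_corner_ge c v : corner c -> c < v -> c <= left_corner v.
Proof.
case/and3P => _ h _ cv; have [h1 h2 h3] := left_cornerP v.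
rewrite leqNgt; apply/negP => lt; have : ~~ X c.-1 by apply: h3; lia.
by move: h; case/orP => [|-> //]; lia.
Qed.

(** Two corners are linked by a chain of valleys, of which the last one can
    always be split off. *)
Lemma valley_before c c' : corner c -> corner c' -> c < c' ->
  exists v, [/\ valley v, c < v < c', right_corner v = c' & c <= left_corner v].
Proof.
move=> kc kc' lt; have /and3P[hn h _] := kc'.
have [v [lv Hv hv]] : exists v, [/\ v <= c', forall u, v <= u -> u < c' -> X u
    & (v == 0) || ~~ X v.-1].
  elim: (c') => [|d [v [lv Hv hv]]]; first by exists 0; split=> // u; lia.
  case Xd: (X d); last by exists d.+1; split; [| move=> u; lia | rewrite Xd].
  exists v; split=> //; first lia.
  move=> u h1 h2; have [l|g] := ltnP u d; first exact: Hv.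
  by have -> : u = d by [lia].
have cv : c < v.
  rewrite ltnNge; apply/negP => vc; have Xc := Hv c vc lt.
  by move: kc => /and3P[_ _]; rewrite Xc orbF; lia.
have vc' : v < c'.
  rewrite ltn_neqAle lv andbT; apply/negP => /eqP e.
  by move: hv; rewrite e; move: h; case: (X c'.-1); rewrite ?orbF; lia.
have val : valley v.
  rewrite /valley (Hv v) //; move: hv; case: (X v.-1); lia.
exists v; split=> //; first lia; first exact: right_corner_uniq.
exact: left_corner_ge.
Qed.

(** Distinct corners are incomparable, so no generator is redundant. *)
Lemma corner_anti c c' : count_a n.+1 = j -> corner c -> corner c' -> 0 < c -> 0 < c' ->
  c <= n -> c' <= n ->
  beta_exp c' <= beta_exp c -> alpha_exp c' <= alpha_exp c -> c = c'.
Proof.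
move=> hA /and3P[_ h1 h2] /and3P[_ h1' h2'] c0 c0' cn cn' lp lq.
case: (ltngtP c c') => // lt.
  have Xc : ~~ X c by move: h2; case/orP => //; lia.
  by have := count_b_lt (leqnn c) lt Xc; move: lq; rewrite /alpha_exp; lia.
have Xc : X c.-1 by move: h1; case/orP => //; lia.
have hc : c' <= c.-1 by lia.
have hc' : c.-1 < c by lia.
have := count_a_lt hc hc' Xc; have := @count_a_j c hA; move: lp; rewrite /beta_exp; lia.
Qed.

Lemma corner_inb c : count_a n.+1 = j -> corner c -> 0 < c <= n ->
  (beta_exp c < j) && (j + alpha_exp c <= n).
Proof.
move=> hA /and3P[cn h1 h2] hc; have bj := count_a_j hA cn; have bc := count_a_le c.
have Xc : X c.-1 by move: h1; case/orP => //; lia.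
have hc1 : c.-1 <= c.-1 by []. have hc2 : c.-1 < c by lia.
have l1 := count_a_lt hc1 hc2 Xc.
have Yc : ~~ X c by move: h2; case/orP => //; lia.
have hc3 : c < n.+1 by lia.
have := count_b_lt (leqnn c) hc3 Yc; rewrite hA /beta_exp /alpha_exp; lia.
Qed.

(** The corners generate the region. The walk at content j + Q - P lies
    below (P, Q); from there, going back over letters b or forward over
    letters a decreases one exponent and keeps the other. *)
Lemma corner_below P Q : count_a n.+1 = j -> P < j -> j + Q <= n ->
  j <= P + count_a (j + Q - P) ->
  exists c, [/\ corner c, 0 < c <= n, beta_exp c <= P & alpha_exp c <= Q].
Proof.
move=> hA hP hQ; set v := j + Q - P => hF; have v0 : 0 < v by lia.
have vn : v <= n.+1 by lia.
have pv : beta_exp v <= P by rewrite /beta_exp; lia.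
have qv : alpha_exp v <= Q by rewrite /alpha_exp; lia.
have [h1 h2 h3] := left_cornerP v.
(* the last letter read is b, or else it is a *)
have [lt|ge] := ltnP (left_corner v) v.
  have e : count_a v = count_a (left_corner v) := count_a_const h1 h3.
  have l0 : 0 < left_corner v.
    by rewrite lt0n; apply/negP => /eqP l0; move: pv; rewrite /beta_exp e l0 count_a0; lia.
  exists (left_corner v); split.
  - by rewrite /corner h2 h3 //= orbT andbT; lia.
  - lia.
  - by rewrite /beta_exp -e.
  by apply: leq_trans qv; apply: alpha_exp_mono.
have ev : left_corner v = v by lia.
have Xv : X v.-1 by move: h2; rewrite ev; case/orP => //; lia.
have [|/andP[g1 g1'] g2 g3] := @right_cornerP v; first lia.
have eq : alpha_exp (right_corner v) = alpha_exp v.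
  by have := count_a_run g1 g3; have := count_a_le v; rewrite /alpha_exp; lia.
have rn : right_corner v <= n.
  rewrite leqNgt; apply/negP => gt; have e : right_corner v = n.+1 by lia.
  by move: qv; rewrite -eq e /alpha_exp hA; lia.
exists (right_corner v); split; last by rewrite eq.
- rewrite /corner g2 g1' andbT /=; apply/orP; right.
  have [e|ne] := eqVneq (right_corner v) v; first by rewrite e.
  by apply: g3; lia.
- by lia.
by apply: leq_trans pv; apply: beta_exp_anti.
Qed.

Lemma right_corner_inj c c' : valley c -> valley c' -> right_corner c = right_corner c' ->
  c' = c.
Proof.
have aux a b : valley a -> valley b -> a < b -> right_corner a <> right_corner b.
  move=> va vb lt e; have [|_ _ h] := @right_cornerP a; first by case/and4P: va; lia.
  have /and4P[_ _ Xb _] := vb; have [_ lb _ _] := right_corner_spec vb.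
  by move: Xb; rewrite h //; lia.
move=> vc vc' e; case: (ltngtP c c') => // lt.
  by case: (aux _ _ vc vc' lt).
by case: (aux _ _ vc' vc lt).
Qed.

Lemma left_corner_inj c c' : valley c -> valley c' -> left_corner c = left_corner c' -> c' = c.
Proof.
have aux a b : valley a -> valley b -> a < b -> left_corner a <> left_corner b.
  move=> va vb lt e; have [_ _ h] := left_cornerP b.
  have /and4P[_ _ _ Xa] := va; have [_ la _] := left_corner_spec va.
  by have := h a; rewrite Xa -e => /(_ (ltnW la) lt).
move=> vc vc' e; case: (ltngtP c c') => // lt.
  by case: (aux _ _ vc vc' lt).
by case: (aux _ _ vc' vc lt).
Qed.

(** The corner on the axis without alpha, which may be the one at 0. *)
Lemma corner_low : exists c, [/\ corner c, alpha_exp c = 0, count_a c = c & beta_exp c <= j].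
Proof.
have [|h1 h2 h3] := @right_cornerP 0; first by [].
have e := count_a_run (leq0n _) h3; rewrite count_a0 add0n subn0 in e.
exists (right_corner 0); split; rewrite /alpha_exp /beta_exp ?e ?subnn //; last by lia.
rewrite /corner h2 andbT; apply/andP; split; first by lia.
by case: (posnP (right_corner 0)) => [-> //|r0]; rewrite h3 ?orbT //; lia.
Qed.

(** The corner on the axis without beta, which may be the one at n + 1. *)
Lemma corner_high : count_a n.+1 = j -> exists c, [/\ corner c, count_a c = j & beta_exp c = 0].
Proof.
move=> hA; have [h1 h2 h3] := left_cornerP n.+1; have e := count_a_const h1 h3; rewrite hA in e.
exists (left_corner n.+1); split; rewrite /beta_exp -?e ?subnn //.
rewrite /corner h2 h1 /=; case: (ltngtP (left_corner n.+1) n.+1) => // [lt|]; last lia.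
exact: h3.
Qed.

End Walk.

Local Open Scope ring_scope.

(** * Path coefficients on the preprojective algebra *)

Section PathCalculus.
Variables (K : fieldType) (n : nat).
Local Notation Q := (double_A n).
Local Notation KQ := (path_algebra K Q).
Local Notation A := (preproj K n).
Local Notation pi := (ba_pi (@preproj_rel K n)).

Definition is_beta (a : arrow Q) : bool := if a is inr _ then true else false.
Definition nbeta (x : qpath Q) : nat := count is_beta (val x).2.
Definition nalpha (x : qpath Q) : nat := count (predC is_beta) (val x).2.

(** Both counts together determine the target from the source. *)
Lemma path_balance (x : qpath Q) :
  (psrc x + nalpha x = ptgt x + nbeta x :> nat)%N.
Proof.
rewrite /psrc /ptgt /nalpha /nbeta; case: x => -[v p] /=.
elim: p v => [|a p IHp] v //= /andP[/eqP <- /IHp]; case: a => i /=; lia.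
Qed.

(** Outside of the bounds a path vanishes in the algebra, although it may
    well exist in the quiver, and its weight has to vanish too. *)
Definition path_weight (c p q : nat) (x : qpath Q) : K :=
  [&& (psrc x).+1 == c, nbeta x == p, nalpha x == q, (p < c)%N & (c + q <= n)%N]%:R.

(** The linear functional that counts the paths from c with p letters beta
    and q letters alpha. *)
Definition kcoef c p q (f : KQ) : K :=
  @pa_ext K Q K^o f (path_weight c p q).

Lemma kcoefD c p q f g : kcoef c p q (f + g) = kcoef c p q f + kcoef c p q g.
Proof. exact: (@pa_extD K Q K^o). Qed.
Lemma kcoefZ c p q a f : kcoef c p q (a *: f) = a * kcoef c p q f.
Proof. exact: (@pa_extZ K Q K^o). Qed.
Lemma kcoefB c p q f g : kcoef c p q (f - g) = kcoef c p q f - kcoef c p q g.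
Proof. by rewrite kcoefD -scaleN1r kcoefZ mulN1r. Qed.
(** Sealing the path stops conversion from computing with the finitely
    supported function behind it; the same is done below for the elements of
    the algebra. *)
Fact lpath_seal : {f : qpath Q -> KQ | forall x, f x = pa_path K x}.
Proof. by exists (@pa_path K Q). Qed.
Definition lpath : qpath Q -> KQ := sval lpath_seal.
Lemma lpathE x : lpath x = pa_path K x. Proof. exact: (svalP lpath_seal). Qed.

Lemma kcoef_path c p q x : kcoef c p q (lpath x) = path_weight c p q x.
Proof. by rewrite lpathE; exact: (@pa_ext_path K Q K^o). Qed.
Lemma kcoef0 c p q : kcoef c p q 0 = 0.
Proof. exact: (@pa_ext0 K Q K^o). Qed.

Lemma lpath_mul (x y : qpath Q) :
  lpath x * lpath y = pa_comp K x y.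
Proof. by rewrite !lpathE -[LHS]/(pa_mul _ _) pa_mulE !pa_ext_path. Qed.

Lemma pa_span (U : KQ -> Prop) :
  U 0 -> (forall f g, U f -> U g -> U (f + g)) ->
  (forall a x, U (a *: lpath x)) -> forall f, U f.
Proof.
move=> U0 UD UZ f; rewrite -[f]pa_ext_id /pa_ext.
by elim/big_ind: _ => // x _; rewrite -lpathE.
Qed.

Lemma path_mulP (x y : qpath Q) : ptgt x = psrc y ->
  exists z, [/\ lpath x * lpath y = lpath z, psrc z = psrc x, ptgt z = ptgt y,
    nbeta z = (nbeta x + nbeta y)%N & nalpha z = (nalpha x + nalpha y)%N].
Proof.
move=> exy; have [z ez vz] := pconcatP exy; exists z; split.
- by rewrite lpath_mul /pa_comp ez lpathE.
- exact: psrc_concat ez.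
- exact: ptgt_concat ez.
- by rewrite /nbeta vz count_cat.
- by rewrite /nalpha vz count_cat.
Qed.

Lemma path_mul0 (x y : qpath Q) : ptgt x != psrc y -> lpath x * lpath y = 0.
Proof. by move=> nxy; rewrite lpath_mul /pa_comp /pconcat (negPf nxy). Qed.

Lemma src_arrow a : psrc (@arrow_path Q a) = src a. Proof. by []. Qed.
Lemma tgt_arrow a : ptgt (@arrow_path Q a) = tgt a. Proof. by []. Qed.

Lemma arrow_mulP (a b : arrow Q) : tgt a = src b ->
  exists z, [/\ lpath (@arrow_path Q a) * lpath (@arrow_path Q b) = lpath z,
    psrc z = src a, ptgt z = tgt b, nbeta z = (is_beta a + is_beta b)%N
    & nalpha z = (~~ is_beta a + ~~ is_beta b)%N].
Proof.
move=> e; have [z [e1 e2 e3 e4 e5]] := @path_mulP (arrow_path a) (arrow_path b) e.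
by exists z; split=> //; rewrite ?e2 ?e3 ?e4 ?e5 // /nbeta /nalpha /= !addn0.
Qed.

Lemma kcoef_mul0 c p q f g : f = 0 -> kcoef c p q (f * g) = 0.
Proof. by move=> ->; rewrite mul0r kcoef0. Qed.
Lemma kcoef_mulE c p q f g h k : f = g -> g * h = k -> kcoef c p q (f * h) = kcoef c p q k.
Proof. by move=> -> ->. Qed.

(** The two terms of a relation are closed paths z of length two. The value
    depends on z only through its source and its counts. *)
Lemma kcoef_xzy c p q (x y z : qpath Q) : psrc z = ptgt z ->
  kcoef c p q (lpath x * lpath z * lpath y) =
  if (ptgt x == psrc z) && (ptgt x == psrc y) then
   [&& (psrc x).+1 == c, nbeta x + nbeta z + nbeta y == p,
     nalpha x + nalpha z + nalpha y == q, p < c & c + q <= n]%N%:R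
  else 0.
Proof.
move=> ez; have [e|ne] := eqVneq (ptgt x) (psrc z); last first.
  exact: kcoef_mul0 (path_mul0 ne).
have [t [et st tt bt at_]] := path_mulP e.
have [e2|ne] := eqVneq (ptgt x) (psrc y) => /=; last first.
  rewrite (kcoef_mulE _ _ _ et (path_mul0 _)) ?kcoef0 //.
  by rewrite tt -ez -e.
have [|s [es ss _ bs as_]] := @path_mulP t y; first by rewrite tt -ez -e.
by rewrite (kcoef_mulE _ _ _ et es) kcoef_path /path_weight ss st bs bt as_ at_.
Qed.

(** The terms of an inner relation have equal sources and counts. At the two
    ends of the quiver, the balance of the path x shows that the product is
    out of bounds. *)
Lemma kcoef_rel_path c p q (x y : qpath Q) r :
  preproj_rel r -> kcoef c p q (lpath x * r * lpath y) = 0.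
Proof.
case=> [i j ij|i i0|i il].
- have [z [ez sz tz bz az]] := @arrow_mulP (inr i) (inl i) erefl.
  have [z' [ez' sz' tz' bz' az']] := @arrow_mulP (inl j) (inr j) erefl.
  have eij : vlow j = vhigh i by apply: val_inj; rewrite /= ij.
  rewrite [X in _ * X * _](_ : _ = lpath z - lpath z'); last first.
    by rewrite -ez -ez' !lpathE.
  rewrite mulrBr mulrBl kcoefB.
  rewrite [X in X - _](kcoef_xzy c p q x y (etrans sz (esym tz))).
  rewrite [X in _ - X](kcoef_xzy c p q x y (etrans sz' (esym tz'))).
  by rewrite sz sz' bz bz' az az' /= eij subrr.
- have [z [ez sz tz bz az]] := @arrow_mulP (inl i) (inr i) erefl.
  rewrite [X in _ * X * _](_ : _ = lpath z); last by rewrite -ez !lpathE.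
  rewrite kcoef_xzy ?sz ?tz // bz az; case: eqP => //= e; case: eqP => //= _.
  case: (_ =P c) => //= <-; case: (_ =P p) => //= <-; case: (_ =P q) => //= <-.
  have := path_balance x; rewrite e /= i0 => ex.
  by rewrite (_ : (_ < _)%N = false) //; apply/negbTE; lia.
- have [z [ez sz tz bz az]] := @arrow_mulP (inr i) (inl i) erefl.
  rewrite [X in _ * X * _](_ : _ = lpath z); last by rewrite -ez !lpathE.
  rewrite kcoef_xzy ?sz ?tz // bz az; case: eqP => //= e; case: eqP => //= _.
  case: (_ =P c) => //= <-; case: (_ =P p) => //= <-; case: (_ =P q) => //= <-.
  have := path_balance x; rewrite e /= il => ex.
  have := ltn_ord (vhigh i); rewrite /= il => hn.
  rewrite [X in _ && X](_ : _ = false) ?andbF //; apply/negbTE; lia.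
Qed.

Lemma kcoef_rel c p q u r v : preproj_rel r -> kcoef c p q (u * r * v) = 0.
Proof.
move=> rel_r.
elim/pa_span: u => [|f g hf hg|a x]; first by rewrite !mul0r kcoef0.
  by rewrite !mulrDl kcoefD hf hg addr0.
rewrite -!pa_scaleAl kcoefZ; apply/eqP; rewrite mulf_eq0; apply/orP; right; apply/eqP.
elim/pa_span: v => [|f g hf hg|b y]; first by rewrite !mulr0 kcoef0.
  by rewrite !mulrDr kcoefD hf hg addr0.
rewrite -!pa_scaleAr kcoefZ; apply/eqP; rewrite mulf_eq0; apply/orP; right; apply/eqP.
exact: kcoef_rel_path.
Qed.

Lemma kcoef_ideal c p q f : ideal_gen (@preproj_rel K n) f -> kcoef c p q f = 0.
Proof.
elim=> {f} [f [u [r [v [Sr ->]]]]| |f g _ hf _ hg]; first exact: kcoef_rel.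
  exact: kcoef0.
by rewrite kcoefB hf hg subr0.
Qed.

(** The functional descends to the algebra because it kills the relations. *)
Definition pcoef c p q (x : A) : K := kcoef c p q (repr x).

Lemma pcoef_pi c p q f : pcoef c p q (pi f) = kcoef c p q f.
Proof.
have := kcoef_ideal c p q (ba_reprP (@preproj_rel K n) f).
by rewrite kcoefB => /eqP; rewrite subr_eq0 => /eqP ->.
Qed.

Lemma pcoefD c p q x y : pcoef c p q (x + y) = pcoef c p q x + pcoef c p q y.
Proof.
elim/ba_ind: x => x; elim/ba_ind: y => y.
by rewrite -ba_piD !pcoef_pi kcoefD.
Qed.
Lemma pcoefZ c p q a x : pcoef c p q (a *: x) = a * pcoef c p q x.
Proof. by elim/ba_ind: x => x; rewrite -ba_pi_scale !pcoef_pi kcoefZ. Qed.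

Lemma pcoef_oob c p q x : ~~ ((p < c) && (c + q <= n))%N -> pcoef c p q x = 0.
Proof.
move=> h; elim/ba_ind: x => x; rewrite pcoef_pi.
elim/pa_span: x => [|f g hf hg|a x]; rewrite ?kcoef0 // ?kcoefD ?hf ?hg ?addr0 //.
by rewrite kcoefZ kcoef_path /path_weight (negPf h) !andbF mulr0.
Qed.

(** Natural numbers as vertices, with zero idempotents outside of the
    quiver, make e_c alpha = alpha e_(c+1) hold for every c. *)
Fact en_seal : {e : nat -> A | forall c, e c = \sum_(i < n | i.+1 == c :> nat) idem K i}.
Proof. by eexists. Qed.
Definition vertex_idem : nat -> A := sval en_seal.
Local Notation en := vertex_idem.
Lemma en_sumE c : en c = \sum_(i < n | i.+1 == c :> nat) idem K i.
Proof. exact: (svalP en_seal). Qed.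

Lemma pi_sum (I : Type) (r : seq I) (P : pred I) (F : I -> KQ) :
  pi (\sum_(i <- r | P i) F i) = \sum_(i <- r | P i) pi (F i).
Proof.
apply: (big_morph _ (id1 := 0) (op1 := +%R)) => [x y|]; first exact: ba_piD.
by have := ba_piB (@preproj_rel K n) 0 0; rewrite !subrr.
Qed.

Lemma pi0 : pi 0 = 0.
Proof. by have := ba_piB (@preproj_rel K n) 0 0; rewrite !subrr. Qed.

Lemma en_oob c : ~~ ((0 < c) && (c <= n))%N -> en c = 0.
Proof.
move=> h; rewrite en_sumE big_pred0 // => i; apply/negP => /eqP e; move/negP: h; apply.
by rewrite -e /= ltn_ord.
Qed.

Lemma enE (i : 'I_n) : en i.+1 = idem K i.
Proof. by rewrite en_sumE (big_pred1 i) // => j; rewrite eqSS. Qed.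

Lemma sum_en : \sum_(i < n) en i.+1 = 1 :> A.
Proof.
under eq_bigr do rewrite enE.
rewrite -ba_pi1 -[1]/(pa_one K Q) pa_oneE pi_sum.
by apply: eq_bigr.
Qed.

Lemma en0 : en 0 = 0. Proof. exact: en_oob. Qed.

Lemma en_vertex c : en c = 0 \/ exists2 i : 'I_n, c = i.+1 & en c = idem K i.
Proof.
have [|/en_oob ->] := boolP ((0 < c) && (c <= n))%N; last by left.
case: c => // c /= h; right; exists (Ordinal h) => //; exact: (enE (Ordinal h)).
Qed.

Lemma idemE i : idem K i = pi (lpath (@stationary Q i)).
Proof. by rewrite lpathE. Qed.

Lemma stationary_mul i x : lpath (@stationary Q i) * lpath x =
  if i == psrc x then lpath x else 0.
Proof.
case: (eqVneq i (psrc x)) => [->|ne]; last by rewrite path_mul0.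
rewrite lpath_mul /pa_comp /pconcat eqxx insubT /=.
  by case: (x) => -[].
move=> h; rewrite lpathE; congr (pa_path K _); apply: val_inj => /=.
by rewrite /psrc; case: (x) => -[].
Qed.

Lemma mul_stationary i x : lpath x * lpath (@stationary Q i) =
  if ptgt x == i then lpath x else 0.
Proof.
case: (eqVneq (ptgt x) i) => [<-|ne]; last by rewrite path_mul0.
rewrite lpath_mul /pa_comp /pconcat eqxx insubT /=.
  by case: (x) => -[v w] /=; rewrite cats0.
move=> h; rewrite lpathE; congr (pa_path K _); apply: val_inj => /=.
by rewrite cats0; case: (x) => -[].
Qed.

Lemma idemM (i j : 'I_n) : idem K i * idem K j = if i == j then idem K i else 0.
Proof.
rewrite !idemE -ba_pi_mul stationary_mul /psrc /=.
by case: eqP => [<-|]; rewrite ?pi0.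
Qed.

Lemma enM c d : en c * en d = if c == d then en c else 0.
Proof.
have [ec|[i ec ->]] := en_vertex c; first by rewrite ec mul0r if_same.
have [ed|[j -> ->]] := en_vertex d; last by rewrite ec idemM eqSS.
rewrite ed mulr0; case: eqP => // ecd; move: ed.
by rewrite -ecd ec enE.
Qed.

Fact earrow_seal : {f : arrow Q -> A | forall a, f a = pi (lpath (@arrow_path Q a))}.
Proof. by eexists. Qed.
Definition earrow : arrow Q -> A := sval earrow_seal.
Lemma earrowE a : earrow a = pi (lpath (@arrow_path Q a)).
Proof. exact: (svalP earrow_seal). Qed.

Lemma idem_arrow (i : 'I_n) (a : arrow Q) :
  idem K i * earrow a = if i == src a then earrow a else 0.
Proof.
rewrite idemE earrowE -ba_pi_mul stationary_mul src_arrow.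
by case: ifP; rewrite ?pi0.
Qed.
Lemma arrow_idem (i : 'I_n) (a : arrow Q) :
  earrow a * idem K i = if tgt a == i then earrow a else 0.
Proof.
rewrite idemE earrowE -ba_pi_mul mul_stationary tgt_arrow.
by case: ifP; rewrite ?pi0.
Qed.

Fact al_seal : {x : A | x = \sum_(i < n.-1) earrow (inl i)}. Proof. by eexists. Qed.
Definition alpha_sum : A := sval al_seal.
Local Notation al := alpha_sum.
Lemma alE : al = \sum_(i < n.-1) earrow (inl i). Proof. exact: (svalP al_seal). Qed.
Fact be_seal : {x : A | x = \sum_(i < n.-1) earrow (inr i)}. Proof. by eexists. Qed.
Definition beta_sum : A := sval be_seal.
Local Notation be := beta_sum.
Lemma beE : be = \sum_(i < n.-1) earrow (inr i). Proof. exact: (svalP be_seal). Qed.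

Lemma en_al c : en c * al = \sum_(i < n.-1 | i.+1 == c :> nat) earrow (inl i).
Proof.
rewrite alE mulr_sumr [RHS]big_mkcond; apply: eq_bigr => i _.
have [ec|[j -> ->]] := en_vertex c; last first.
  by rewrite idem_arrow -val_eqE /= eqSS eq_sym.
rewrite ec mul0r; case: eqP => // e; move: ec; rewrite -e.
move: (enE (vlow i)) => /= -> ei.
by move: (idem_arrow (vlow i) (inl i)); rewrite /= eqxx ei mul0r.
Qed.

Lemma al_en c : al * en c = \sum_(i < n.-1 | i.+2 == c :> nat) earrow (inl i).
Proof.
rewrite alE mulr_suml [RHS]big_mkcond; apply: eq_bigr => i _.
have [ec|[j -> ->]] := en_vertex c; last first.
  by rewrite arrow_idem -val_eqE /= eqSS.
rewrite ec mulr0; case: eqP => // e; move: ec; rewrite -e.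
move: (enE (vhigh i)) => /= -> ei.
by move: (arrow_idem (vhigh i) (inl i)); rewrite /= eqxx ei mulr0.
Qed.

Lemma en_be c : en c * be = \sum_(i < n.-1 | i.+2 == c :> nat) earrow (inr i).
Proof.
rewrite beE mulr_sumr [RHS]big_mkcond; apply: eq_bigr => i _.
have [ec|[j -> ->]] := en_vertex c; last first.
  by rewrite idem_arrow -val_eqE /= eqSS eq_sym.
rewrite ec mul0r; case: eqP => // e; move: ec; rewrite -e.
move: (enE (vhigh i)) => /= -> ei.
by move: (idem_arrow (vhigh i) (inr i)); rewrite /= eqxx ei mul0r.
Qed.

Lemma be_en c : be * en c = \sum_(i < n.-1 | i.+1 == c :> nat) earrow (inr i).
Proof.
rewrite beE mulr_suml [RHS]big_mkcond; apply: eq_bigr => i _.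
have [ec|[j -> ->]] := en_vertex c; last first.
  by rewrite arrow_idem -val_eqE /= eqSS.
rewrite ec mulr0; case: eqP => // e; move: ec; rewrite -e.
move: (enE (vlow i)) => /= -> ei.
by move: (arrow_idem (vlow i) (inr i)); rewrite /= eqxx ei mulr0.
Qed.

Lemma en_al_comm c : en c * al = al * en c.+1.
Proof. by rewrite en_al al_en; apply: eq_bigl => i; rewrite eqSS. Qed.
Lemma en_be_comm c : en c.+1 * be = be * en c.
Proof. by rewrite en_be be_en; apply: eq_bigl => i; rewrite eqSS. Qed.

End PathCalculus.

(** * The monomial basis *)

Section Monomials.
Variables (K : fieldType) (n : nat).
Local Notation Q := (double_A n).
Local Notation A := (preproj K n).
Local Notation pi := (ba_pi (@preproj_rel K n)).
Local Notation al := (alpha_sum K n).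
Local Notation be := (beta_sum K n).
Local Notation en := (vertex_idem K n).
Local Notation earrow := (@earrow K n).
Local Notation lpath := (@lpath K n).

Lemma pi_rel0 r : preproj_rel r -> pi r = 0.
Proof.
move=> rel_r; rewrite -(@pi0 K n); apply: (proj1 (ba_piP _ _ _)).
rewrite subr0; apply: addspan_gen; exists 1, r, 1; split=> //.
by rewrite mul1r mulr1.
Qed.

Lemma earrow_mid (i j : 'I_n.-1) : j = i.+1 :> nat ->
  earrow (inl j) * earrow (inr j) = earrow (inr i) * earrow (inl i).
Proof.
move=> /(preproj_rel_mid K)/pi_rel0; rewrite /pa_alpha /pa_beta -!lpathE !earrowE ba_piB.
by rewrite [X in X - _]ba_pi_mul [X in _ - X]ba_pi_mul => /eqP; rewrite subr_eq0 => /eqP ->.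
Qed.
Lemma earrow_first (i : 'I_n.-1) : i = 0%N :> nat ->
  earrow (inl i) * earrow (inr i) = 0.
Proof.
move=> /(preproj_rel_first K)/pi_rel0; rewrite /pa_alpha /pa_beta -!lpathE !earrowE.
by rewrite ba_pi_mul.
Qed.
Lemma earrow_last (i : 'I_n.-1) : i.+1 = n.-1 ->
  earrow (inr i) * earrow (inl i) = 0.
Proof.
move=> /(preproj_rel_last K)/pi_rel0; rewrite /pa_alpha /pa_beta -!lpathE !earrowE.
by rewrite ba_pi_mul.
Qed.

Lemma earrow_tgt a : earrow a = earrow a * en (tgt a).+1.
Proof. by rewrite enE arrow_idem eqxx. Qed.

Lemma en_al_be c :
  en c * al * be = \sum_(i < n.-1 | i.+1 == c :> nat) earrow (inl i) * earrow (inr i).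
Proof.
rewrite en_al mulr_suml; apply: eq_bigr => i _.
rewrite {1}earrow_tgt -mulrA en_be /=.
by rewrite (big_pred1 i) // => j; rewrite !eqSS.
Qed.
Lemma en_be_al c :
  en c * be * al = \sum_(i < n.-1 | i.+2 == c :> nat) earrow (inr i) * earrow (inl i).
Proof.
rewrite en_be mulr_suml; apply: eq_bigr => i _.
rewrite {1}earrow_tgt -mulrA en_al /=.
by rewrite (big_pred1 i) // => j; rewrite !eqSS.
Qed.

(** The boundary relations appear as the cases where one side is an empty
    sum. *)
Lemma en_albe c : en c * al * be = en c * be * al.
Proof.
rewrite en_al_be en_be_al; case: c => [|[|c]]; first by rewrite !big_pred0.
  by rewrite [RHS]big_pred0 // big1 // => i /eqP [e]; rewrite earrow_first.
have [h|h] := ltnP c.+1 n.-1.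
  rewrite (big_pred1 (Ordinal h)) => [|i]; last by rewrite eqSS.
  have h' := ltnW h; rewrite (big_pred1 (Ordinal h')) => [|i].
    by rewrite (earrow_mid (i := Ordinal h')).
  by rewrite !eqSS.
rewrite big_pred0 => [|i]; last by have := ltn_ord i; lia.
rewrite big1 // => i /eqP ei; rewrite earrow_last //.
by have := ltn_ord i; lia.
Qed.

Lemma al_be : al * be = be * al.
Proof.
rewrite -[LHS]mul1r -[RHS]mul1r -(@sum_en K n) !mulr_suml.
by apply: eq_bigr => i _; rewrite !mulrA en_albe.
Qed.

Lemma en_alX c q : en c * al ^+ q = al ^+ q * en (c + q).
Proof.
elim: q => [|q IH]; first by rewrite !expr0 addn0 mul1r mulr1.
by rewrite exprSr mulrA IH -mulrA en_al_comm addnS mulrA.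
Qed.
Lemma en_beX c p : en (c + p) * be ^+ p = be ^+ p * en c.
Proof.
elim: p => [|p IH] in c *; first by rewrite !expr0 addn0 mul1r mulr1.
by rewrite addnS -addSn exprSr mulrA IH -mulrA en_be_comm mulrA.
Qed.

Lemma al_beX p q : al ^+ q * be ^+ p = be ^+ p * al ^+ q.
Proof. by apply: commrX; apply/commr_sym/commrX/esym/al_be. Qed.

Definition monomial c p q : A := en c * be ^+ p * al ^+ q.
Local Notation mono := monomial.
Local Notation inb := (in_bounds n).

Lemma mono_al c p q : mono c p q * al = mono c p q.+1.
Proof. by rewrite /monomial exprSr mulrA. Qed.
Lemma mono_be c p q : mono c p q * be = mono c p.+1 q.
Proof.
by rewrite /monomial -mulrA -[be in LHS]expr1 al_beX expr1 exprSr !mulrA.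
Qed.
Lemma mono_alX c p q q' : mono c p q * al ^+ q' = mono c p (q + q').
Proof. by elim: q' => [|k IH]; rewrite ?mulr1 ?addn0 // exprSr mulrA IH mono_al addnS. Qed.
Lemma mono_beX c p q p' : mono c p q * be ^+ p' = mono c (p + p') q.
Proof. by elim: p' => [|k IH]; rewrite ?mulr1 ?addn0 // exprSr mulrA IH mono_be addnS. Qed.
Lemma mono00 c : mono c 0 0 = en c. Proof. by rewrite /monomial !mulr1. Qed.

(** A power of an arrow sum moves e_c past an end of the quiver, where the
    idempotent is zero. *)
Lemma mono_oob c p q : ~~ inb c p q -> mono c p q = 0.
Proof.
rewrite /in_bounds negb_and -leqNgt -ltnNge => /orP[h|h].
  rewrite /monomial -{1}(subnKC (leq0n c)) subn0.
  (* e_c beta^c = beta^c e_0 = 0 *)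
  have -> : be ^+ p = be ^+ c * be ^+ (p - c) by rewrite -exprD subnKC.
  by rewrite !mulrA en_beX en0 mulr0 !mul0r.
rewrite /monomial -mulrA -al_beX mulrA en_alX en_oob ?mulr0 ?mul0r //.
by apply/negP; lia.
Qed.

Lemma mono_tgt c p q : (p <= c)%N -> mono c p q = be ^+ p * al ^+ q * en (c - p + q).
Proof. by move=> h; rewrite /monomial -{1}(subnK h) en_beX -mulrA en_alX mulrA. Qed.

Lemma mono_en c p q d : mono c p q * en d = if (d + p == c + q)%N then mono c p q else 0.
Proof.
have [hb|/mono_oob ->] := boolP (inb c p q); last by rewrite mul0r if_same.
have /andP[hp hq] := hb; rewrite mono_tgt 1?ltnW // -mulrA enM.
have -> : (d + p == c + q)%N = (c - p + q == d)%N by apply/eqP/eqP; lia.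
by case: eqP => // _; rewrite mulr0.
Qed.

Lemma en_mono d c p q : en d * mono c p q = if d == c then mono c p q else 0.
Proof. by rewrite /monomial !mulrA enM; case: eqP => [->|]; rewrite ?mul0r. Qed.

Lemma monoM c p q d p' q' :
  mono c p q * mono d p' q' = if (d + p == c + q)%N then mono c (p + p') (q + q') else 0.
Proof.
rewrite {2}/monomial !mulrA mono_en; case: eqP => _; last by rewrite !mul0r.
by rewrite mono_beX mono_alX.
Qed.

Lemma pcoef_sum c p q (I : Type) (r : seq I) (P : pred I) (F : I -> A) :
  pcoef c p q (\sum_(i <- r | P i) F i) = \sum_(i <- r | P i) pcoef c p q (F i).
Proof.
apply: (big_morph _ (id1 := 0) (op1 := +%R)) => [x y|]; first exact: pcoefD.
by rewrite -[0 in LHS](scale0r (1 : A)) pcoefZ mul0r.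
Qed.
Lemma pcoef0 c p q : pcoef c p q (0 : A) = 0.
Proof. by rewrite -[0 in LHS](scale0r (1 : A)) pcoefZ mul0r. Qed.
Lemma pcoefN c p q (x : A) : pcoef c p q (- x) = - pcoef c p q x.
Proof. by rewrite -[- x]scaleN1r pcoefZ mulN1r. Qed.
Lemma pcoefB c p q (x y : A) : pcoef c p q (x - y) = pcoef c p q x - pcoef c p q y.
Proof. by rewrite pcoefD pcoefN. Qed.

Lemma A_span (U : A -> Prop) :
  U 0 -> (forall f g, U f -> U g -> U (f + g)) ->
  (forall a x, U (a *: pi (lpath x))) -> forall f, U f.
Proof.
move=> U0 UD UZ; elim/ba_ind=> f.
elim/(@pa_span K n): f => [|f g hf hg|a x]; first by rewrite pi0.
  by rewrite ba_piD; apply: UD.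
by rewrite ba_pi_scale; apply: UZ.
Qed.

Lemma pcoef_path c p q x : pcoef c p q (pi (lpath x)) = path_weight K c p q x.
Proof. by rewrite pcoef_pi kcoef_path. Qed.

(** On a path, multiplying by alpha appends the one arrow that starts at its
    target; the balance shows that this arrow exists in bounds. *)
Lemma pcoef_al c p q (x : A) :
  pcoef c p q (x * al) = if (0 < q)%N && inb c p q then pcoef c p q.-1 x else 0.
Proof.
elim/A_span: x => [|f g hf hg|a x]; first by rewrite mul0r !pcoef0 if_same.
  by rewrite mulrDl 2!pcoefD hf hg; case: ifP; rewrite ?addr0.
rewrite -ba_scaleAl !pcoefZ pcoef_path.
transitivity (a * (if (0 < q)%N && inb c p q then path_weight K c p q.-1 x else 0)); last first.
  by case: ifP; rewrite ?mulr0.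
congr (_ * _); rewrite alE mulr_sumr pcoef_sum.
transitivity (\sum_(i < n.-1) if (ptgt x == i :> nat) then
    path_weight K c p q.-1 x *+ ((0 < q)%N && inb c p q) else 0).
  apply: eq_bigr => i _; rewrite earrowE -ba_pi_mul.
  have [e|ne] := eqVneq (ptgt x) (vlow i); last first.
    rewrite path_mul0 // pi0 pcoef0 (_ : (ptgt x == i :> nat) = false) //.
    by apply/negbTE; move: ne; rewrite -val_eqE.
  have [z [-> sz tz bz az]] := @path_mulP K n x (@arrow_path Q (inl i)) e.
  rewrite pcoef_path /path_weight sz bz az e eqxx /nbeta /nalpha /= addn0 addn1 /in_bounds.
  by rewrite -mulrnA mulnb; congr (_%:R); lia.
case: ifP => [/andP[q0 /andP[hp hq]]|_]; last by rewrite big1 // => i _; case: ifP.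
have [/and3P[/eqP sx /eqP bx /eqP ax]|nx]
  := boolP [&& (psrc x).+1 == c, nbeta x == p & nalpha x == q.-1].
  have bal := path_balance x; have h : (ptgt x < n.-1)%N by lia.
  rewrite (bigD1 (Ordinal h)) //= eqxx big1 ?addr0 // => i.
  by rewrite -val_eqE /= eq_sym => /negbTE ->.
rewrite /path_weight big1 => [|i _]; last first.
  by case: ifP => // _; case: and5P => // -[h1 h2 h3]; move/negP: nx; case; apply/and3P.
by case: and5P => // -[h1 h2 h3]; move/negP: nx; case; apply/and3P.
Qed.

Lemma pcoef_be c p q (x : A) :
  pcoef c p q (x * be) = if (0 < p)%N && inb c p q then pcoef c p.-1 q x else 0.
Proof.
elim/A_span: x => [|f g hf hg|a x]; first by rewrite mul0r !pcoef0 if_same.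
  by rewrite mulrDl 2!pcoefD hf hg; case: ifP; rewrite ?addr0.
rewrite -ba_scaleAl !pcoefZ pcoef_path.
transitivity (a * (if (0 < p)%N && inb c p q then path_weight K c p.-1 q x else 0)); last first.
  by case: ifP; rewrite ?mulr0.
congr (_ * _); rewrite beE mulr_sumr pcoef_sum.
transitivity (\sum_(i < n.-1) if (ptgt x == i.+1 :> nat) then
    path_weight K c p.-1 q x *+ ((0 < p)%N && inb c p q) else 0).
  apply: eq_bigr => i _; rewrite earrowE -ba_pi_mul.
  have [e|ne] := eqVneq (ptgt x) (vhigh i); last first.
    rewrite path_mul0 // pi0 pcoef0 (_ : (ptgt x == i.+1 :> nat) = false) //.
    by apply/negbTE; move: ne; rewrite -val_eqE.
  have [z [-> sz tz bz az]] := @path_mulP K n x (@arrow_path Q (inr i)) e.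
  rewrite pcoef_path /path_weight sz bz az e eqxx /nbeta /nalpha /= addn0 addn1 /in_bounds.
  by rewrite -mulrnA mulnb; congr (_%:R); lia.
case: ifP => [/andP[q0 /andP[hp hq]]|_]; last by rewrite big1 // => i _; case: ifP.
have [/and3P[/eqP sx /eqP bx /eqP ax]|nx]
  := boolP [&& (psrc x).+1 == c, nbeta x == p.-1 & nalpha x == q].
  have bal := path_balance x; have h : ((ptgt x).-1 < n.-1)%N by have := ltn_ord (ptgt x); lia.
  rewrite (bigD1 (Ordinal h)) //= ifT ?big1 ?addr0 // => [i|]; last lia.
  by rewrite -val_eqE /= => ni; case: eqP => // ei; move: ni; rewrite ei /= eqxx.
rewrite /path_weight big1 => [|i _]; last first.
  by case: ifP => // _; case: and5P => // -[h1 h2 h3]; move/negP: nx; case; apply/and3P.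
by case: and5P => // -[h1 h2 h3]; move/negP: nx; case; apply/and3P.
Qed.

Lemma pcoef_en c p q d :
  pcoef c p q (en d) = [&& d == c, p == 0, q == 0 & inb c p q]%N%:R.
Proof.
have [/andP[d0 dn]|hd] := boolP ((0 < d) && (d <= n))%N; last first.
  rewrite en_oob // pcoef0; case: and4P => // -[/eqP ed /eqP p0 /eqP q0].
  by rewrite /in_bounds p0 q0 -ed addn0; move/negP: hd.
case: d d0 dn => // d _ dn; rewrite -[d]/(nat_of_ord (Ordinal dn)) enE idemE pcoef_path.
rewrite /path_weight /psrc /nbeta /nalpha /=.
by congr (_%:R); rewrite [0%N == p]eq_sym [0%N == q]eq_sym.
Qed.

(** The functionals are dual to the monomials in bounds, which are therefore
    linearly independent. *)
Lemma pcoef_mono c p q d p' q' :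
  pcoef c p q (mono d p' q') = [&& d == c, p' == p, q' == q & inb c p q]%N%:R.
Proof.
elim: q' q => [|q' IH] q; last first.
  rewrite -mono_al pcoef_al; case: q => [|q] /=; first by rewrite !andbF.
  rewrite IH eqSS; case hi: (inb c p q.+1); last by rewrite !andbF.
  by rewrite (_ : inb c p q) //; move: hi; rewrite /in_bounds; lia.
elim: p' p => [|p' IH] p; last first.
  rewrite -mono_be pcoef_be; case: p => [|p] /=; first by rewrite !andbF.
  rewrite IH eqSS; case hi: (inb c p.+1 q); last by rewrite !andbF.
  by rewrite (_ : inb c p q) //; move: hi; rewrite /in_bounds; lia.
by rewrite mono00 pcoef_en [p == _]eq_sym [q == _]eq_sym.
Qed.

Lemma mono_earrow (c p q : nat) (a : arrow Q) : (c + q = (src a : 'I_n).+1 + p)%N ->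
  mono c p q * earrow a = if is_beta a then mono c p.+1 q else mono c p q.+1.
Proof.
move=> e; have E : mono c p q = mono c p q * en (src a : 'I_n).+1 by rewrite mono_en e eqxx.
case: a e E => i /= e E.
  rewrite -mono_al [in RHS]E -mulrA en_al (big_pred1 i) // => j.
rewrite -mono_be [in RHS]E -mulrA en_be (big_pred1 i) // => j.
Qed.

(** Paths are sorted letter by letter: each arrow is absorbed into the
    monomial on its left, since alpha and beta commute. *)
Lemma mul_mono_path (x : qpath Q) c p q : (c + q = (psrc x).+1 + p)%N ->
  mono c p q * pi (lpath x) = mono c (p + nbeta x) (q + nalpha x).
Proof.
have [v [l ex]] : exists v l, val x = (v, l) by case: (val x) => v l; exists v, l.
move: ex.
elim: l v x c p q => [|b l IH] v x c p q ex.
  have -> : x = @stationary Q v by apply: val_inj.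
  rewrite -idemE -enE /psrc /nbeta /nalpha /= !addn0 => e.
  by rewrite mono_en e eqxx.
rewrite /psrc ex /= => e.
have wx := valP x; rewrite ex /= in wx; case/andP: wx => /eqP sb wl.
pose y : qpath Q := QPath (qpath_val := (tgt b, l)) wl.
have [z ez vz] := @pconcatP Q (arrow_path b) y erefl.
have xz : x = z by apply: val_inj; rewrite vz ex /= sb.
have -> : lpath x = lpath (arrow_path b) * lpath y.
  by rewrite lpath_mul /pa_comp ez xz lpathE.
have {}e : (c + q = (src b : 'I_n).+1 + p)%N by rewrite e -sb.
rewrite ba_pi_mul mulrA -earrowE (mono_earrow e).
have -> : nbeta x = (is_beta b + nbeta y)%N by rewrite /nbeta ex.
have -> : nalpha x = (~~ is_beta b + nalpha y)%N by rewrite /nalpha ex.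
have {IH} := IH (tgt b) y _ _ _ erefl; rewrite [psrc y]/(tgt b).
clearbody y; clear -e; move: (nbeta y) (nalpha y) (lpath y) => nb na t.
case: b e => i /= e IH; rewrite IH; try (congr (mono _ _ _)); lia.
Qed.

Lemma pi_path x : pi (lpath x) = mono (psrc x).+1 (nbeta x) (nalpha x).
Proof.
rewrite -(mul_mono_path (x := x) (c := (psrc x).+1) (p := 0) (q := 0)) //.
by rewrite mono00 enE idemE -ba_pi_mul stationary_mul eqxx.
Qed.

Lemma mono_span (U : A -> Prop) :
  U 0 -> (forall f g, U f -> U g -> U (f + g)) ->
  (forall a c p q, inb c p q -> U (a *: mono c p q)) -> forall f, U f.
Proof.
move=> U0 UD UZ; elim/A_span=> // a x; rewrite pi_path.
have [h|/mono_oob ->] := boolP (inb (psrc x).+1 (nbeta x) (nalpha x)); first exact: UZ.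
by rewrite scaler0.
Qed.

Lemma mono_expand (x : A) : x = \sum_(c < n.+1) \sum_(p < n.+1) \sum_(q < n.+1)
    pcoef c p q x *: mono c p q.
Proof.
elim/mono_span: x => [|f g {1}-> {1}->|a c p q /andP[h1 h2]].
- rewrite big1 // => c _; rewrite big1 // => p _; rewrite big1 // => q _.
  by rewrite pcoef0 scale0r.
- rewrite -big_split; apply: eq_bigr => c _; rewrite -big_split.
  apply: eq_bigr => p _; rewrite -big_split; apply: eq_bigr => q _.
  by rewrite pcoefD scalerDl.
have hc : (c < n.+1)%N by lia. have hp : (p < n.+1)%N by lia. have hq : (q < n.+1)%N by lia.
rewrite (bigD1 (Ordinal hc)) //= (bigD1 (Ordinal hp)) //= (bigD1 (Ordinal hq)) //=.
rewrite pcoefZ pcoef_mono !eqxx /in_bounds h1 h2 mulr1 !big1 ?addr0 // => [i|i|i].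
- rewrite -val_eqE /= => ne; rewrite big1 // => j _; rewrite big1 // => k _.
  by rewrite pcoefZ pcoef_mono eq_sym (negPf ne) mulr0 scale0r.
- rewrite -val_eqE /= => ne; rewrite big1 // => k _.
  by rewrite pcoefZ pcoef_mono [p == _]eq_sym (negPf ne) /= andbF mulr0 scale0r.
rewrite -val_eqE /= => ne.
by rewrite pcoefZ pcoef_mono [q == _]eq_sym (negPf ne) /= !andbF mulr0 scale0r.
Qed.

(** Membership in the span of the monomials indexed by F. *)
Definition supp_in (F : nat -> nat -> nat -> bool) (x : A) : Prop :=
  forall c p q, ~~ F c p q -> pcoef c p q x = 0.

Lemma supp_ind (F : nat -> nat -> nat -> bool) (U : A -> Prop) :
  U 0 -> (forall f g, U f -> U g -> U (f + g)) ->
  (forall a c p q, inb c p q -> F c p q -> U (a *: mono c p q)) ->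
  forall x, supp_in F x -> U x.
Proof.
move=> U0 UD UZ x Sx; rewrite [x]mono_expand.
elim/big_ind: _ => // c _; elim/big_ind: _ => // p _; elim/big_ind: _ => // q _.
have [/Sx->|h] := boolP (~~ F c p q); first by rewrite scale0r.
have [hb|/mono_oob ->] := boolP (inb c p q); last by rewrite scaler0.
by apply: UZ => //; move: h; rewrite negbK.
Qed.

Lemma pcoef_ext (x : A) : (forall c p q, inb c p q -> pcoef c p q x = 0) -> x = 0.
Proof.
move=> h; apply: (supp_ind (F := fun c p q => ~~ inb c p q) (U := fun x => x = 0)) => //.
- by move=> f g -> ->; rewrite addr0.
- by move=> a c p q ->.
by move=> c p q; rewrite negbK; apply: h.
Qed.

Lemma supp0 F : supp_in F 0. Proof. by move=> c p q _; rewrite pcoef0. Qed.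
Lemma suppD F (x y : A) : supp_in F x -> supp_in F y -> supp_in F (x + y).
Proof. by move=> hx hy c p q h; rewrite pcoefD hx ?hy ?addr0. Qed.
Lemma suppB F (x y : A) : supp_in F x -> supp_in F y -> supp_in F (x - y).
Proof. by move=> hx hy c p q h; rewrite pcoefB hx ?hy ?subr0. Qed.
Lemma suppZ F a (x : A) : supp_in F x -> supp_in F (a *: x).
Proof. by move=> hx c p q h; rewrite pcoefZ hx ?mulr0. Qed.
Lemma supp_mono (F : nat -> nat -> nat -> bool) c p q : F c p q -> supp_in F (mono c p q).
Proof.
move=> h c' p' q' h'; rewrite pcoef_mono; case: and4P => // -[/eqP e1 /eqP e2 /eqP e3 _].
by rewrite -e1 -e2 -e3 h in h'.
Qed.

(** Left multiplication by a monomial shifts the coordinates. *)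
Lemma pcoef_monoM c p q d P R (x : A) :
  pcoef c P R (mono d p q * x) =
  if [&& d == c, inb c P R, p <= P & q <= R]%N then pcoef (c + q - p) (P - p) (R - q) x else 0.
Proof.
elim/mono_span: x => [|f g hf hg|a c' p' q' hb]; first by rewrite mulr0 !pcoef0 if_same.
  by rewrite mulrDr !pcoefD hf hg; case: ifP; rewrite ?addr0.
rewrite -ba_scaleAr !pcoefZ monoM.
transitivity (a * (if [&& d == c, inb c P R, (p <= P)%N & (q <= R)%N] then
     pcoef (c + q - p) (P - p) (R - q) (mono c' p' q') else 0)); last first.
  by case: ifP; rewrite ?mulr0.
congr (_ * _); rewrite (fun_if (pcoef c P R)) pcoef0 2!pcoef_mono.
have [ed|] /= := eqVneq d c; last by rewrite if_same.
subst d.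
case hi : (inb c P R); rewrite /= ?andbF ?if_same //.
have [hp|hp] := leqP p P; last first.
  by rewrite (_ : (_ == P) = false) ?if_same //; apply/negbTE; lia.
have [hq|hq] := leqP q R; last first.
  by rewrite (_ : (_ == R) = false) ?andbF ?if_same //; apply/negbTE; lia.
have -> /= : inb (c + q - p) (P - p) (R - q) by move: hi; rewrite /in_bounds; lia.
rewrite andbT; move: hi; rewrite /in_bounds => hi.
have -> : (p + p' == P)%N = (p' == P - p)%N by apply/eqP/eqP; lia.
have -> : (q + q' == R)%N = (q' == R - q)%N by apply/eqP/eqP; lia.
have -> : (c' + p == c + q)%N = (c' == c + q - p)%N by apply/eqP/eqP; lia.
by case: (c' == _); rewrite /= ?andbT ?eqxx.
Qed.

(** This functional is the character by which the algebra acts on the simple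
    module at c. *)
Lemma pcoef_mul00 c (x y : A) :
  pcoef c 0 0 (x * y) = pcoef c 0 0 x * pcoef c 0 0 y.
Proof.
elim/mono_span: x => [|f g hf hg|a d p q hb]; first by rewrite !mul0r !pcoef0 mul0r.
  by rewrite mulrDl !pcoefD hf hg mulrDl.
rewrite -ba_scaleAl !pcoefZ -[RHS]mulrA; congr (_ * _); rewrite pcoef_monoM pcoef_mono.
rewrite !leqn0 !sub0n.
have [_|_] /= := eqVneq d c; last by rewrite mul0r.
have [->|_] /= := eqVneq p 0%N; last by rewrite andbF mul0r.
have [->|_] /= := eqVneq q 0%N; last by rewrite andbF mul0r.
by rewrite andbT addn0 subn0; case: ifP; rewrite ?mul1r ?mul0r.
Qed.

Lemma pcoef00_1 c : (0 < c <= n)%N -> pcoef c 0 0 (1 : A) = 1.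
Proof.
case/andP; case: c => // c _ hc; rewrite -(@sum_en K n) pcoef_sum.
rewrite (bigD1 (Ordinal hc)) //= big1 ?addr0 => [|i].
  by rewrite pcoef_en !eqxx /in_bounds addn0 hc.
by rewrite -val_eqE /= pcoef_en eqSS => /negPf ->.
Qed.

End Monomials.

(** * The ideal of a reduced word is spanned by monomials *)

Section Ideals.
Variables (K : fieldType) (n : nat).
Local Notation A := (preproj K n).
Local Notation al := (alpha_sum K n).
Local Notation be := (beta_sum K n).
Local Notation en := (vertex_idem K n).
Local Notation mono := (monomial K n).
Local Notation wideal := (word_ideal (@idem K n)).

Lemma vertex_ideal00 (k : 'I_n) (x : A) :
  vertex_ideal (@idem K n) k x -> pcoef k.+1 0 0 x = 0.
Proof.
have kn : (0 < k.+1 <= n)%N by rewrite ltn_ord.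
elim=> {x} [x [u [r [v [<- ->]]]]| |x y _ hx _ hy].
- rewrite !pcoef_mul00 pcoefB pcoef00_1 // -enE pcoef_en !eqxx /= /in_bounds addn0 ltn_ord /=.
  by rewrite subrr mulr0 mul0r.
- exact: pcoef0.
by rewrite pcoefB hx hy subr0.
Qed.

Lemma en_vertex_ideal (k : 'I_n) c (x y : A) : c != k.+1 ->
  vertex_ideal (@idem K n) k (x * en c * y).
Proof.
move=> ne; apply: addspan_gen; exists (x * en c), (1 - idem K k), y; split=> //.
have E : en c * idem K k = 0 by rewrite -enE enM (negPf ne).
have -> // : x * en c * (1 - idem K k) = x * en c.
rewrite mulrBr.
rewrite mulr1.
have -> : x * en c * idem K k = 0 by rewrite -mulrA E mulr0.
by rewrite subr0.
Qed.

Lemma al_mono c p q : al * mono c.+1 p q = mono c p q.+1.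
Proof.
rewrite /monomial !mulrA -en_al_comm -[en c * al * _]mulrA -[al in LHS]expr1 al_beX.
by rewrite -!mulrA -exprD add1n.
Qed.
Lemma be_mono c p q : be * mono c p q = mono c.+1 p.+1 q.
Proof. by rewrite /monomial !mulrA -en_be_comm -[_ * be * be ^+ p]mulrA -exprS. Qed.

(** The induction follows the product I_k I_w. Its elements are sums of
    products of a path other than e_k with an element of I_w, which stay in
    the filter by [in_filter_step]. Conversely, a monomial of the filter
    that does not start at the vertex k is fixed by an idempotent of I_k,
    and one that starts there is a multiple of alpha or beta by a monomial
    of I_w by [in_filter_consE]. *)
Theorem word_idealP s (x : A) : reduced_expression s (word_perm s) ->
  wideal s x <-> supp_in (in_filter (word_perm s)) x.
Proof.
elim: s x => [|k s IH] x red.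
  split=> // _ c p q; rewrite /word_perm big_nil in_filter_id; exact: pcoef_oob.
have [red' lt] := reduced_cons red; have {}IH y := IH y red'.
rewrite word_perm_cons; set w := word_perm s in lt IH *.
split=> [|Sx].
  elim=> {x} [x [y [z [Iy Jz ->]]]| |x y _ hx _ hy]; last exact: suppB.
    have {Iy} Sy : supp_in (fun c p q => ~~ [&& c == k.+1, p == 0 & q == 0]%N) y.
      move=> c p q; rewrite negbK => /and3P[/eqP-> /eqP-> /eqP->].
      exact: vertex_ideal00.
    have {Jz} Sz := proj1 (IH z) Jz.
    elim/supp_ind: y / Sy => [|f g hf hg|a c p q hb ne].
    - by rewrite mul0r; apply: supp0.
    - by rewrite mulrDl; apply: suppD.
    rewrite -ba_scaleAl; apply: suppZ => c' P Q nF; rewrite pcoef_monoM.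
    case: and4P => // -[/eqP ec hb' hp hq]; apply: Sz; apply: contra nF.
    by subst c'; apply: in_filter_step.
  exact: supp0.
elim/supp_ind: x / Sx => [|f g hf hg|a c p q hb hF].
- exact: subm0.
- exact: (submD (s := wideal (k :: s)) hf hg).
have gen (y z : A) : vertex_ideal (@idem K n) k y -> wideal s z ->
    wideal (k :: s) (y * z : A).
  by move=> hy hz; apply: addspan_gen; exists y, z.
have [ec|nc] := eqVneq c k.+1; last first.
  have -> : a *: mono c p q = (1 * en c * 1) * (a *: mono c p q).
    by rewrite mul1r mulr1 -ba_scaleAr en_mono eqxx.
  apply: gen; first exact: en_vertex_ideal.
  apply/IH/suppZ/supp_mono; move: hF; rewrite /in_filter hb perm_rank_cons_neq //.
  by move: hb; rewrite /in_bounds; lia.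
rewrite ec in hF *; have [[q0 hF']|[p0 hF']] := in_filter_consE lt hF.
  have -> : a *: mono k.+1 p q = (al * en k.+2 * 1) * (a *: mono k.+2 p q.-1).
    rewrite mulr1 -ba_scaleAr -mulrA en_mono eqxx al_mono prednK //.
  apply: gen; first by apply: en_vertex_ideal; lia.
  exact/IH/suppZ/supp_mono.
have -> : a *: mono k.+1 p q = (be * en k * 1) * (a *: mono k p.-1 q).
  rewrite mulr1 -ba_scaleAr -mulrA en_mono eqxx be_mono prednK //.
apply: gen; first by apply: en_vertex_ideal; lia.
exact/IH/suppZ/supp_mono.
Qed.

End Ideals.

(** * Modules: kernels, isomorphisms, direct summands *)

Section MakeLinear.
Variables (R : pzRingType) (M N : lmodType R) (f : M -> N) (Hf : linear f).
(** The proof of linearity is an argument so that the structure can be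
    attached to a function given inside of a proof. *)
Definition lfun_of (h : linear f) : M -> N := f.
HB.instance Definition _ := GRing.isLinear.Build R M N *:%R (lfun_of Hf) Hf.
Definition mklin : {linear M -> N} := lfun_of Hf.
Lemma mklinE x : mklin x = f x. Proof. by []. Qed.
End MakeLinear.

Lemma inj_surj_bij (S T : Type) (f : S -> T) :
  injective f -> (forall y, exists x, f x = y) -> bijective f.
Proof.
move=> inj surj; pose g y := projT1 (cid (surj y)).
have gK : cancel g f by move=> y; rewrite /g; case: cid.
by exists g => // x; apply: inj; rewrite gK.
Qed.

Section Modules.
Variable R : pzRingType.
Implicit Types M N L : lmodType R.

Lemma comp_lin M N L (f : {linear M -> N}) (g : {linear N -> L}) : linear (g \o f).
Proof. by move=> a x y /=; rewrite !linearP. Qed.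

Lemma iso_refl M : iso_mod M M.
Proof. by exists (mklin (f := id) (fun _ _ _ => erefl)); exists id. Qed.

Lemma iso_sym M N : iso_mod M N -> iso_mod N M.
Proof.
case=> f [g fK gK]; have lg : linear g.
  by move=> a x y; apply: (can_inj fK); rewrite linearP !gK.
by exists (mklin lg); exists f.
Qed.

Lemma iso_trans M N L : iso_mod M N -> iso_mod N L -> iso_mod M L.
Proof.
case=> f bf [g bg]; exists (mklin (comp_lin f g)).
exact: (bij_comp bg bf).
Qed.

Lemma iso_can M N (f : {linear M -> N}) (g : N -> M) : cancel f g -> cancel g f -> iso_mod M N.
Proof. by move=> fK gK; exists f; exists g. Qed.

Lemma zero_iso M N : iso_mod M N -> zero_mod N -> zero_mod M.
Proof.
by case=> f [g fK _] zN x; rewrite -(fK x) -(fK 0) (zN (f x)) (zN (f 0)).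
Qed.

Lemma summand_split N M : summand N M ->
  exists (i : {linear N -> M}) (p : {linear M -> N}), forall x, p (i x) = x.
Proof.
case=> L [f [g fK gK]].
have lg : linear g by move=> a x y; apply: (can_inj fK); rewrite linearP !gK.
have li : linear (fun x : N => f (x, 0)).
  by move=> a x y; rewrite -linearP; congr (f _); apply: injective_projections;
    rewrite //= scaler0 addr0.
have lp : linear (fun y : M => (g y).1) by move=> a x y; rewrite lg.
by exists (mklin li), (mklin lp) => x; rewrite !mklinE fK.
Qed.

Lemma summand_zero Z M : zero_mod Z -> summand Z M.
Proof.
move=> zZ; exists M.
have lf : linear (fun x : (Z * M)%type => x.2) by [].
by apply: (iso_can (f := mklin lf) (g := fun x => (0, x))) => [[x y]|y] //=; rewrite (zZ x).
Qed.

Lemma iso_pair0l Z M : zero_mod Z -> iso_mod (Z * M)%type M.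
Proof.
move=> zZ; have lf : linear (fun x : (Z * M)%type => x.2) by [].
by apply: (iso_can (f := mklin lf) (g := fun x => (0, x))) => [[x y]|y] //=; rewrite (zZ x).
Qed.

Lemma iso_pair0r Z M : zero_mod Z -> iso_mod (M * Z)%type M.
Proof.
move=> zZ; have lf : linear (fun x : (M * Z)%type => x.1) by [].
by apply: (iso_can (f := mklin lf) (g := fun x => (x, 0))) => [[x y]|y] //=; rewrite (zZ y).
Qed.

Section KernelSubmodule.
Variables (M N : lmodType R) (f : {linear M -> N}).
Fact ker0 : f 0 = 0. Proof. exact: linear0. Qed.
Fact kerD x y : f x = 0 -> f y = 0 -> f (x + y) = 0.
Proof. by rewrite linearD => -> ->; rewrite addr0. Qed.
Fact kerZ a x : f x = 0 -> f (a *: x) = 0.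
Proof. by rewrite linearZ_LR => ->; rewrite scaler0. Qed.
Definition kernel : submodule M := Submodule ker0 kerD kerZ.
Fact img0 : exists x, f x = 0. Proof. by exists 0; rewrite linear0. Qed.
Fact imgD y z : (exists x, f x = y) -> (exists x, f x = z) -> exists x, f x = y + z.
Proof. by case=> a <- [b <-]; exists (a + b); rewrite linearD. Qed.
Fact imgZ a y : (exists x, f x = y) -> exists x, f x = a *: y.
Proof. by case=> b <-; exists (a *: b); rewrite linearZ_LR. Qed.
Definition image_sub : submodule N := Submodule img0 imgD imgZ.
End KernelSubmodule.

Definition insub_mod M (U : submodule M) x (h : U x) : U := SubmodType (asboolT h).
Lemma submod_valE M (U : submodule M) (x : U) : U (submod_val x).
Proof. exact: asboolW (valP x). Qed.
Lemma submod_valP M (U : submodule M) a (x y : U) :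
  submod_val (a *: x + y) = a *: submod_val x + submod_val y.
Proof. by []. Qed.
Lemma submod_valD M (U : submodule M) (x y : U) :
  submod_val (x + y) = submod_val x + submod_val y.
Proof. by []. Qed.
Lemma submod_valB M (U : submodule M) (x y : U) :
  submod_val (x - y) = submod_val x - submod_val y.
Proof. by []. Qed.
Lemma submod_val0 M (U : submodule M) : submod_val (0 : U) = 0.
Proof. by []. Qed.
Lemma submod_inj M (U : submodule M) (x y : U) : submod_val x = submod_val y -> x = y.
Proof. exact: val_inj. Qed.
Lemma insub_modK M (U : submodule M) x (h : U x) : submod_val (insub_mod h) = x.
Proof. by []. Qed.
Lemma fst_linP M N a (x y : (M * N)%type) : (a *: x + y).1 = a *: x.1 + y.1.
Proof. by []. Qed.
Lemma snd_linP M N a (x y : (M * N)%type) : (a *: x + y).2 = a *: x.2 + y.2.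
Proof. by []. Qed.

(** The map a is a split monomorphism, so N is the direct sum of the image
    of a and the kernel of b, and the kernel must vanish. *)
Lemma split_indec M N (a : {linear M -> N}) (b : {linear N -> M}) :
  bijective (b \o a) -> indecomposable N -> ~ zero_mod M -> iso_mod N M.
Proof.
case=> g gK Kg [_ indN] nzM; set Z := kernel b.
have lin : linear (fun x : (M * Z)%type => a x.1 + submod_val x.2).
  move=> c x y /=; rewrite linearP /= scalerDr -!addrA; congr (_ + _).
  by rewrite [RHS]addrCA.
have kerP x : b (x - a (g (b x))) = 0.
  by rewrite linearB -[b (a _)]/((b \o a) _) Kg subrr.
have iMZ : iso_mod (M * Z)%type N.
  apply: (iso_can (f := mklin lin) (g := fun x => (g (b x), insub_mod (U := Z) (kerP x)))).
    move=> [x z]; rewrite mklinE /=; have bz : b (submod_val z) = 0 := submod_valE z.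
    have E : g (b (a x + submod_val z)) = x by rewrite linearD bz addr0 gK.
    by congr pair => //; apply: val_inj => /=; rewrite E addrC addKr.
  by move=> x; rewrite mklinE /= addrC subrK.
case: (indN _ _ iMZ) => // zZ.
have binj : injective b.
  move=> x y /eqP; rewrite -subr_eq0 -linearB => /eqP h.
  apply/eqP; rewrite -subr_eq0; apply/eqP.
  exact: (congr1 (@submod_val _ _ _) (zZ (insub_mod (U := Z) h))).
apply: (iso_can (f := b) (g := a \o g)) => x; last exact: Kg.
by apply: binj; rewrite -[LHS]/((b \o a) _) Kg.
Qed.

Lemma projective_summand N M : projective M -> summand N M -> projective N.
Proof.
move=> pM /summand_split[i [p pi]] X Y g h sg.
have [h' eh'] := pM X Y g (mklin (comp_lin p h)) sg.
exists (mklin (comp_lin i h')) => x.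
by rewrite mklinE /= eh' mklinE /= pi.
Qed.

End Modules.

(** * Right action and socle *)

Section RightActionGeneral.
Variable A : pzRingType.
Local Notation rmod := (rmod A).
Local Notation reg := ((A^c)^o : rmod).

(** Modules over the converse ring, written with the ring acting on the
    right. *)
Definition ract (M : rmod) (x : M) (a : A) : M := (a : A^c) *: x.

Lemma ractA (M : rmod) (x : M) a b : ract (ract x a) b = ract x (a * b).
Proof. by rewrite /ract scalerA. Qed.
Lemma ract1 (M : rmod) (x : M) : ract x 1 = x.
Proof. exact: scale1r. Qed.
Lemma ractDr (M : rmod) (x : M) a b : ract x (a + b) = ract x a + ract x b.
Proof. exact: scalerDl. Qed.
Lemma ractDl (M : rmod) (x y : M) a : ract (x + y) a = ract x a + ract y a.
Proof. exact: scalerDr. Qed.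
Lemma ractBr (M : rmod) (x : M) a b : ract x (a - b) = ract x a - ract x b.
Proof. exact: scalerBl. Qed.
Lemma ractBl (M : rmod) (x y : M) a : ract (x - y) a = ract x a - ract y a.
Proof. exact: scalerBr. Qed.
Lemma ract0r (M : rmod) (x : M) : ract x 0 = 0.
Proof. exact: scale0r. Qed.
Lemma ract0l (M : rmod) a : ract (0 : M) a = 0.
Proof. exact: scaler0. Qed.
Lemma lin_ract (M N : rmod) (f : {linear M -> N}) x a : f (ract x a) = ract (f x) a.
Proof. exact: linearZ_LR. Qed.
Lemma ract_reg (x : reg) a : ract x a = (x : A) * a.
Proof. by []. Qed.
Lemma ract_sum (M : rmod) (x : M) I (r : seq I) (P : pred I) (F : I -> A) :
  ract x (\sum_(i <- r | P i) F i) = \sum_(i <- r | P i) ract x (F i).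
Proof. by apply: (big_morph _ (id1 := 0) (op1 := +%R)) => [a b|]; rewrite ?ractDr ?ract0r. Qed.
Lemma ract_suml (M : rmod) a I (r : seq I) (P : pred I) (F : I -> M) :
  ract (\sum_(i <- r | P i) F i) a = \sum_(i <- r | P i) ract (F i) a.
Proof. exact: scaler_sumr. Qed.
Lemma ract_val (M : rmod) (U : submodule M) (x : U) a :
  submod_val (ract (x : submod_lmod U) a) = ract (submod_val x) a.
Proof. by []. Qed.
Lemma sub_ract (M : rmod) (U : submodule M) x a : U x -> U (ract x a).
Proof. exact: submZ. Qed.
Lemma mk_lin (M N : rmod) (f : M -> N) :
  (forall x y, f (x + y) = f x + f y) -> (forall a x, f (ract x a) = ract (f x) a) -> linear f.
Proof. by move=> fD fZ a x y; rewrite fD -[a *: x]/(ract x a) fZ. Qed.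
End RightActionGeneral.

Section RightAction.
Variables (K : fieldType) (n : nat).
Local Notation A := (preproj K n).
Local Notation al := (alpha_sum K n).
Local Notation be := (beta_sum K n).
Local Notation en := (vertex_idem K n).
Local Notation mono := (monomial K n).
Local Notation inb := (in_bounds n).

(** The longest path from j; it ends at n + 1 - j. *)
Definition socle_elt j : A := mono j j.-1 (n - j).
Local Notation om := socle_elt.

Lemma inb_om j : (0 < j <= n)%N -> inb j j.-1 (n - j).
Proof. by rewrite /in_bounds; lia. Qed.

Lemma pcoef_om j : (0 < j <= n)%N -> pcoef j j.-1 (n - j) (om j) = 1.
Proof. by move=> hj; rewrite pcoef_mono !eqxx inb_om. Qed.

Lemma en_om i j : en i * om j = if i == j then om j else 0.
Proof. exact: en_mono. Qed.
Lemma om_neq0 j : (0 < j <= n)%N -> om j != 0.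
Proof.
by move=> hj; apply/eqP => /(congr1 (pcoef j j.-1 (n - j)));
  rewrite pcoef_om // pcoef0 => /eqP; rewrite oner_eq0.
Qed.

Lemma pcoef_en_l i c p q (x : A) : pcoef c p q (en i * x) = if i == c then pcoef c p q x else 0.
Proof.
rewrite -mono00 pcoef_monoM; case: eqP => //= _; rewrite addn0 !subn0 andbT.
by case: ifP => // h; rewrite pcoef_oob //; rewrite -/(inb c p q) h.
Qed.

Lemma pcoef_en_r d c p q (x : A) :
  pcoef c p q (x * en d) = if (d + p == c + q)%N then pcoef c p q x else 0.
Proof.
elim/mono_span: x => [|f g hf hg|a c' p' q' hb]; first by rewrite mul0r pcoef0 if_same.
  by rewrite mulrDl 2!pcoefD hf hg; case: ifP; rewrite ?addr0.
rewrite -ba_scaleAl !pcoefZ mono_en (fun_if (pcoef c p q)) pcoef_mono pcoef0.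
by case: and4P => [[/eqP-> /eqP-> /eqP-> _]|_]; rewrite ?if_same //; case: ifP; rewrite ?mulr0.
Qed.

Lemma sum_en_r (x : A) : x = \sum_(i < n) x * en i.+1.
Proof. by rewrite -mulr_sumr sum_en mulr1. Qed.

(** A monomial in the support can be prolonged unless it is the longest one. *)
Lemma socle_coef (y : A) c p q : y * al = 0 -> y * be = 0 ->
  pcoef c p q y != 0 -> p = c.-1 /\ q = (n - c)%N.
Proof.
move=> ya yb; have [hb|hb] := boolP (inb c p q); last by rewrite pcoef_oob ?eqxx.
move: (hb); rewrite /in_bounds => /andP[hp hq] nz; split.
  have [//|ne] := eqVneq p c.-1; case/eqP: nz.
  have := pcoef_be c p.+1 q y; rewrite yb pcoef0 /= => ->.
  by rewrite ifT // /in_bounds; lia.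
have [//|ne] := eqVneq q (n - c)%N; case/eqP: nz.
have := pcoef_al c p q.+1 y; rewrite ya pcoef0 /= => ->.
by rewrite ifT // /in_bounds; lia.
Qed.

Lemma socle_left (y : A) j : (0 < j <= n)%N -> y * al = 0 -> y * be = 0 -> en j * y = y ->
  y = pcoef j j.-1 (n - j) y *: om j.
Proof.
move=> hj ya yb ey; apply/eqP; rewrite -subr_eq0; apply/eqP/pcoef_ext => c p q hb.
rewrite pcoefB pcoefZ pcoef_mono hb andbT.
case: and3P => [[/eqP<- /eqP<- /eqP<-]|ne]; first by rewrite mulr1 subrr.
rewrite mulr0 subr0; apply/eqP; apply: contra_notT ne => nz.
have [-> ->] := socle_coef ya yb nz.
move: nz; rewrite -ey pcoef_en_l; case: (j =P c) => [-> _|_]; last by rewrite eqxx.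
by rewrite !eqxx.
Qed.

Lemma socle_right (y : A) d : (0 < d <= n)%N -> y * al = 0 -> y * be = 0 -> y * en d = y ->
  exists c, y = c *: om (n.+1 - d).
Proof.
move=> hd ya yb ey; set j := (n.+1 - d)%N; exists (pcoef j j.-1 (n - j) y).
apply/eqP; rewrite -subr_eq0; apply/eqP/pcoef_ext => c p q hb.
rewrite pcoefB pcoefZ pcoef_mono hb andbT.
case: and3P => [[/eqP<- /eqP<- /eqP<-]|ne]; first by rewrite mulr1 subrr.
rewrite mulr0 subr0; apply/eqP; apply: contra_notT ne => nz.
have [ep eq] := socle_coef ya yb nz.
move: nz; rewrite -ey pcoef_en_r; case: (_ =P (c + q)%N) => [e _|_]; last by rewrite eqxx.
have ec : c = j by move: hb; rewrite /in_bounds /j; lia.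
by rewrite ep eq ec !eqxx.
Qed.

Lemma long_paths p q : (n <= p + q)%N -> be ^+ p * al ^+ q = 0.
Proof.
move=> h; rewrite -[LHS]mul1r -(@sum_en K n) mulr_suml big1 // => i _.
by rewrite mulrA -/(mono _ _ _) mono_oob // /in_bounds; have := ltn_ord i; lia.
Qed.

(** An element is multiplied by arrows as long as the product is not zero;
    this stops because long paths vanish. Some e_d does not kill the result,
    and the product with e_d is still killed by the arrows. *)
Lemma socle_reach (x : A) : x != 0 -> exists a d, [/\ (0 < d <= n)%N, x * a != 0,
  x * a * al = 0, x * a * be = 0 & x * a * en d = x * a].
Proof.
(* k bounds the Loewy length of the module generated by x *)
have [k] : exists k, forall p q, (k <= p + q)%N -> x * be ^+ p * al ^+ q = 0.
  by exists n => p q h; rewrite -mulrA long_paths ?mulr0.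
elim: k x => [|k IH] x hx nx.
  by have := hx 0%N 0%N erefl; rewrite !mulr1 => /eqP; rewrite (negPf nx).
have [xa|xa] := eqVneq (x * al) 0; last first.
  have [|a [d [hd h1 h2 h3 h4]]] := IH (x * al) _ xa.
    move=> p q h; have := hx p q.+1; rewrite addnS ltnS => /(_ h) <-.
    by rewrite exprS !mulrA -[x * al * _]mulrA -{1}[al]expr1 al_beX expr1 !mulrA.
  by exists (al * a), d; rewrite !mulrA.
have [xb|xb] := eqVneq (x * be) 0; last first.
  have [|a [d [hd h1 h2 h3 h4]]] := IH (x * be) _ xb.
    move=> p q h; have := hx p.+1 q; rewrite addSn ltnS => /(_ h) <-.
    by rewrite exprS !mulrA.
  by exists (be * a), d; rewrite !mulrA.
have [i ni] : exists i : 'I_n, x * en i.+1 != 0.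
  apply/existsP; apply: contraNT nx; rewrite negb_exists => /forallP h.
  by rewrite [x]sum_en_r big1 // => i _; apply/eqP; rewrite -[_ == _]negbK.
exists (en i.+1), i.+1; split=> //; first by rewrite ltn_ord.
- by rewrite -mulrA en_al_comm mulrA xa mul0r.
- case: i ni => -[|i] hi /= _.
    by have := @en_be_comm K n 0; rewrite en0 mulr0 -mulrA => ->; rewrite mulr0.
  by rewrite -mulrA en_be_comm mulrA xb mul0r.
by rewrite -mulrA enM eqxx.
Qed.

End RightAction.

(** * Vertex parts and the indecomposable summands of an ideal *)

Section VertexPart.
Variables (A : pzRingType) (U : submodule ((A^c)^o : rmod A)) (e : A).
Local Notation reg := ((A^c)^o : rmod A).

Definition in_part (x : A) : Prop := U x /\ e * x = x.
Fact part0 : in_part 0. Proof. by split; [exact: subm0 | rewrite mulr0]. Qed.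
Fact partD (x y : reg) : in_part x -> in_part y -> in_part (x + y : A).
Proof. by move=> [Ux ex] [Uy ey]; split; [exact: submD | rewrite mulrDr ex ey]. Qed.
Fact partZ (a : A^c) (x : reg) : in_part x -> in_part (a *: x : A).
Proof.
by move=> [Ux ex]; split; [exact: submZ | rewrite right_regular_scaleE mulrA ex].
Qed.
(** This is e U when U is stable under left multiplication by the idempotent
    e; membership is an equation instead of an existence statement. *)
Definition part : submodule reg := @Submodule _ reg _ part0 partD partZ.

Fact copart0 : U 0 /\ e * 0 = 0. Proof. by split; [exact: subm0 | rewrite mulr0]. Qed.
Fact copartD (x y : reg) : U x /\ e * x = 0 -> U y /\ e * y = 0 -> U (x + y) /\ e * (x + y) = 0.
Proof. by move=> [Ux ex] [Uy ey]; split; [exact: submD | rewrite mulrDr ex ey addr0]. Qed.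
Fact copartZ (a : A^c) (x : reg) : U x /\ e * x = 0 -> U (a *: x : A) /\ e * (a *: x : A) = 0.
Proof.
by move=> [Ux ex]; split; [exact: submZ | rewrite right_regular_scaleE mulrA ex mul0r].
Qed.
Definition copart : submodule reg := @Submodule _ reg _ copart0 copartD copartZ.

Hypothesis Ul : forall x, U x -> U (e * x).
Hypothesis ee : e * e = e.

Lemma in_part_mul x : U x -> in_part (e * x).
Proof. by move=> Ux; split; [exact: Ul | rewrite mulrA ee]. Qed.

Lemma in_partU (x : part) : U (submod_val x). Proof. by case: (submod_valE x). Qed.
Fact part_incl_lin : linear (fun x : part => insub_mod (in_partU x)).
Proof. by move=> a x y; apply: submod_inj. Qed.
Definition part_incl : {linear part -> U} := mklin part_incl_lin.
Fact part_proj_lin :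
  linear (fun x : U => insub_mod (U := part) (in_part_mul (submod_valE x))).
Proof.
move=> a x y; apply: submod_inj; rewrite [RHS]submod_valP 3!insub_modK submod_valP.
by rewrite !right_regular_scaleE mulrDr mulrA.
Qed.
Definition part_proj : {linear U -> part} := mklin part_proj_lin.
Lemma part_projE (x : U) : submod_val (part_proj x) = e * submod_val x. Proof. by []. Qed.

Lemma part_summand : summand part U.
Proof.
exists copart.
have inU (x : part) (y : copart) : U (submod_val x + submod_val y).
  by apply: submD; [case: (submod_valE x) | case: (submod_valE y)].
pose f (z : (part * copart)%type) : U := insub_mod (inU z.1 z.2).
have lf : linear f.
  move=> a x y; apply: submod_inj; rewrite submod_valP !insub_modK fst_linP snd_linP.
  by rewrite !submod_valP scalerDr addrACA.
have inC (x : U) : U (submod_val x - e * submod_val x) /\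
  e * (submod_val x - e * submod_val x) = 0.
  have Ux := submod_valE x; split; last by rewrite mulrBr mulrA ee subrr.
  apply: submD => //.
  have := @submZ _ _ U (-1) _ (Ul Ux); by rewrite scaleN1r.
pose g (x : U) : (part * copart)%type :=
  (insub_mod (U := part) (in_part_mul (submod_valE x)), insub_mod (U := copart) (inC x)).
apply: (iso_can (f := mklin lf) (g := g)) => [[x y]|x].
  have [_ ex] := submod_valE x; have [_ ey] := submod_valE y.
  have E : e * (submod_val x + submod_val y) = submod_val x by rewrite mulrDr ex ey addr0.
  rewrite /g mklinE; apply: injective_projections; apply: submod_inj; rewrite !insub_modK.
    exact: E.
  by rewrite E addrC addKr.
by apply: submod_inj; rewrite mklinE !insub_modK addrC subrK.
Qed.

End VertexPart.

Section KrullSchmidt.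
Variables (K : fieldType) (n : nat).
Local Notation A := (preproj K n).
Local Notation al := (alpha_sum K n).
Local Notation be := (beta_sum K n).
Local Notation en := (vertex_idem K n).
Local Notation om := (socle_elt K n).
Local Notation rmod := (rmod A).
Local Notation reg := ((A^c)^o : rmod).
Variable U : submodule reg.
Hypothesis Ul : forall (j : nat) (x : A), U x -> U (en j * x).

Lemma en_idem j : en j * en j = en j. Proof. by rewrite enM eqxx. Qed.

Lemma sub_scal c (x : A) : U x -> U (c *: x : A).
Proof.
move=> Ux; have := @sub_ract A reg U x (c *: (1 : A)) Ux.
by rewrite ract_reg -ba_scaleAr mulr1.
Qed.

Lemma sub_reach_socle (x : A) : U x -> x != 0 -> exists a j c,
  [/\ (0 < j <= n)%N, c != 0, x * a = c *: om j & U (om j)].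
Proof.
move=> Ux /socle_reach[a [d [hd nz ya yb ed]]].
have [c ec] := socle_right hd ya yb ed.
have c0 : c != 0 by apply: contraNneq nz => c0; rewrite ec c0 scale0r.
exists a, (n.+1 - d)%N, c; split=> //; first lia.
have -> : om (n.+1 - d) = c^-1 *: (x * a) by rewrite ec scalerA mulVf // scale1r.
apply: sub_scal; exact: (@sub_ract A reg U x a Ux).
Qed.

Lemma part_om j : (0 < j <= n)%N -> U (om j) -> part U (en j) (om j).
Proof. by move=> hj Uo; split=> //; rewrite en_om eqxx. Qed.

(** The socle of e_j A is simple and essential. *)
Lemma part_reach j (x : A) : (0 < j <= n)%N -> en j * x = x -> x != 0 -> exists a, x * a = om j.
Proof.
move=> hj ex /socle_reach[a [d [hd nz ya yb ed]]].
have exa : en j * (x * a) = x * a by rewrite mulrA ex.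
have := socle_left hj ya yb exa; set c := pcoef _ _ _ _ => E.
have c0 : c != 0 by apply: contraNneq nz => c0; rewrite E c0 scale0r.
by exists (c^-1 *: a); rewrite -ba_scaleAr E scalerA mulVf // scale1r.
Qed.

(** Injectivity follows from the essential socle. For surjectivity, g fixes
    the socle, so x - g x has smaller Loewy length than x and lies in the
    image by induction. *)
Lemma part_endo_bij j (g : {linear part U (en j) -> part U (en j)}) (o : part U (en j)) :
  (0 < j <= n)%N -> submod_val o = om j -> g o = o -> bijective g.
Proof.
move=> hj eo go.
have o0 : o != 0.
  by apply: contraNneq (om_neq0 K hj) => o0; rewrite -eo o0.
apply: inj_surj_bij => [x y|y].
  move=> /eqP; rewrite -subr_eq0 -linearB => /eqP gw.
  apply/eqP; rewrite -subr_eq0; apply: contraT => nw; set w := x - y in gw nw.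
  have [||a ea] := @part_reach j (submod_val w) hj.
  - by case: (submod_valE w).
  - apply: contraNneq nw => w0; apply/eqP; apply: val_inj; exact: w0.
  have E : ract (w : submod_lmod _) a = o by apply: submod_inj;
    rewrite ract_val ract_reg eo -ea.
  by case/eqP: o0; rewrite -go -E lin_ract gw ract0l.
(* t bounds the Loewy length of x *)
have H t : forall x : part U (en j), (forall p q, (t <= p + q)%N ->
    ract (x : submod_lmod _) (be ^+ p * al ^+ q) = 0) -> exists z, g z = x.
  elim: t => [|t IH] x hx.
    have := hx 0%N 0%N erefl; rewrite !expr0 mulr1 ract1 => ->.
    by exists 0; rewrite linear0.
  have [|z ez] := IH (x - g x); last by exists (x + z); rewrite linearD ez addrC subrK.
  move=> p q hpq; rewrite ractBl -lin_ract; set s := ract _ _.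
  have sa : (submod_val s : A) * al = 0.
    have := hx p q.+1; rewrite addnS ltnS => /(_ hpq)/(congr1 (@submod_val _ _ _)).
    by rewrite /s !ract_val !ract_reg submod_val0 exprSr mulrA => <-; rewrite !mulrA.
  have sb : (submod_val s : A) * be = 0.
    have := hx p.+1 q; rewrite addSn ltnS => /(_ hpq)/(congr1 (@submod_val _ _ _)).
    rewrite /s !ract_val !ract_reg submod_val0 => <-.
    by rewrite -!mulrA -[be in LHS]expr1 al_beX expr1 exprSr !mulrA.
  have [_ es] := submod_valE s.
  have := socle_left hj sa sb es; set c := pcoef _ _ _ _ => E.
  have -> : s = ract (o : submod_lmod _) (c *: (1 : A)).
    by apply: submod_inj; rewrite ract_val ract_reg eo -ba_scaleAr mulr1.
  by rewrite lin_ract go subrr.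
apply: (H n) => p q hpq; by rewrite long_paths // ract0r.
Qed.

(** An element of N can be multiplied into the socle of U, where its
    component at some j does not vanish. The composite of e_j U -> U -> N ->
    U -> e_j U then fixes the socle element of e_j U and is bijective, so
    that e_j U is a summand of the indecomposable N. *)
Lemma indec_summand_part N : indecomposable N -> summand N U ->
  exists j, [/\ (0 < j <= n)%N, U (om j) & iso_mod N (part U (en j))].
Proof.
move=> indN /summand_split[i [p pi]].
have [nzN _] := indN.
have [z0 nz0] : exists z0 : N, z0 <> 0.
  by apply: contra_notP nzN => h x; apply: contrapT => nx; apply: h; exists x.
have nz : submod_val (i z0) != 0.
  apply: contra_notN nz0 => /eqP h; rewrite -[z0]pi (_ : i z0 = 0) ?linear0 //.
  exact: val_inj.
have [a [j [c [hj c0 ea Uo]]]] := sub_reach_socle (submod_valE (i z0)) nz.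
exists j; split=> //.
pose f := mklin (comp_lin (part_incl U (en j)) p).
pose h := mklin (comp_lin i (part_proj (Ul j) (en_idem j))).
pose o : part U (en j) := insub_mod (part_om hj Uo).
have nP : ~ zero_mod (part U (en j)).
  move=> zP; have := om_neq0 K hj; rewrite -[om j]/(submod_val o) (zP o).
  by rewrite eqxx.
apply: (split_indec (a := f) (b := h)) => //.
pose g := mklin (comp_lin f h).
apply: (part_endo_bij (g := g) (o := o)) => //.
have eo : ract (i z0) (c^-1 *: a) = insub_mod Uo.
  apply: submod_inj; rewrite ract_val ract_reg insub_modK -ba_scaleAr ea scalerA.
  by rewrite mulVf // scale1r.
have ep : p (insub_mod Uo) = ract z0 (c^-1 *: a) by rewrite -eo lin_ract pi.
have E : part_incl U (en j) o = insub_mod Uo by apply: submod_inj.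
apply: submod_inj; rewrite -[g o]/(part_proj (Ul j) (en_idem j) (i (p (part_incl U (en j) o)))).
by rewrite part_projE E ep lin_ract eo !insub_modK en_om eqxx.
Qed.

Lemma part_nonzero j : (0 < j <= n)%N -> ~ zero_mod (part U (en j)) -> U (om j).
Proof.
move=> hj nz; have [x nx] : exists x : part U (en j), x <> 0.
  by apply: contra_notP nz => h x; apply: contrapT => nx; apply: h; exists x.
have [Ux ex] := submod_valE x.
have nx' : submod_val x != 0 by apply: contra_notN nx => /eqP h; apply: val_inj.
have [a <-] := part_reach hj ex nx'.
exact: (@sub_ract A reg U _ a Ux).
Qed.

(** Two nonzero submodules of e_j U both contain its socle element, so they
    cannot be complementary. *)
Lemma part_indec j : (0 < j <= n)%N -> U (om j) -> indecomposable (part U (en j)).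
Proof.
move=> hj Uo; pose o : part U (en j) := insub_mod (part_om hj Uo).
have no : o <> 0.
  by move=> h; have := om_neq0 K hj; rewrite -[om j]/(submod_val o) h eqxx.
have reach (x : part U (en j)) : x <> 0 -> exists a, ract (x : submod_lmod _) a = o.
  move=> nx; have [Ux ex] := submod_valE x.
  have nx' : submod_val x != 0 by apply: contra_notN nx => /eqP h; apply: val_inj.
  by have [a ea] := part_reach hj ex nx'; exists a; apply: submod_inj;
    rewrite ract_val ract_reg ea.
split=> [z|N L [f [g fK gK]]]; first exact: no.
apply: contrapT => /not_orP[nN nL].
have [x nx] : exists x : N, x <> 0.
  by apply: contra_notP nN => h x; apply: contrapT => nx; apply: h; exists x.
have [y ny] : exists x : L, x <> 0.
  by apply: contra_notP nL => h y; apply: contrapT => ny; apply: h; exists y.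
have f0 u : f u = 0 -> u = 0 by move=> h; rewrite -[u]fK h -(linear0 f) fK.
have [|a ea] := reach (f (x, 0)); first by move/f0 => [].
have [|b eb] := reach (f (0, y)); first by move/f0 => [].
have : f (ract ((x, 0) : (N * L)%type : rmod) a) = f (ract ((0, y) : (N * L)%type : rmod) b).
  by rewrite !lin_ract ea eb.
move/(can_inj fK) => [ex ey]; apply: no; rewrite -ea -lin_ract.
have -> : ract ((x, 0) : (N * L)%type : rmod) a = 0.
  by apply: injective_projections; rewrite /= ?ex ?ract0l // [LHS]scaler0.
by rewrite linear0.
Qed.

End KrullSchmidt.

(** * Sums of indecomposable projectives *)

Section ProjSum.
Variables (A : pzRingType) (V : finType) (e : V -> A).
Hypothesis ee : forall v, e v * e v = e v.
Local Notation rmod := (rmod A).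

Section OneSum.
Variable r : V -> nat.
Local Notation PS := (proj_sum e r).
Local Notation index := {i : V & 'I_(r i)}.

Definition ps_coord (x : PS) (k : index) : A := submod_val x k.

Lemma ps_coord_idem (x : PS) k : e (tag k) * ps_coord x k = ps_coord x k.
Proof.
have [a ha] := submod_valE x k; rewrite -[ps_coord x k]/(submod_val x k : A) ha.
by rewrite mulrA ee.
Qed.
Lemma ps_coord_ext (x y : PS) : (forall k, ps_coord x k = ps_coord y k) -> x = y.
Proof. by move=> h; apply: submod_inj; apply/ffunP => k; apply: h. Qed.
Lemma ps_coordD (x y : PS) k : ps_coord (x + y) k = ps_coord x k + ps_coord y k.
Proof. by rewrite /ps_coord submod_valD ffunE. Qed.
Lemma ps_coord0 k : ps_coord (0 : PS) k = 0.
Proof. by rewrite /ps_coord submod_val0 ffunE. Qed.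
Lemma ps_coord_ract (x : PS) a k : ps_coord (ract x a) k = ps_coord x k * a.
Proof. by rewrite /ps_coord ract_val /ract ffunE. Qed.
Lemma ps_coord_sum (I : Type) (s : seq I) (P : pred I) (F : I -> PS) k :
  ps_coord (\sum_(i <- s | P i) F i) k = \sum_(i <- s | P i) ps_coord (F i) k.
Proof. by apply: (big_morph (ps_coord^~ k) (id1 := 0) (op1 := +%R)) => [x y|];
  rewrite ?ps_coordD ?ps_coord0. Qed.

Fact ps_make_proof (f : index -> A) :
  in_proj_sum e [ffun k : index => e (tag k) * f k : (A^c)^o].
Proof. by move=> k; exists (f k); rewrite ffunE. Qed.
(** The idempotent in front forces the k-th coordinate into e_k A. *)
Definition ps_make (f : index -> A) : PS :=
  insub_mod (U := Submodule (@proj_sum0 A V e r) (@proj_sumD A V e r) (@proj_sumZ A V e r))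
    (ps_make_proof f).
Lemma ps_makeE f k : ps_coord (ps_make f) k = e (tag k) * f k.
Proof. by rewrite /ps_coord insub_modK ffunE. Qed.

Definition ps_gen (k : index) : PS := ps_make (fun l => (l == k)%:R).
Lemma ps_gen_sum (x : PS) : x = \sum_k ract (ps_gen k) (ps_coord x k).
Proof.
apply: ps_coord_ext => l; rewrite ps_coord_sum (bigD1 l) //= big1 => [|k nk].
  by rewrite ps_coord_ract ps_makeE eqxx mulr1 ps_coord_idem addr0.
by rewrite ps_coord_ract ps_makeE eq_sym (negPf nk) mulr0 mul0r.
Qed.

Section Map.
Variables (M : rmod) (m : index -> M).
Fact psmap_lin : linear (fun x : PS => \sum_k ract (m k) (ps_coord x k)).
Proof.
apply: mk_lin => [x y|a x].
  by rewrite -big_split; apply: eq_bigr => k _; rewrite ps_coordD ractDr.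
rewrite ract_suml; apply: eq_bigr => k _.
by rewrite ps_coord_ract ractA.
Qed.
Definition psmap : {linear PS -> M} := mklin psmap_lin.
Lemma psmapE x : psmap x = \sum_k ract (m k) (ps_coord x k). Proof. by []. Qed.
End Map.

Lemma lin_psE (M : rmod) (h : {linear PS -> M}) x :
  h x = \sum_k ract (h (ps_gen k)) (ps_coord x k).
Proof.
by rewrite {1}[x]ps_gen_sum linear_sum; apply: eq_bigr => k _; rewrite lin_ract.
Qed.

Lemma projective_ps : projective PS.
Proof.
move=> M N g h sg.
pose m k := projT1 (cid (sg (h (ps_gen k)))).
exists (psmap m) => x; rewrite psmapE linear_sum lin_psE; apply: eq_bigr => k _.
by rewrite lin_ract /m; case: cid => y /= ->.
Qed.

(** The coordinates at all copies of a vertex, added up. For multiplicities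
    at most one this is a coordinate indexed by vertices, without dependent
    indices. *)
Definition vcomp (x : PS) (v : V) : A := \sum_(k : index | tag k == v) ps_coord x k.
Lemma vcompD x y v : vcomp (x + y) v = vcomp x v + vcomp y v.
Proof. by rewrite /vcomp -big_split; apply: eq_bigr => k _; rewrite ps_coordD. Qed.
Lemma vcomp_ract x a v : vcomp (ract x a) v = vcomp x v * a.
Proof. by rewrite /vcomp mulr_suml; apply: eq_bigr => k _; rewrite ps_coord_ract. Qed.
Lemma vcomp_e x v : e v * vcomp x v = vcomp x v.
Proof. by rewrite /vcomp mulr_sumr; apply: eq_bigr => k /eqP <-; rewrite ps_coord_idem. Qed.
Lemma vcomp_sum (I : Type) (s : seq I) (P : pred I) (F : I -> PS) v :
  vcomp (\sum_(i <- s | P i) F i) v = \sum_(i <- s | P i) vcomp (F i) v.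
Proof.
apply: (big_morph (vcomp^~ v) (id1 := 0) (op1 := +%R)) => [x y|]; first exact: vcompD.
by rewrite /vcomp big1 // => k _; rewrite ps_coord0.
Qed.

Lemma sum_index (W : nmodType) (F : V -> W) v :
  \sum_(k : index | tag k == v) F (tag k) = F v *+ r v.
Proof.
rewrite big_mkcond /=.
rewrite -(@sig_big_dep _ _ _ V (fun i => 'I_(r i) : finType) xpredT (fun _ => xpredT)
   (fun i _ => if i == v then F i else 0)) /=.
rewrite (bigD1 v) //= eqxx sumr_const card_ord big1 ?addr0 // => i /negPf ->.
by rewrite big1.
Qed.

Lemma psmap_comp (M : rmod) (m : V -> M) x :
  psmap (fun k => m (tag k)) x = \sum_v ract (m v) (vcomp x v).
Proof.
rewrite psmapE (partition_big (fun k : index => tag k) xpredT) //=.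
apply: eq_bigr => v _; rewrite /vcomp ract_sum.
by apply: eq_bigr => k /eqP ->.
Qed.

Definition ps_inj (v : V) (a : A) : PS := ps_make (fun k => if tag k == v then a else 0).
Lemma ps_injD v a b : ps_inj v (a + b) = ps_inj v a + ps_inj v b.
Proof. by apply: ps_coord_ext => k; rewrite ps_coordD !ps_makeE; case: ifP;
  rewrite ?mulr0 ?addr0 // mulrDr. Qed.
Lemma ps_inj_ract v a b : ract (ps_inj v a) b = ps_inj v (a * b).
Proof. by apply: ps_coord_ext => k; rewrite ps_coord_ract !ps_makeE; case: ifP;
  rewrite ?mulr0 ?mul0r // mulrA. Qed.
Lemma ps_inj0 v : ps_inj v 0 = 0.
Proof. by apply: ps_coord_ext => k; rewrite ps_coord0 ps_makeE if_same mulr0. Qed.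
Lemma vcomp_inj v a u : vcomp (ps_inj v a) u = if u == v then (e v * a) *+ r v else 0.
Proof.
rewrite /vcomp.
under eq_bigr => k _ do rewrite ps_makeE.
rewrite (sum_index (fun w => e w * (if w == v then a else 0))).
by case: eqP => [->//|_]; rewrite mulr0 mul0rn.
Qed.

Hypothesis r1 : forall v, (r v <= 1)%N.

Lemma vcomp_tag x k : vcomp x (tag k) = ps_coord x k.
Proof.
rewrite /vcomp (big_pred1 k) // => l; apply/eqP/eqP => [|->//].
case: k l => [v i] [u j] /= euv; subst u; congr existT; apply: val_inj => /=.
by have := r1 v; have := ltn_ord i; have := ltn_ord j; lia.
Qed.

Lemma vcomp_ext (x y : PS) : (forall v, vcomp x v = vcomp y v) -> x = y.
Proof. by move=> h; apply: ps_coord_ext => k; rewrite -!vcomp_tag h. Qed.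

Lemma ps_inj_sum (x : PS) : x = \sum_v ps_inj v (vcomp x v).
Proof.
apply: vcomp_ext => u; rewrite vcomp_sum (bigD1 u) //= big1 => [|v nv].
  rewrite vcomp_inj eqxx vcomp_e addr0.
  have := r1 u; case: (posnP (r u)) => [r0 _|r0 ru]; last by rewrite (_ : r u = 1%N) //; lia.
  rewrite r0 /vcomp big_pred0 // => -[w i] /=; apply/eqP => ew; subst w.
  by have := leq_ltn_trans (leq0n _) (ltn_ord i); rewrite [X in (_ < X)%N]r0.
by rewrite vcomp_inj eq_sym (negPf nv).
Qed.
End OneSum.

Lemma zero_ps : zero_mod (proj_sum e (fun=> 0%N)).
Proof. by move=> x; apply: ps_coord_ext => -[v [i hi]]; have := hi; rewrite ltn0. Qed.

End ProjSum.

Lemma iso_ps_eq (A : pzRingType) (V : finType) (e : V -> A) (r r' : V -> nat) :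
  r =1 r' -> iso_mod (proj_sum e r) (proj_sum e r').
Proof. by move=> /funext ->; apply: iso_refl. Qed.

(** * Radical, and uniqueness of minimal presentations *)

Section Nakayama.
Variables (K : fieldType) (n : nat).
Local Notation A := (preproj K n).
Local Notation rmod := (rmod A).
Local Notation PS := (proj_sum (@idem K n)).

Lemma ideme (i : 'I_n) : idem K i * idem K i = idem K i.
Proof. by rewrite idemM eqxx. Qed.

(** The arrow ideal. *)
Definition in_rad (d : A) : Prop := forall c, pcoef c 0 0 d = 0.
Definition rad_mod (M : rmod) : M -> Prop :=
  addspan (fun x : M => exists m d, in_rad d /\ x = ract m d).
(** The t-th power of the arrow ideal, by coefficients. *)
Definition deg_ge t (d : A) : Prop := forall c p q, (p + q < t)%N -> pcoef c p q d = 0.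

Lemma in_rad_mulr (d a : A) : in_rad d -> in_rad (d * a).
Proof. by move=> h c; rewrite pcoef_mul00 h mul0r. Qed.
Lemma deg_ge_mul t (d d' : A) : in_rad d' -> deg_ge t d -> deg_ge t.+1 (d' * d).
Proof.
move=> h' h; have : supp_in (fun c p q => 0 < p + q)%N d'.
  by move=> c p q; rewrite -leqNgt leqn0 addn_eq0 => /andP[/eqP-> /eqP->].
elim/supp_ind => [|f g hf hg|a c p q hb hpq] c' P Q hPQ.
- by rewrite mul0r pcoef0.
- by rewrite mulrDl pcoefD hf // hg // addr0.
rewrite -ba_scaleAl pcoefZ pcoef_monoM; case: and4P => [[_ _ h1 h2]|_]; last by rewrite mulr0.
by rewrite h ?mulr0 //; lia.
Qed.

Lemma deg_ge_big t (d : A) : (n <= t)%N -> deg_ge t d -> d = 0.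
Proof. by move=> ht h; apply: pcoef_ext => c p q; rewrite /in_bounds => hb; apply: h; lia. Qed.

(** The radical is nilpotent: a product of t elements of the radical has
    only monomials of degree at least t. Descending from degree n, the
    products of all elements of M with elements of degree n - t lie in L. *)
Lemma nakayama (M : rmod) (L : submodule M) :
  (forall x, exists y z, [/\ L y, rad_mod z & x = y + z]) -> forall x, L x.
Proof.
move=> H x; suff Hd t : forall m d, deg_ge (n - t) d -> L (ract m d).
  by rewrite -[x]ract1; apply: (Hd n) => c p q; rewrite subnn.
elim: t => [|t IH] m d hd.
  by rewrite (deg_ge_big _ hd) ?subn0 // ract0r; apply: subm0.
have [ht|ht] := leqP n t.
  apply: IH => c p q; rewrite (_ : n - t = 0)%N //; lia.
have [y [z [Ly Rz ->]]] := H m; rewrite ractDl; apply: submD; first exact: sub_ract.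
elim: Rz => {z} [z [m' [d' [hd' ->]]]| |z1 z2 _ h1 _ h2].
- rewrite ractA; apply: IH; rewrite (_ : n - t = (n - t.+1).+1)%N; last by lia.
  exact: deg_ge_mul.
- by rewrite ract0l; apply: subm0.
rewrite ractBl; apply: submD => //; rewrite -scaleN1r; exact: submZ.
Qed.

Lemma ps_coord_rad r (x : PS r) : (forall k, in_rad (ps_coord x k)) -> rad_mod x.
Proof.
move=> h; rewrite [x](ps_gen_sum ideme); elim/big_rec: _ => [|k y _ hy]; first exact: addspan0.
by apply: addspanD => //; apply: addspan_gen; exists (ps_gen _ k), (ps_coord x k).
Qed.

Lemma small_ps r (M : rmod) (p : {linear PS r -> M}) :
  (forall x, p x = 0 -> forall k, in_rad (ps_coord x k)) -> small_kernel p.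
Proof.
move=> h L HL; apply: nakayama => x; have [y [z [Ly pz ->]]] := HL x.
by exists y, z; split=> //; apply: ps_coord_rad; apply: h.
Qed.

Lemma sum_index_at r (v : 'I_n) (F : {i : 'I_n & 'I_(r i)} -> K) :
  (forall k, tag k != v -> F k = 0) ->
  \sum_k F k = \sum_(a < r v) F (Tagged (fun i => 'I_(r i)) a).
Proof.
move=> h0.
rewrite (eq_bigl (fun k => xpredT (tag k) && xpredT (tagged k))) //.
have -> : \sum_(k | xpredT (tag k) && xpredT (tagged k)) F k =
   \sum_(k : {i : 'I_n & 'I_(r i)} | xpredT (tag k) && xpredT (tagged k))
      F (Tagged (fun i => 'I_(r i)) (tagged k)) by apply: eq_bigr => -[].
rewrite -(@sig_big_dep _ _ _ 'I_n (fun i => 'I_(r i) : finType) xpredT (fun _ => xpredT)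
   (fun i j => F (Tagged (fun i => 'I_(r i)) j))) /=.
by rewrite (bigD1 v) //= addrC big1 ?add0r // => i ni; rewrite big1 // => j _; apply: h0.
Qed.

(** Taking coefficients at the stationary path of v turns the surjection
    into a matrix of full rank over K; modulo the radical, copies of
    different vertices do not interact. *)
Lemma surj_ps_le r r' (f : {linear PS r -> PS r'}) v : surj_lin f -> (r' v <= r v)%N.
Proof.
move=> sf; pose T r a := Tagged (fun i : 'I_n => 'I_(r i)) (a : 'I_(r v)).
pose eps (x : A) := pcoef v.+1 0 0 x.
(* rows for the generators at v of the source, columns for those of the
   target *)
pose F : 'M[K]_(r v, r' v) :=
  \matrix_(a, b) eps (ps_coord (f (ps_gen (@idem K n) (T r a))) (T r' b)).
suff : row_full F by move=> /eqP <-; apply: rank_leq_row.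
rewrite -sub1mx; apply/row_subP => i; apply/submxP.
have [x ex] := sf (ps_gen (@idem K n) (T r' i)).
exists (\row_a eps (ps_coord x (T r a))); apply/rowP => b.
have E : eps (ps_coord (f x) (T r' b)) = (i == b)%:R.
  rewrite ex ps_makeE /eps pcoef_mul00 -enE pcoef_en !eqxx /in_bounds addn0 ltn_ord /= mul1r.
  rewrite eq_Tagged /= [b == i]eq_sym; case: (i == b); last by rewrite pcoef0.
  by rewrite pcoef00_1 ?ltn_ord.
rewrite !mxE -E (lin_psE ideme) ps_coord_sum /eps pcoef_sum.
rewrite (sum_index_at (v := v)) => [|k nk].
  by apply: eq_bigr => a _; rewrite ps_coord_ract pcoef_mul00 mulrC !mxE.
rewrite ps_coord_ract pcoef_mul00 -[ps_coord x k](ps_coord_idem ideme) pcoef_mul00.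
rewrite -enE pcoef_en eqSS; rewrite (_ : (tag k == v :> nat) = false) ?mul0r ?mulr0 //.
exact: negbTE.
Qed.

(** The isomorphism lifts to the projectives. The lifts are surjective
    because their images together with a small kernel cover the targets. *)
Lemma surj_presentation (M N : rmod) (th : {linear M -> N}) r s r' s'
  (f : {linear PS s -> PS r}) (p : {linear PS r -> M})
  (f' : {linear PS s' -> PS r'}) (p' : {linear PS r' -> N}) v :
  bijective th -> minimal_presentation f p -> minimal_presentation f' p' ->
  (r' v <= r v)%N /\ (s' v <= s v)%N.
Proof.
move=> bth [sp ex _ _] [sp' ex' smp' smf'].
have [thi thK thiK] := bth.
have [g eg] := @projective_ps _ _ _ ideme r _ _ p' (mklin (comp_lin p th)) sp'.
have {}eg x : p' (g x) = th (p x) by rewrite eg.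
have sg : surj_lin g.
  apply: (smp' (image_sub g)) => x.
  have [u eu] := sp (thi (p' x)); exists (g u), (x - g u); split.
  - by exists u.
  - by rewrite linearB eg eu thiK subrr.
  by rewrite addrC subrK.
have Pf' x : p' (f' x) = 0 by apply/ex'; exists x.
have Pf x : p (f x) = 0 by apply/ex; exists x.
have lf' : linear (fun x => insub_mod (U := kernel p') (Pf' x)).
  by move=> a x y; apply: submod_inj; rewrite submod_valP !insub_modK linearP.
have Pgf x : p' (g (f x)) = 0 by rewrite eg Pf linear0.
have lgf : linear (fun x => insub_mod (U := kernel p') (Pgf x)).
  by move=> a x y; apply: submod_inj; rewrite submod_valP !insub_modK !linearP.
have sf' : surj_lin (mklin lf').
  move=> z; have [y ey] := proj1 (ex' (submod_val z)) (submod_valE z).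
  by exists y; apply: submod_inj; rewrite mklinE insub_modK.
have [h eh] := @projective_ps _ _ _ ideme s _ _ (mklin lf') (mklin lgf) sf'.
have {}eh x : f' (h x) = g (f x) by have := congr1 (@submod_val _ _ _) (eh x).
have sh : surj_lin h.
  apply: (smf' (image_sub h)) => x.
  have [w ew] := sg (f' x).
  have [|u eu] := proj1 (ex w).
    by apply: (can_inj thK); rewrite linear0 -eg ew Pf'.
  exists (h u), (x - h u); split; first by exists u.
    by rewrite linearB eh eu ew subrr.
  by rewrite addrC subrK.
by split; apply: surj_ps_le; eassumption.
Qed.

Lemma presentation_unique (M N : rmod) r s r' s'
  (f : {linear PS s -> PS r}) (p : {linear PS r -> M})
  (f' : {linear PS s' -> PS r'}) (p' : {linear PS r' -> N}) v :
  iso_mod M N -> minimal_presentation f p -> minimal_presentation f' p' ->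
  r v = r' v /\ s v = s' v.
Proof.
move=> iMN mp mp'; have [th bth] := iMN; have [th' bth'] := iso_sym iMN.
have [h1 h2] := surj_presentation v bth mp mp'.
have [h3 h4] := surj_presentation v bth' mp' mp.
by split; apply/eqP; rewrite eqn_leq ?h1 ?h2 ?h3 ?h4.
Qed.

Lemma iso_ps_mult r r' v : iso_mod (PS r) (PS r') -> r v = r' v.
Proof.
move=> i; have [f [g fK gK]] := i; have [f' [g' fK' gK']] := iso_sym i.
apply/eqP; rewrite eqn_leq; apply/andP; split.
  by apply: (surj_ps_le (f := f')) => y; exists (g' y).
by apply: (surj_ps_le (f := f)) => y; exists (g y).
Qed.

End Nakayama.

(** * Indecomposable projective modules *)

Section Functional.
Variables (K : fieldType) (n : nat).
Local Notation A := (preproj K n).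
Local Notation rmod := (rmod A).
Variable L : rmod.
Implicit Types (U : L -> Prop) (x y a : L).

Definition subspace U := [/\ U 0, forall x y, U x -> U y -> U (x + y)
  & forall c x, U x -> U (ract x (scal n c))].

Definition add_line U a : L -> Prop := fun x => exists c y, U y /\ x = y + ract a (scal n c).

Lemma scalD (c d : K) : scal n (c + d) = scal n c + scal n d.
Proof. by rewrite /scal scalerDl. Qed.
Lemma scalM (c d : K) : scal n (c * d) = scal n c * scal n d.
Proof. by rewrite /scal -ba_scaleAl mul1r scalerA. Qed.
Lemma scal1 : scal n (1 : K) = 1.
Proof. by rewrite /scal scale1r. Qed.
Lemma scal0 : scal n (0 : K) = 0.
Proof. by rewrite /scal scale0r. Qed.

Lemma subspace_line U a : subspace U -> subspace (add_line U a).
Proof.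
case=> U0 UD UZ; split.
- by exists 0, 0; rewrite scal0 ract0r addr0.
- move=> _ _ [c [y [Uy ->]]] [d [z [Uz ->]]]; exists (c + d), (y + z); split; first exact: UD.
  by rewrite scalD ractDr addrACA.
move=> t _ [c [y [Uy ->]]]; exists (c * t), (ract y (scal n t)); split; first exact: UZ.
by rewrite ractDl ractA scalM.
Qed.

Fixpoint add_lines U (s : seq L) : L -> Prop :=
  if s is a :: s' then add_lines (add_line U a) s' else U.

Lemma add_lines_sum s U (c : 'I_(size s) -> K) y : U y ->
  add_lines U s (y + \sum_(i < size s) ract (s`_i) (scal n (c i))).
Proof.
elim: s U c y => [|a s IH] U c y Uy; first by rewrite big_ord0 addr0.
rewrite big_ord_recl /= addrA; apply: (IH _ (fun i => c (lift ord0 i))).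
by exists (c ord0), y.
Qed.

(** The vectors of s are added to U one by one. The last proper subspace in
    this chain is a hyperplane, and the functional is the coordinate along
    the vector that completes it. *)
Lemma functional_exists s U : subspace U -> ~ (forall x, U x) ->
  (forall x, add_lines U s x) ->
  exists phi : L -> K, [/\ forall x y, phi (x + y) = phi x + phi y,
    forall c x, phi (ract x (scal n c)) = c * phi x,
    forall x, U x -> phi x = 0 & exists x, phi x != 0].
Proof.
elim: s U => [|a s IH] U sU nU /= hU; first by case: nU.
have [h|h] := pselect (forall x, add_line U a x); last first.
  have [phi [pD pZ p0 px]] := IH _ (subspace_line a sU) h hU.
  exists phi; split=> // x Ux; apply: p0; exists 0, x; split=> //.
  by rewrite scal0 ract0r addr0.
have [U0 UD UZ] := sU.
have UN x : U x -> U (- x).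
  by move=> /(UZ (-1)); rewrite /scal scaleN1r -[ract _ _]/(_ *: _) scaleN1r.
have nUa : ~ U a.
  move=> Ua; apply: nU => x; have [c [y [Uy ->]]] := h x.
  by apply: UD => //; apply: UZ.
pose phi x := projT1 (cid (h x)).
have phiP x : U (x - ract a (scal n (phi x))).
  by rewrite /phi; case: cid => c /= [y [Uy ->]]; rewrite addrK.
have uniq x c : U (x - ract a (scal n c)) -> phi x = c.
  move=> hc; apply/eqP; apply: contraT => ne; case: nUa.
  have := UD _ _ hc (UN _ (phiP x)); rewrite opprB addrC addrA subrK -ractBr.
  have -> : scal n (phi x) - scal n c = scal n (phi x - c) by rewrite /scal scalerBl.
  move=> /(UZ (phi x - c)^-1); rewrite ractA -scalM mulfV ?scal1 ?ract1 //.
  by rewrite subr_eq0.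
exists phi; split.
- move=> x y; apply: uniq; rewrite scalD ractDr opprD addrACA; exact: UD.
- move=> c x; apply: uniq; rewrite mulrC scalM -ractA -ractBl; exact: UZ.
- by move=> x Ux; apply: uniq; rewrite scal0 ract0r subr0.
exists a; rewrite (uniq a 1) ?oner_eq0 //.
by rewrite scal1 ract1 subrr.
Qed.

End Functional.

Section Projectives.
Variables (K : fieldType) (n : nat).
Local Notation A := (preproj K n).
Local Notation en := (vertex_idem K n).
Local Notation om := (socle_elt K n).
Local Notation rmod := (rmod A).
Local Notation reg := ((A^c)^o : rmod).
Local Notation PS := (proj_sum (@idem K n)).
Local Notation full := (unit_ideal A).

Lemma fin_dimP (M : rmod) : fin_dim M <-> exists s : seq M,
  forall x, exists c : 'I_(size s) -> K, x = \sum_(i < size s) ract (s`_i) (scal n (c i)).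
Proof. exact: (conj id id). Qed.

Lemma summand_fin_dim (M N : rmod) : fin_dim M -> summand N M -> fin_dim N.
Proof.
move=> /fin_dimP[s hs] /summand_split[i [p pi]]; apply/fin_dimP.
exists (map p s) => x; have [c ec] := hs (i x).
have e : size (map p s) = size s by rewrite size_map.
exists (fun k => c (cast_ord e k)).
rewrite -[LHS]pi ec linear_sum (reindex (cast_ord e)) /=; last first.
  by exists (cast_ord (esym e)) => k _; rewrite ?cast_ordK ?cast_ordKV.
by apply: eq_bigr => k _; rewrite lin_ract (nth_map 0) // -e.
Qed.

Lemma en_rad (v : nat) (d : A) : pcoef v 0 0 d = 0 -> in_rad (d * en v).
Proof.
move=> hd c; rewrite pcoef_mul00 pcoef_en; case: and4P => [[/eqP<- _ _ _]|_].
  by rewrite hd mul0r.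
by rewrite mulr0.
Qed.

(** Only the stationary path at its end vertex does not kill a socle
    element. *)
Lemma om_mul v (a : A) : (0 < v <= n)%N -> om (n.+1 - v) * a = pcoef v 0 0 a *: om (n.+1 - v).
Proof.
move=> hv; elim/mono_span: a => [|f g hf hg|a c p q hb].
- by rewrite mulr0 pcoef0 scale0r.
- by rewrite mulrDr hf hg pcoefD scalerDl.
rewrite -ba_scaleAr pcoefZ -scalerA; congr (_ *: _).
rewrite pcoef_mono /socle_elt monoM; case: and4P => [[/eqP-> /eqP-> /eqP-> _]|ne].
  by rewrite ifT ?addn0 ?scale1r //; lia.
rewrite scale0r; case: eqP => // e; rewrite mono_oob // /in_bounds.
apply/negP => h; apply: ne; move: h hb e hv; rewrite /in_bounds => h hb e hv.
by split; lia.
Qed.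

(** Some e_v does not annihilate L modulo its radical. A nonzero functional
    on L that kills all x with x e_v in the radical amounts to a map of
    modules from L to the line spanned by the socle element ending at v.
    This line is a quotient of A, by left multiplication with the socle
    element, so projectivity lifts the map to L -> A. Composed with e_v, the
    lift is surjective onto e_v A by Nakayama's lemma, and it splits because
    e_v A is generated by e_v. *)
Lemma indec_projective (L : rmod) : projective L -> fin_dim L -> indecomposable L ->
  exists v : 'I_n, iso_mod L (part full (en v.+1)).
Proof.
move=> pL /fin_dimP[s hs] indL; have [nzL _] := indL.
(* the radical of L is proper by Nakayama's lemma *)
have [x0 nx0] : exists x, ~ rad_mod (M := L) x.
  apply: contra_notP nzL => h.
  pose Z := kernel (mklin (f := (id : L -> L)) (fun _ _ _ => erefl)).
  apply: (nakayama (L := Z)) => x; exists 0, x; rewrite add0r; split=> //.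
  by apply: contrapT => nx; apply: h; exists x.
have [v nv] : exists v : 'I_n, ~ rad_mod (ract x0 (en v.+1)).
  apply: contra_notP nx0 => h; rewrite -[x0]ract1 -(@sum_en K n) ract_sum.
  elim/big_rec: _ => [|v y _ hy]; first exact: addspan0.
  by apply: addspanD => //; apply: contrapT => nx; apply: h; exists v.
exists v; have hv : (0 < v.+1 <= n)%N by rewrite ltn_ord.
pose U (x : L) := rad_mod (ract x (en v.+1)).
have radR (x : L) a : rad_mod x -> rad_mod (ract x a).
  elim=> {x} [x [m [d [hd ->]]]| |x y _ hx _ hy].
  - by apply: addspan_gen; exists m, (d * a); rewrite ractA; split=> //; apply: in_rad_mulr.
  - by rewrite ract0l; apply: addspan0.
  by rewrite ractBl; apply: addspanB.
have Urad x (d : A) : pcoef v.+1 0 0 d = 0 -> U (ract x d).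
  move=> hd; apply: addspan_gen; exists x, (d * en v.+1); rewrite ractA; split=> //.
  exact: en_rad.
have sU : subspace U.
  split; rewrite /U.
  - by rewrite ract0l; apply: addspan0.
  - by move=> x y hx hy; rewrite ractDl; apply: addspanD.
  move=> c x hx; rewrite ractA (_ : scal n c * _ = en v.+1 * scal n c); last first.
    by rewrite /scal -ba_scaleAl mul1r -ba_scaleAr mulr1.
  by rewrite -ractA; apply: radR.
have nU : ~ forall x, U x by move=> h; apply: nv; apply: h.
have [x|phi [pD pZ pU [x1 nx1]]] := functional_exists (s := s) sU nU.
  have [c ->] := hs x; rewrite -[X in add_lines _ _ X]add0r.
  by apply: add_lines_sum; case: sU.
(* phi is compatible with the character of A at v *)
have pA a x : phi (ract x a) = pcoef v.+1 0 0 a * phi x.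
  set d := a - scal n (pcoef v.+1 0 0 a).
  have Ud : U (ract x d) by apply: Urad; rewrite pcoefB pcoefZ pcoef00_1 // mulr1 subrr.
  have -> : ract x a = ract x (scal n (pcoef v.+1 0 0 a)) + ract x d.
    by rewrite -ractDr addrC subrK.
  by rewrite pD pZ (pU _ Ud) addr0.
set o := om (n.+1 - v.+1).
have lh : linear (fun x : L => (phi x *: o : A) : reg).
  apply: mk_lin => [x y|a x]; first by rewrite pD scalerDl.
  by rewrite pA ract_reg -ba_scaleAl om_mul // scalerA mulrC.
have lg : linear (fun y : reg => (o * (y : A) : A) : reg).
  by apply: mk_lin => [x y|a x]; rewrite ?mulrDr // !ract_reg mulrA.
pose Im := image_sub (mklin lg).
have hI x : Im ((phi x *: o : A) : reg).
  by exists (scal n (phi x)); rewrite mklinE /scal -ba_scaleAr mulr1.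
have lhI : linear (fun x : L => insub_mod (hI x)).
  by move=> a x y; apply: submod_inj; rewrite submod_valP !insub_modK lh.
have gI y : Im (mklin lg y) by exists y.
have lgI : linear (fun y : reg => insub_mod (gI y)).
  by move=> a x y; apply: submod_inj; rewrite submod_valP !insub_modK linearP.
have sgI : surj_lin (mklin lgI).
  by move=> z; have [y ey] := submod_valE z; exists y; apply: submod_inj;
    rewrite mklinE insub_modK.
have [h eh] := pL _ _ (mklin lgI) (mklin lhI) sgI.
have {}eh x : o * (h x : A) = phi x *: o := congr1 (@submod_val _ _ _) (eh x).
have ech x : pcoef v.+1 0 0 (h x : A) = phi x.
  have := eh x; rewrite om_mul // => /(congr1 (pcoef (n.+1 - v.+1) (n.+1 - v.+1).-1 (n - (n.+1 - v.+1)))).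
  by rewrite !pcoefZ pcoef_om ?mulr1 //; lia.
have fl (x : A) : full x -> full (en v.+1 * x) by [].
have lfull : linear (fun x : reg => insub_mod (U := full) (x := x) I).
  by move=> a x y; apply: submod_inj.
pose incl := mklin (comp_lin h (mklin lfull)).
pose b := mklin (comp_lin incl (part_proj fl (en_idem K n v.+1))).
have bE x : submod_val (b x) = en v.+1 * (h x : A) by [].
pose o1 : part full (en v.+1) :=
  insub_mod (U := part full (en v.+1)) (x := en v.+1) (conj I (en_idem K n v.+1)).
(* the generator e_v is hit modulo the radical *)
have sb : surj_lin b.
  apply: (nakayama (L := image_sub b)) => y.
  have [_ ey] := submod_valE y; set ya : A := submod_val y in ey.
  set d : A := (phi x1)^-1 *: ((h x1 : A) * en v.+1).
  exists (b (ract x1 (en v.+1 * ((phi x1)^-1 *: ya)))),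
    (ract (o1 : submod_lmod _) (en v.+1 * (1 - d) * ya)).
  split; first by exists (ract x1 (en v.+1 * ((phi x1)^-1 *: ya))).
    apply: addspan_gen; exists o1, (en v.+1 * (1 - d) * ya); split=> //.
    apply: in_rad_mulr => c; rewrite pcoef_mul00 pcoef_en.
    case: and4P => [[/eqP<- _ _ _]|_]; last by rewrite mul0r.
    rewrite pcoefB pcoef00_1 // pcoefZ pcoef_mul00 ech pcoef_en !eqxx /in_bounds addn0 ltn_ord /= !mulr1.
    by rewrite mul1r mulVf // subrr.
  apply: submod_inj; rewrite submod_valD bE lin_ract ract_val !ract_reg insub_modK.
  rewrite -ba_scaleAr -/ya /d !mulrA en_idem mulrBr mulr1 mulrBl ey.
  rewrite -!ba_scaleAr -ba_scaleAl !mulrA.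
  by rewrite -[_ * en v.+1 * ya]mulrA ey addrC subrK.
have [x2 ex2] := sb o1.
have la : linear (fun y : part full (en v.+1) => ract x2 (submod_val y : A)).
  apply: mk_lin => [y z|a y]; first by rewrite -ractDr.
  by rewrite ract_val ract_reg ractA.
apply: (split_indec (a := mklin la) (b := b)) => //.
  exists id => y /=; last first.
    apply: submod_inj; rewrite mklinE lin_ract ex2 ract_val insub_modK ract_reg.
    by case: (submod_valE y).
  apply: submod_inj; rewrite mklinE lin_ract ex2 ract_val insub_modK ract_reg.
  by case: (submod_valE y).
move=> z; have := congr1 (@submod_val _ _ _) (z o1); rewrite insub_modK submod_val0 => e.
have := @pcoef_en K n v.+1 0 0 v.+1; rewrite e pcoef0 !eqxx /in_bounds addn0 ltn_ord /= => /eqP.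
by rewrite eq_sym oner_eq0.
Qed.

Lemma iso_part_ps (v : 'I_n) :
  iso_mod (part full (en v.+1)) (PS (fun i => (i == v) : nat)).
Proof.
apply: iso_sym.
pose o1 : part full (en v.+1) :=
  insub_mod (U := part full (en v.+1)) (x := en v.+1) (conj I (en_idem K n v.+1)).
pose r (i : 'I_n) := (i == v) : nat.
pose f : {linear PS r -> part full (en v.+1)} := psmap (@idem K n) (fun=> o1).
have r1 i : (r i <= 1)%N by rewrite /r; case: eqP.
have fE x : submod_val (f x) = vcomp x v :> A.
  rewrite /f (@psmap_comp _ _ (@idem K n) r _ (fun=> o1)) (bigD1 v) // big1 => [|i /= ni].
    rewrite Monoid.mulm1 ract_val insub_modK ract_reg enE; exact: (vcomp_e (@ideme K n)).
  rewrite /vcomp big_pred0 ?ract0r // => -[w a] /=; apply/eqP => ew; subst w.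
  by have := leq_ltn_trans (leq0n _) (ltn_ord a); rewrite [X in (_ < X)%N]/r (negPf ni).
apply: (iso_can (f := f) (g := fun y => ps_inj (@idem K n) r v (submod_val y))) => [x|y].
  apply: (vcomp_ext r1) => u; rewrite vcomp_inj fE (vcomp_e (@ideme K n)).
  case: eqP => [->|/eqP ne]; first by rewrite /r eqxx mulr1n.
  rewrite /vcomp big_pred0 // => -[w a] /=; apply/eqP => ew; subst w.
  by have := leq_ltn_trans (leq0n _) (ltn_ord a); rewrite [X in (_ < X)%N]/r (negPf ne).
apply: submod_inj; rewrite fE vcomp_inj eqxx /r eqxx mulr1n -enE.
by case: (submod_valE y).
Qed.

End Projectives.

(** * Minimal presentation of a vertex part *)

Section Presentation.
Variables (K : fieldType) (n j : nat) (X : nat -> bool).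
Local Notation A := (preproj K n).
Local Notation en := (vertex_idem K n).
Local Notation mono := (monomial K n).
Local Notation rmod := (rmod A).
Local Notation reg := ((A^c)^o : rmod).
Local Notation PS := (proj_sum (@idem K n)).
Local Notation pp := (beta_exp j X).
Local Notation qq := (alpha_exp X).
Local Notation nba := (count_a X).
Local Notation is_corner := (corner n X).
Local Notation is_valley := (valley n X).
Local Notation lft := (left_corner X).
Local Notation rgt := (right_corner n X).
Local Notation inb := (in_bounds n).

Hypothesis hj : (0 < j <= n)%N.
Hypothesis hA : nba n.+1 = j.
Variable U : submodule reg.
Hypothesis HU : forall x : A, U x <->
  supp_in (fun c p q => [&& c == j, inb j p q & j <= p + nba (j + q - p)])%N x.

(** The numbers of generators and relations at each vertex; their difference
    is the g-vector of the word. *)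
Definition gens (i : 'I_n) : nat := X i && ~~ X i.+1.
Definition rels (i : 'I_n) : nat := ~~ X i && X i.+1.
Lemma gens1 i : (gens i <= 1)%N. Proof. by rewrite /gens; case: (_ && _). Qed.
Lemma rels1 i : (rels i <= 1)%N. Proof. by rewrite /rels; case: (_ && _). Qed.

Lemma gens_corner (i : 'I_n) : gens i = 1%N <-> is_corner i.+1.
Proof.
rewrite /gens /corner /= ltnS (ltnW (ltn_ord i)) /= eqSS.
have -> : (nat_of_ord i == n) = false by have := ltn_ord i; lia.
by case: (X i) => /=; case: (X i.+1).
Qed.
Lemma rels_valley (i : 'I_n) : rels i = 1%N <-> is_valley i.+1.
Proof. by rewrite /rels /valley /= ltn_ord; case: (X i) => /=; case: (X i.+1). Qed.

Lemma U_mono P Q : (j <= P + nba (j + Q - P))%N -> U (mono j P Q).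
Proof.
move=> h; apply/HU; have [hb|/mono_oob ->] := boolP (inb j P Q); last exact: supp0.
by apply: supp_mono; rewrite eqxx hb h.
Qed.

Lemma U_gen (v : 'I_n) : U (mono j (pp v.+1) (qq v.+1)).
Proof.
have hv : (v.+1 <= n.+1)%N by rewrite ltnS ltnW.
have := walk_content hA hv => e; apply: U_mono.
have -> : (j + qq v.+1 - pp v.+1 = v.+1)%N by lia.
by rewrite /beta_exp; lia.
Qed.

Definition gen_elt (v : 'I_n) : U := insub_mod (U_gen v).
Definition pres_p : {linear PS gens -> U} := psmap (@idem K n) (fun k => gen_elt (tag k)).

Lemma val_sum (V : submodule reg) (I : Type) (r : seq I) (P : pred I) (F : I -> V) :
  submod_val (\sum_(i <- r | P i) F i) = \sum_(i <- r | P i) submod_val (F i).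
Proof. exact: (big_morph _ (id1 := 0) (op1 := +%R)). Qed.

Lemma pres_pE x :
  (submod_val (pres_p x) : A) = \sum_(v : 'I_n) mono j (pp v.+1) (qq v.+1) * vcomp x v.
Proof.
rewrite /pres_p psmap_comp val_sum; apply: eq_bigr => v _.
by rewrite ract_val ract_reg.
Qed.

(** In the summand of the corner c, the preimage of the monomial with
    exponents (P, Q). The sum over v is empty when c lies outside of the
    quiver. *)
Definition corner_mono (c P Q : nat) : PS gens :=
  \sum_(v < n | v.+1 == c) ps_inj (@idem K n) gens v (mono c (P - pp c) (Q - qq c)).

Lemma vcomp_corner_mono c P Q (u : 'I_n) : vcomp (corner_mono c P Q) u =
  if u.+1 == c then mono c (P - pp c) (Q - qq c) *+ gens u else 0.
Proof.
rewrite /corner_mono vcomp_sum; case: eqP => [<-|ne].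
  rewrite (big_pred1 u) => [|v]; last by rewrite eqSS.
  by rewrite vcomp_inj eqxx -enE en_mono eqxx.
rewrite big1 // => v /eqP ev; rewrite vcomp_inj; case: eqP => // euv.
by case: ne; rewrite euv.
Qed.

Lemma corner_mono0 c P Q : mono c (P - pp c) (Q - qq c) = 0 -> corner_mono c P Q = 0.
Proof. by move=> e; rewrite /corner_mono big1 // => v _; rewrite e ps_inj0. Qed.

(** At a corner outside of the quiver both sides vanish. *)
Lemma pres_p_corner_mono c P Q : is_corner c -> (pp c <= P)%N -> (qq c <= Q)%N ->
  (submod_val (pres_p (corner_mono c P Q)) : A) = mono j P Q.
Proof.
move=> kc hP hQ; have cn : (c <= n.+1)%N by case/and3P: kc.
have e := walk_content hA cn.
rewrite pres_pE; have [/andP[c0 c1]|hc] := boolP ((0 < c) && (c <= n))%N; last first.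
  rewrite big1 => [|v _]; last first.
    by rewrite vcomp_corner_mono ifF ?mulr0 //; have := ltn_ord v; lia.
  rewrite mono_oob //; apply/negP; rewrite /in_bounds => hb.
  have [c0|c0] := posnP c; first by move: hP hb; rewrite c0 /beta_exp count_a0; lia.
  have ec : c = n.+1 by lia.
  by move: hQ hb; rewrite ec /alpha_exp hA; lia.
have c1' : (c.-1 < n)%N by lia.
pose u := Ordinal c1'; have eu : u.+1 = c by rewrite /= prednK.
rewrite (bigD1 u) //= big1 => [|v nv].
  rewrite addr0 vcomp_corner_mono eu eqxx (_ : gens u = 1%N) ?mulr1n;
    last by apply/gens_corner; rewrite eu.
  rewrite ?prednK // monoM ifT; first by congr (mono _ _ _); lia.
  by apply/eqP; lia.
rewrite vcomp_corner_mono ifF ?mulr0 //; apply/negP => /eqP ev; move/eqP: nv; apply.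
by apply: val_inj; rewrite /= -ev.
Qed.

Lemma corner_mono_mul c P Q d a b : (pp c <= P)%N -> (qq c <= Q)%N ->
  (d + (P - pp c) = c + (Q - qq c))%N ->
  ract (corner_mono c P Q) (mono d a b) = corner_mono c (P + a) (Q + b).
Proof.
move=> hP hQ e; apply: (vcomp_ext gens1) => u; rewrite vcomp_ract !vcomp_corner_mono.
case: eqP => // _; last by rewrite mul0r.
rewrite mulrnAl monoM e eqxx; congr (mono _ _ _ *+ _); lia.
Qed.

(** The monomial at a valley is a multiple of both of the adjacent
    generators; the relation identifies the two multiples. *)
Definition rel_elt (v : 'I_n) : PS gens :=
  corner_mono (lft v.+1) (pp v.+1) (qq v.+1) - corner_mono (rgt v.+1) (pp v.+1) (qq v.+1).
Definition pres_f : {linear PS rels -> PS gens} := psmap (@idem K n) (fun k => rel_elt (tag k)).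

Lemma pres_fE x : pres_f x = \sum_(v : 'I_n) ract (rel_elt v) (vcomp x v).
Proof. exact: psmap_comp. Qed.

Lemma vcomp0 r (x : PS r) v : r v = 0%N -> vcomp x v = 0.
Proof.
move=> r0; rewrite /vcomp big_pred0 // => -[w i] /=; apply/eqP => ew; subst w.
by have := leq_ltn_trans (leq0n _) (ltn_ord i); rewrite [X in (_ < X)%N]r0.
Qed.

Lemma nth_valley c : is_valley c -> exists v : 'I_n, v.+1 = c.
Proof.
case/and4P => c0 cn _ _; have h : (c.-1 < n)%N by lia.
by exists (Ordinal h); rewrite /= prednK.
Qed.

Lemma left_corner_facts c : is_valley c ->
  [/\ is_corner (lft c), (lft c < c)%N, pp (lft c) = pp c,
  (qq (lft c) < qq c)%N & (c = lft c + (qq c - qq (lft c)))%N].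
Proof.
move=> vc; have [h1 h2 h3'] := left_corner_spec vc;
  have h3 : pp (lft c) = pp c by rewrite /beta_exp h3'.
 have /and4P[c0 cn _ _] := vc.
have e1 := @walk_content n j X c hA; have e2 := @walk_content n j X (lft c) hA.
have := alpha_exp_mono X (ltnW h2); split=> //; lia.
Qed.
Lemma right_corner_facts c : is_valley c ->
  [/\ is_corner (rgt c), (c < rgt c <= n.+1)%N, qq (rgt c) = qq c,
  (pp (rgt c) < pp c)%N & (c + (pp c - pp (rgt c)) = rgt c)%N].
Proof.
move=> vc; have [h1 h2 h3 h4] := right_corner_spec vc; have /and4P[c0 cn _ _] := vc.
have e1 := @walk_content n j X c hA; have e2 := @walk_content n j X (rgt c) hA.
have := beta_exp_anti j X (ltnW h2); split=> //; lia.
Qed.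

Lemma image_rel c P Q : is_valley c -> (pp c <= P)%N -> (qq c <= Q)%N ->
  image_sub pres_f (corner_mono (lft c) P Q - corner_mono (rgt c) P Q).
Proof.
move=> vc hP hQ; have [v ev] := nth_valley vc.
have [l1 l2 l3 l4 l5] := left_corner_facts vc; have [r1 r2 r3 r4 r5] := right_corner_facts vc.
exists (ps_inj (@idem K n) rels v (mono c (P - pp c) (Q - qq c))).
rewrite pres_fE (bigD1 v) //= big1 => [|u nu]; last first.
  by rewrite vcomp_inj (negPf nu) ract0r.
have s1 : rels v = 1%N by apply/rels_valley; rewrite ev.
rewrite addr0 vcomp_inj eqxx s1 mulr1n -enE ev en_mono eqxx /rel_elt ev ractBl.
rewrite corner_mono_mul ?l3 //; [|lia|lia].
rewrite corner_mono_mul ?r3 //; [|lia|lia].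
by rewrite !subnKC.
Qed.

Lemma image0 : image_sub pres_f 0. Proof. exact: subm0. Qed.
Lemma imageD x y : image_sub pres_f x -> image_sub pres_f y -> image_sub pres_f (x + y).
Proof. exact: submD. Qed.
Lemma imageN x : image_sub pres_f x -> image_sub pres_f (- x).
Proof. by move=> h; rewrite -scaleN1r; apply: submZ. Qed.

(** Modulo the relations, the copies of one monomial in the summands of two
    corners agree: the valleys between the corners are crossed one at a
    time. *)
Lemma telescope c c' P Q : is_corner c -> is_corner c' -> (c <= c')%N ->
  (pp c <= P)%N -> (qq c' <= Q)%N -> image_sub pres_f (corner_mono c P Q - corner_mono c' P Q).
Proof.
move=> kc; elim/ltn_ind: c' => c' IH kc' le hP hQ.
have [->|ne] := eqVneq c c'; first by rewrite subrr; apply: image0.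
have lt : (c < c')%N by lia.
have [v [vv /andP[cv vc'] rv lv]] := valley_before kc kc' lt.
have [l1 l2 l3 l4 l5] := left_corner_facts vv; have [r1 r2 r3 r4 r5] := right_corner_facts vv.
have -> : corner_mono c P Q - corner_mono c' P Q =
  (corner_mono c P Q - corner_mono (lft v) P Q)
    + (corner_mono (lft v) P Q - corner_mono (rgt v) P Q).
  by rewrite rv addrA subrK.
have hq : (qq c' = qq v)%N by rewrite -rv.
have hp := beta_exp_anti j X lv.
apply: imageD; first by apply: IH => //; lia.
by apply: image_rel => //; lia.
Qed.

Lemma telescope2 c c' P Q : is_corner c -> is_corner c' -> (pp c <= P)%N -> (qq c <= Q)%N ->
  (pp c' <= P)%N -> (qq c' <= Q)%N -> image_sub pres_f (corner_mono c P Q - corner_mono c' P Q).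
Proof.
move=> kc kc' h1 h2 h3 h4; have [le|/ltnW le] := leqP c c'; first exact: telescope.
by rewrite -opprB; apply/imageN/telescope.
Qed.

(** A monomial that is zero in the algebra is moved to the first or the last
    corner, according to the bound that it violates; in the summand of that
    corner it is zero as well. *)
Lemma image_dead c P Q : is_corner c -> (pp c <= P)%N -> (qq c <= Q)%N -> ~~ inb j P Q ->
  image_sub pres_f (corner_mono c P Q).
Proof.
move=> kc hP hQ; rewrite /in_bounds negb_and -leqNgt -ltnNge => /orP[h|h].
  have [d [kd qd ad pd]] := corner_low n j X.
  have := telescope2 kc kd hP hQ (leq_trans pd h); rewrite qd => /(_ (leq0n _)).
  rewrite (@corner_mono0 d) ?subr0 //; apply: mono_oob; rewrite /in_bounds /beta_exp ad.
  have := @count_a_j n j X d hA; have := kd => /and3P[dn _ _]; rewrite ad => /(_ dn); lia.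
have [d [kd ad pd]] := corner_high hA.
have dn : (d <= n.+1)%N by case/and3P: kd.
have ed := walk_content hA dn; rewrite pd in ed.
have := telescope2 kc kd hP hQ _ _ (P := P) (Q := Q).
rewrite pd leq0n => /(_ isT) T; have {}T := T _.
rewrite -[corner_mono c P Q]subr0 -(@corner_mono0 d P Q).
  by apply: T; lia.
by apply: mono_oob; rewrite /in_bounds; have := count_a_le X d; lia.
Qed.

(** A preimage of the monomial with exponents (P, Q), from some corner below
    it. *)
Definition lift_mono P Q : PS gens :=
  if [pick c : 'I_n.+2 | [&& is_corner c, (pp c <= P)%N & (qq c <= Q)%N]] is Some c
  then corner_mono c P Q else 0.

Lemma lift_monoP c P Q : is_corner c -> (pp c <= P)%N -> (qq c <= Q)%N ->
  exists d, [/\ is_corner d, (pp d <= P)%N, (qq d <= Q)%N & lift_mono P Q = corner_mono d P Q].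
Proof.
move=> kc hP hQ; rewrite /lift_mono; case: pickP => [d /and3P[kd h1 h2]|h]; first by exists d.
have cn : (c < n.+2)%N by case/and3P: kc.
by have := h (Ordinal cn); rewrite /= kc hP hQ.
Qed.

(** The linear section of [pres_p] given by the chosen preimages of the
    monomials. *)
Definition lin_section (z : A) : PS gens :=
  \sum_(P < n.+1) \sum_(Q < n.+1) ract (lift_mono P Q) (scal n (pcoef j P Q z)).

Lemma lin_sectionD z z' : lin_section (z + z') = lin_section z + lin_section z'.
Proof.
rewrite /lin_section -big_split; apply: eq_bigr => P _; rewrite -big_split;
  apply: eq_bigr => Q _.
by rewrite pcoefD scalD ractDr.
Qed.
Lemma lin_sectionZ t z : lin_section (t *: z) = ract (lin_section z) (scal n t).
Proof.
rewrite /lin_section ract_suml; apply: eq_bigr => P _; rewrite ract_suml; apply: eq_bigr => Q _.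
by rewrite pcoefZ mulrC scalM ractA.
Qed.
Lemma lin_section0 : lin_section 0 = 0.
Proof. by rewrite -(scale0r (0 : A)) lin_sectionZ scal0 ract0r. Qed.

Lemma lin_section_mono P Q : inb j P Q -> lin_section (mono j P Q) = lift_mono P Q.
Proof.
move=> hb; have := hb; rewrite /in_bounds => hb'.
have hP : (P < n.+1)%N by lia. have hQ : (Q < n.+1)%N by lia.
rewrite /lin_section (bigD1 (Ordinal hP)) //= (bigD1 (Ordinal hQ)) //= !big1 ?addr0 => [|P' nP|Q' nQ].
- by rewrite pcoef_mono !eqxx hb scal1 ract1.
- rewrite big1 // => Q' _; rewrite pcoef_mono -val_eqE /= in nP *.
  by rewrite eqxx [P == _]eq_sym (negPf nP) /= scal0 ract0r.
rewrite pcoef_mono -val_eqE /= in nQ *.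
by rewrite !eqxx [Q == _]eq_sym (negPf nQ) /= scal0 ract0r.
Qed.

Lemma val_D (V : submodule reg) (x y : V) :
  (submod_val (x + y) : A) = (submod_val x : A) + submod_val y.
Proof. by []. Qed.

(** Exactness is the case where x lies in the kernel. Unlike membership in
    the kernel, this property can be checked on monomials. *)
Definition good (x : PS gens) := image_sub pres_f (x - lin_section (submod_val (pres_p x))).
Lemma goodD x y : good x -> good y -> good (x + y).
Proof.
move=> hx hy; rewrite /good linearD val_D lin_sectionD opprD addrACA; exact: imageD.
Qed.
Lemma good_scal x t : good x -> good (ract x (scal n t)).
Proof.
move=> hx; rewrite /good lin_ract ract_val ract_reg.
have -> : (submod_val (pres_p x) : A) * scal n t = t *: (submod_val (pres_p x) : A).
  by rewrite /scal -ba_scaleAr mulr1.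
rewrite lin_sectionZ -ractBl; exact: sub_ract.
Qed.
Lemma good0 : good 0.
Proof. by rewrite /good linear0 submod_val0 lin_section0 subr0; apply: image0. Qed.

Lemma good_corner_mono c P Q : is_corner c -> (pp c <= P)%N -> (qq c <= Q)%N ->
  good (corner_mono c P Q).
Proof.
move=> kc hP hQ; rewrite /good pres_p_corner_mono //.
have [hb|hb] := boolP (inb j P Q).
  rewrite lin_section_mono //; have [d [kd h1 h2 ->]] := lift_monoP kc hP hQ.
  exact: telescope2.
by rewrite mono_oob // lin_section0 subr0; apply: image_dead.
Qed.

Lemma ps_inj_gens0 v a : gens v = 0%N -> ps_inj (@idem K n) gens v a = 0.
Proof.
move=> g0; apply: (vcomp_ext gens1) => u; rewrite vcomp_inj.
case: eqP => [->|_]; last by rewrite /vcomp big1 // => k _; rewrite ps_coord0.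
by rewrite g0 mulr0n /vcomp big1 // => k _; rewrite ps_coord0.
Qed.

Lemma all_good x : good x.
Proof.
rewrite [x](ps_inj_sum (@ideme K n) gens1).
elim/big_rec: _ => [|v y _ hy]; first exact: good0.
apply: goodD => //; move: (vcomp x v) => {hy} a.
have [g1|g0] : gens v = 1%N \/ gens v = 0%N by rewrite /gens; case: (_ && _); [left|right].
  elim/mono_span: a => [|a b ha hb|t c p q hb]; first by rewrite ps_inj0; apply: good0.
    by rewrite ps_injD; apply: goodD.
  have -> : t *: mono c p q = mono c p q * scal n t by rewrite /scal -ba_scaleAr mulr1.
  rewrite -ps_inj_ract; apply: good_scal.
  have [ec|nc] := eqVneq c v.+1; last first.
    have -> : ps_inj (@idem K n) gens v (mono c p q) = 0; last exact: good0.
    apply: (vcomp_ext gens1) => u;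
      rewrite vcomp_inj -enE en_mono [_ == c]eq_sym (negPf nc) mul0rn if_same.
    by rewrite /vcomp big1 // => k _; rewrite ps_coord0.
  have -> : ps_inj (@idem K n) gens v (mono c p q) = corner_mono c (pp c + p) (qq c + q).
    rewrite /corner_mono (big_pred1 v) => [|u]; last by rewrite ec eqSS.
    by rewrite !addKn.
  by apply: good_corner_mono; rewrite ?leq_addr // ec; apply/gens_corner.
by rewrite ps_inj_gens0 //; apply: good0.
Qed.

Lemma pres_p_surj : surj_lin pres_p.
Proof.
move=> z; exists (lin_section (submod_val z)).
have Sz : supp_in _ (submod_val z : A) := proj1 (HU _) (submod_valE z).
apply: submod_inj; rewrite [RHS](@mono_expand K n).
rewrite /lin_section linear_sum val_sum.
have [j0 jn] := andP hj; have jn' : (j < n.+1)%N by lia.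
rewrite [RHS](bigD1 (Ordinal jn')) // [X in _ = _ + X]big1 ?addr0 => [|c nc]; last first.
  rewrite big1 // => p _; rewrite big1 // => q _; rewrite Sz ?scale0r //.
  by move: nc; rewrite -val_eqE /= => /negPf ->.
apply: eq_bigr => P _; rewrite linear_sum val_sum; apply: eq_bigr => Q _.
rewrite lin_ract ract_val ract_reg.
have [/and3P[_ hb hF]|/Sz ->] := boolP [&& j == j, inb j P Q & (j <= P + nba (j + Q - P))%N];
  last first.
  by rewrite scal0 mulr0 scale0r.
have := hb; rewrite /in_bounds => /andP[hP hQ].
have [c [kc _ h1 h2]] := corner_below hA hP hQ hF.
have [d [kd h3 h4 ->]] := lift_monoP kc h1 h2.
by rewrite pres_p_corner_mono // /scal -ba_scaleAr mulr1.
Qed.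

Lemma pres_pf x : pres_p (pres_f x) = 0.
Proof.
rewrite pres_fE linear_sum big1 // => v _; rewrite lin_ract.
have [s1|s0] : rels v = 1%N \/ rels v = 0%N by rewrite /rels; case: (_ && _); [left|right].
  have vc : is_valley v.+1 by apply/rels_valley.
  have [l1 l2 l3 l4 l5] := left_corner_facts vc; have [r1 r2 r3 r4 r5] := right_corner_facts vc.
  rewrite (_ : pres_p (rel_elt v) = 0) ?ract0l //.
  apply: submod_inj; rewrite /rel_elt linearB submod_valB [X in X - _]pres_p_corner_mono ?l3 //; last exact: ltnW.
  by rewrite [X in _ - X]pres_p_corner_mono ?r3 ?subrr //; apply: ltnW.
by rewrite vcomp0 ?ract0r.
Qed.

Lemma pres_exact x : pres_p x = 0 <-> exists y, pres_f y = x.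
Proof.
split=> [px|[y <-]]; last exact: pres_pf.
by have := all_good x; rewrite /good px submod_val0 lin_section0 subr0.
Qed.

Lemma in_rad_vertex c (a : A) : en c * a = a -> pcoef c 0 0 a = 0 -> in_rad a.
Proof.
move=> ea h0 c'; rewrite -ea pcoef_en_l; case: eqP => // e.
by rewrite -e.
Qed.

(** If x is in the kernel, compare coefficients at the generator of v: by
    [corner_anti] no other generator contributes to it, so x has no constant
    term at v. *)
Lemma pres_p_small : small_kernel pres_p.
Proof.
apply: small_ps => x px k; rewrite -(vcomp_tag gens1); set v := tag k.
have g1 : gens v = 1%N.
  have := gens1 v; have := leq_ltn_trans (leq0n _) (ltn_ord (tagged k)); rewrite -/v; lia.
have kv : is_corner v.+1 by apply/gens_corner.
have ev := vcomp_e (@ideme K n) x v; rewrite -enE in ev.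
apply: (in_rad_vertex ev).
have vn : (v.+1 <= n.+1)%N by rewrite ltnS ltnW.
have e := walk_content hA vn.
have := pres_pE x; rewrite px submod_val0 => /(congr1 (pcoef j (pp v.+1) (qq v.+1))).
rewrite pcoef0 pcoef_sum (bigD1 v) //= big1 => [|u nu].
  rewrite addr0 pcoef_monoM eqxx !leqnn !subnn !andbT => /esym.
  have hvn : (0 < v.+1 <= n)%N by rewrite ltn_ord.
  rewrite /in_bounds (corner_inb hA kv hvn) /=.
  by have -> : (j + qq v.+1 - pp v.+1 = v.+1)%N by rewrite e addnK.
have [gu|gu] : gens u = 1%N \/ gens u = 0%N by rewrite /gens; case: (_ && _); [left|right].
  rewrite pcoef_monoM ifF //; apply/negP => /and4P[_ _ h1 h2].
  move/eqP: nu; apply; apply: val_inj => /=; apply: succn_inj.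
  have ku : is_corner u.+1 by apply/gens_corner.
  by apply/esym; apply: (corner_anti hA) => //; rewrite ltn_ord.
by rewrite (vcomp0 x gu) mulr0 pcoef0.
Qed.

(** If x is in the kernel, look at the summand of the corner next to the
    valley v, on the right if it lies in the quiver and otherwise on the
    left. No other valley has the same neighbour on that side, and the
    relation on its other side contributes in different degrees. If both
    neighbours were outside of the quiver, the word would be b...ba...a and
    U would be zero. *)
Lemma pres_f_small : ~ zero_mod U -> small_kernel pres_f.
Proof.
move=> nzU; apply: small_ps => x fx k; rewrite -(vcomp_tag rels1); set v := tag k.
have s1 : rels v = 1%N.
  have := rels1 v; have := leq_ltn_trans (leq0n _) (ltn_ord (tagged k)); rewrite -/v; lia.
have vv : is_valley v.+1 by apply/rels_valley.
have ev := vcomp_e (@ideme K n) x v; rewrite -enE in ev.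
apply: (in_rad_vertex ev).
have [l1 l2 l3 l4 l5] := left_corner_facts vv; have [r1 r2 r3 r4 r5] := right_corner_facts vv.
have vn : (v.+1 <= n)%N by rewrite ltn_ord.
have Rv (u w : 'I_n) : vcomp (rel_elt w) u =
   (if u.+1 == lft w.+1 then mono u.+1 (pp w.+1 - pp u.+1) (qq w.+1 - qq u.+1) *+ gens u else 0)
  - (if u.+1 == rgt w.+1 then mono u.+1 (pp w.+1 - pp u.+1) (qq w.+1 - qq u.+1) *+ gens u else 0).
  rewrite /rel_elt -scaleN1r vcompD -[(-1) *: _]/(ract _ (-1)) vcomp_ract !vcomp_corner_mono mulrN1.
  by congr (_ - _); case: eqP => // <-.
have fu (u : 'I_n) : \sum_(w : 'I_n) vcomp (rel_elt w) u * vcomp x w = 0.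
  have := congr1 (fun y => vcomp y u) fx; rewrite pres_fE vcomp_sum => e.
  transitivity (vcomp (0 : PS gens) u); last by rewrite /vcomp big1 // => l _;
    rewrite ps_coord0.
  by rewrite -e; apply: eq_bigr => w _; rewrite vcomp_ract.
have [rn|rn] := leqP (rgt v.+1) n.
  have hu : ((rgt v.+1).-1 < n)%N by lia.
  pose u := Ordinal hu; have eu : u.+1 = rgt v.+1 by rewrite /= prednK //; lia.
  have gu : gens u = 1%N by apply/gens_corner; rewrite eu.
  have := congr1 (pcoef u.+1 (pp v.+1 - pp u.+1) 0) (fu u); rewrite pcoef0 pcoef_sum.
  rewrite (bigD1 v) //= big1 ?addr0 => [|w nw].
    rewrite Rv eu eqxx gu mulr1n ifF; last by apply/eqP; lia.
    rewrite sub0r mulNr pcoefN pcoef_monoM eqxx r3 !subnn !leqnn ?subn0 ?addn0 !andbT.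
    rewrite (_ : inb _ _ _) /=; last by rewrite /in_bounds; lia.
    have -> : (rgt v.+1 - (pp v.+1 - pp (rgt v.+1)) = v.+1)%N by lia.
    by move=> /eqP; rewrite oppr_eq0 => /eqP.
  have [sw|sw] : rels w = 1%N \/ rels w = 0%N by rewrite /rels; case: (_ && _); [left|right].
    have vw : is_valley w.+1 by apply/rels_valley.
    have [wl1 wl2 wl3 wl4 wl5] := left_corner_facts vw.
    have [wr1 wr2 wr3 wr4 wr5] := right_corner_facts vw.
    rewrite Rv gu mulr1n [X in _ - X]ifF; last first.
      apply/eqP; rewrite eu => e; move/eqP: nw; apply.
      by apply: val_inj => /=; apply: succn_inj; apply: (right_corner_inj vv vw).
    (* the relation of w contributes only multiples of a power of alpha *)
    rewrite subr0; case: eqP => [e|_]; last by rewrite mul0r pcoef0.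
    rewrite pcoef_monoM ifF //; apply/negP => /and4P[_ _ _]; rewrite e; lia.
  by rewrite (vcomp0 x sw) mulr0 pcoef0.
have er : rgt v.+1 = n.+1 by lia.
have l0 : (0 < lft v.+1)%N.
  rewrite lt0n; apply/negP => /eqP el; case: nzU => z.
  have Sz : supp_in _ (submod_val z : A) := proj1 (HU _) (submod_valE z).
  apply: submod_inj; rewrite submod_val0; apply: pcoef_ext => c p q _; apply: Sz.
  apply/negP => /and3P[/eqP ec hb hF].
  have qv : (qq v.+1 = n.+1 - j)%N by rewrite -r3 er /alpha_exp hA.
  have pv : (pp v.+1 = j)%N by rewrite -l3 el /beta_exp count_a0 subn0.
  have := @walk_content n j X v.+1 hA (ltnW vn); rewrite qv pv => ejn.
  have Av : nba v.+1 = 0%N by move: pv; have := @count_a_j n j X v.+1 hA (ltnW vn);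
    rewrite /beta_exp; lia.
  move: hb hF; rewrite /in_bounds => /andP[hb1 hb2].
  have [hle|/ltnW hle] := leqP (j + q - p) v.+1; have := count_a_bounds X hle; rewrite Av.
    by move: hb1; clear; lia.
  by move: hb1 hb2 ejn hj; clear; lia.
have hu : ((lft v.+1).-1 < n)%N by lia.
pose u := Ordinal hu; have eu : u.+1 = lft v.+1 by rewrite /= prednK //; lia.
have gu : gens u = 1%N by apply/gens_corner; rewrite eu.
have := congr1 (pcoef u.+1 0 (qq v.+1 - qq u.+1)) (fu u); rewrite pcoef0 pcoef_sum.
rewrite (bigD1 v) //= big1 ?addr0 => [|w nw].
  rewrite Rv eu eqxx gu mulr1n ifF; last by apply/eqP; lia.
  rewrite subr0 pcoef_monoM eqxx l3 !subnn !leqnn ?subn0 ?addn0 !andbT.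
  have hb : inb (lft v.+1) 0 (qq v.+1 - qq (lft v.+1)) by rewrite /in_bounds l0 -l5.
  by rewrite hb /= -l5.
have [sw|sw] : rels w = 1%N \/ rels w = 0%N by rewrite /rels; case: (_ && _); [left|right].
  have vw : is_valley w.+1 by apply/rels_valley.
  have [wl1 wl2 wl3 wl4 wl5] := left_corner_facts vw.
  have [wr1 wr2 wr3 wr4 wr5] := right_corner_facts vw.
  rewrite Rv gu mulr1n [X in X - _]ifF; last first.
    apply/eqP; rewrite eu => e; move/eqP: nw; apply.
    by apply: val_inj => /=; apply: succn_inj; apply: (left_corner_inj vv vw).
  (* the relation of w contributes only multiples of a power of beta *)
  rewrite sub0r; case: eqP => [e|_]; last by rewrite oppr0 mul0r pcoef0.
  rewrite mulNr pcoefN pcoef_monoM ifF ?oppr0 //; apply/negP => /and4P[_ _ + _]; rewrite e; lia.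
by rewrite (vcomp0 x sw) mulr0 pcoef0.
Qed.

Theorem pres_minimal : ~ zero_mod U -> minimal_presentation pres_f pres_p.
Proof.
move=> nz; split; [exact: pres_p_surj | exact: pres_exact | exact: pres_p_small | exact: pres_f_small].
Qed.

End Presentation.

(** * The staircase triangulation of the prism *)

Import Order.TTheory.

Section Prism.
Variables (R : realType) (n : nat).
Local Notation pv := (prism_vertex n).
Local Notation pt := (@vertex_point R n).
Implicit Types (d : pv -> R) (s t : {set pv}) (x : 'rV[R]_(n.+1 + 2)).

(** Weights on all vertices of the prism, zero outside of the simplex at
    hand, avoid sums over subsets. *)
Definition wsum d := \sum_v d v *: pt v.
Local Notation yc i := (lshift 2 (i : 'I_n.+1)).
Local Notation zc b := (rshift n.+1 (if b then 0 else 1 : 'I_2)).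

Lemma sum_pv (V : nmodType) (F : pv -> V) : \sum_v F v = \sum_i (F (i, true) + F (i, false)).
Proof.
transitivity (\sum_i \sum_b F (i, b)); last by apply: eq_bigr => i _; rewrite big_bool.
by rewrite pair_bigA; apply: eq_bigr => -[].
Qed.

Lemma pt_y v k : pt v 0 (yc k) = (k == v.1)%:R.
Proof. by rewrite /vertex_point row_mxEl mxE eqxx. Qed.
Lemma pt_z v b : pt v 0 (zc b) = (b == v.2)%:R.
Proof. by rewrite /vertex_point row_mxEr mxE eqxx /=; case: b; case: v.2. Qed.

Lemma wsum_y d i : wsum d 0 (yc i) = d (i, true) + d (i, false).
Proof.
rewrite /wsum sum_pv summxE (bigD1 i) //= big1 => [|k nk].
  by rewrite addr0 mxE [X in X + _]mxE [X in _ + X]mxE !pt_y eqxx !mulr1.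
rewrite mxE [X in X + _]mxE [X in _ + X]mxE !pt_y /=.
by rewrite [i == k]eq_sym (negPf nk) !mulr0 addr0.
Qed.

Lemma wsum_z d b : wsum d 0 (zc b) = \sum_i d (i, b).
Proof.
rewrite /wsum sum_pv summxE; apply: eq_bigr => i _.
rewrite mxE [X in X + _]mxE [X in _ + X]mxE !pt_z /=.
by case: b => /=; rewrite mulr1 mulr0 ?addr0 ?add0r.
Qed.

(** The coordinates of a point are the sums of the weights over each pair
    a_i, b_i and over each of the two letters. *)
Lemma wsum_ext d d' : (forall i, d (i, true) + d (i, false) = d' (i, true) + d' (i, false)) ->
  \sum_i d (i, true) = \sum_i d' (i, true) -> \sum_i d (i, false) = \sum_i d' (i, false) ->
  wsum d = wsum d'.
Proof.
move=> hy ht hf; apply/rowP => k; rewrite -(splitK k); case: (split k) => /= [i|i].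
  by rewrite !wsum_y.
have := wsum_z d (i == 0); have := wsum_z d' (i == 0).
have -> : (if i == 0 then 0 else 1 : 'I_2) = i by case: i => -[|[|//]] hi; apply: val_inj.
by move=> -> ->; case: (i == 0).
Qed.

Lemma in_convP s x : in_conv s x <-> exists d, [/\ forall v, 0 <= d v,
  forall v, v \notin s -> d v = 0, \sum_v d v = 1 & x = wsum d].
Proof.
split=> [[c [c0 c1 ->]]|[d [d0 ds d1 ->]]].
  exists (fun v => if v \in s then c v else 0); split.
  - by move=> v; case: ifP.
  - by move=> v /negPf ->.
  - by rewrite -big_mkcond.
  rewrite /wsum [LHS]big_mkcond; apply: eq_bigr => v _.
  by case: ifP; rewrite ?scale0r.
exists d; split=> //.
  rewrite -d1 [RHS](bigID (mem s)) /= [X in _ = _ + X]big1 ?addr0 // => v; exact: ds.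
rewrite /wsum (bigID (mem s)) /= [X in _ + X]big1 ?addr0 // => v /ds ->.
by rewrite scale0r.
Qed.

Lemma in_conv_sub s t x : s \subset t -> in_conv s x -> in_conv t x.
Proof.
move=> /subsetP st /in_convP[d [d0 ds d1 ->]]; apply/in_convP; exists d; split=> // v nv.
by apply: ds; apply: contra nv; apply: st.
Qed.

Lemma in_prism_vertex v : in_prism (pt v).
Proof.
apply/in_convP; exists (fun u => (u == v)%:R); split.
- by move=> u; apply: ler0n.
- by move=> u; rewrite inE.
- by rewrite (bigD1 v) //= eqxx big1 ?addr0 // => u /negPf ->.
rewrite /wsum (bigD1 v) //= eqxx scale1r big1 ?addr0 // => u /negPf ->.
by rewrite scale0r.
Qed.

Lemma vertex_pointE v : pt v = wsum (fun u => (u == v)%:R).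
Proof.
rewrite /wsum (bigD1 v) //= eqxx scale1r big1 ?addr0 // => u /negPf ->.
by rewrite scale0r.
Qed.

(** A coordinate that vanishes on the simplex, but not on the prism, cuts
    out a proper face which contains the simplex. *)
Lemma boundary_coord s k v : (forall x, in_prism x -> 0 <= x 0 k) ->
  (forall x, in_conv s x -> x 0 k = 0) -> 0 < pt v 0 k ->
  forall x, in_conv s x -> in_boundary x.
Proof.
move=> pos zero vk x sx; split; first by apply: in_conv_sub sx; apply: subsetT.
have E y : (y *m - delta_mx k 0) 0 0 = - y 0 k :> R.
  rewrite mulmxN mxE; congr (- _); rewrite mxE (bigD1 k) //= big1 => [|l nl].
    by rewrite mxE !eqxx mulr1 addr0.
  by rewrite mxE (negPf nl) mulr0.
exists (- delta_mx k 0); split.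
  by move=> y py; rewrite !E (zero _ sx) oppr0 oppr_le0; apply: pos.
exists (pt v); first exact: in_prism_vertex.
by rewrite !E (zero _ sx) oppr0 oppr_lt0.
Qed.

Lemma internal_index s i : internal_simplex R s -> exists b, (i, b) \in s.
Proof.
move=> int; have [|n1] := boolP ((i, true) \in s); first by exists true.
have [|n2] := boolP ((i, false) \in s); first by exists false.
case: int; apply: (@boundary_coord s (yc i) (i, true)).
- by move=> x /in_convP[d [d0 _ _ ->]]; rewrite wsum_y addr_ge0.
- by move=> x /in_convP[d [d0 ds _ ->]]; rewrite wsum_y !ds ?addr0.
by rewrite vertex_pointE wsum_y eqxx ltr_wpDr ?ltr01 ?ler0n.
Qed.

Lemma internal_letter s b : internal_simplex R s -> exists i, (i, b) \in s.
Proof.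
move=> int; have [/existsP //|h] := boolP [exists i, (i, b) \in s].
case: int; apply: (@boundary_coord s (zc b) (ord0, b)).
- by move=> x /in_convP[d [d0 _ _ ->]]; rewrite wsum_z sumr_ge0.
- move=> x /in_convP[d [d0 ds _ ->]]; rewrite wsum_z big1 // => i _; apply: ds.
  by apply: contra h => hi; apply/existsP; exists i.
rewrite vertex_pointE wsum_z (bigD1 ord0) //= eqxx ltr_wpDr ?ltr01 // sumr_ge0 // => i _.
Qed.

Lemma card_word (X : abword n) : #|word_simplex X| = n.+1.
Proof. by rewrite card_imset ?card_ord // => i k []. Qed.

(** A supporting linear form that is maximal at the barycentre of the
    simplex is constant on its vertices. When both letters occur, it is then
    constant on the whole prism, so the barycentre is not in the boundary. *)
Lemma internal_word (X : abword n) : both_letters X -> internal_simplex R (word_simplex X).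
Proof.
move=> [[it hit] [jf hjf]] bd; pose c : R := n.+1%:R^-1.
have c0 : 0 < c by rewrite invr_gt0 ltr0n.
pose x := \sum_(i < n.+1) c *: pt (i, X i).
have sx : in_conv (word_simplex X) x.
  exists (fun=> c); split.
  - by move=> v; apply: ltW.
  - by rewrite sumr_const card_word -mulr_natl mulfV // pnatr_eq0.
  by rewrite /word_simplex big_imset //= => i k _ _ [].
have [_ [u [hmax [y py hlt]]]] := bd x sx.
pose V v := (pt v *m u) 0 0.
pose m := (x *m u) 0 0.
have Vle v : V v <= m by apply: hmax; apply: in_prism_vertex.
have mE : m = \sum_(i < n.+1) c * V (i, X i).
  by rewrite /m /x mulmx_suml summxE; apply: eq_bigr => i _; rewrite -scalemxAl mxE.
have sc : \sum_(i < n.+1) c = 1.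
  by rewrite sumr_const card_ord -mulr_natl mulfV // pnatr_eq0.
have Veq i : V (i, X i) = m.
  have : \sum_(i < n.+1) c * (m - V (i, X i)) = 0.
    under eq_bigr do rewrite mulrBr.
    by rewrite big_split /= sumrN -mE -mulr_suml sc mul1r subrr.
  move/psumr_eq0P => h; have := h _ i isT.
  move=> /(_ _)/eqP; rewrite mulf_eq0 (gt_eqF c0) /= => h'.
  apply/esym/eqP; rewrite -subr_eq0; apply: h' => k _.
  by apply: mulr_ge0; [exact: ltW | rewrite subr_ge0].
pose mu i := usubmx u i 0; pose nu b := dsubmx u (if b then 0 else 1 : 'I_2) 0.
have VE i b : V (i, b) = mu i + nu b.
  rewrite /V (_ : pt (i, b) *m u = row i (usubmx u) + row (if b then 0 else 1) (dsubmx u)).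
    by rewrite mxE [X in X + _]mxE [X in _ + X]mxE.
  by rewrite -{1}[u]vsubmxK mul_row_col -!rowE.
(* compare the values at the two vertices over an index of either letter *)
have nuE : nu true = nu false.
  apply/eqP; rewrite eq_le; apply/andP; split.
    have := Vle (jf, true); rewrite -(Veq jf) hjf !VE; lra.
  have := Vle (it, false); rewrite -(Veq it) hit !VE; lra.
have Vm v : V v = m.
  case: v => i b; rewrite -(Veq i) !VE; congr (_ + _).
  by case: b; case: (X i); rewrite ?nuE.
suff : (y *m u) 0 0 = m by move=> e; rewrite e ltxx in hlt.
have /in_convP[d [d0 _ d1 ->]] := py.
rewrite /wsum mulmx_suml summxE -[m]mul1r -d1 mulr_suml; apply: eq_bigr => v _.
by rewrite -scalemxAl mxE -[X in _ * X]/(V v) Vm.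
Qed.

End Prism.

Section Staircase.
Variables (R : realType) (n : nat) (w : 'S_n.+1).
Local Notation pv := (prism_vertex n).
Local Notation pt := (@vertex_point R n).
Local Notation wsum := (@wsum R n).
Implicit Types (d : pv -> R) (s t : {set pv}) (x : 'rV[R]_(n.+1 + 2)).

Lemma mem_perm_simplex j k b :
  ((w k, b) \in perm_simplex w j) = if b then (k <= j)%N else (j <= k)%N.
Proof.
rewrite /perm_simplex inE; apply/orP/idP.
  by case=> /imsetP[l]; rewrite inE => hl [/perm_inj -> ->].
by case: b => h; [left|right]; apply/imsetP; exists k; rewrite ?inE.
Qed.

(** The support condition of the j-th cell of the staircase. *)
Definition stair j d := forall k : 'I_n.+1,
  ((j < k)%N -> d (w k, true) = 0) /\ ((k < j)%N -> d (w k, false) = 0).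

Lemma stair_sub j s d : s \subset perm_simplex w j -> (forall v, v \notin s -> d v = 0) ->
  stair j d.
Proof.
move=> /subsetP ss ds k; split=> h; apply: ds; apply/negP => /ss; rewrite mem_perm_simplex; lia.
Qed.

Lemma sum_perm (F : 'I_n.+1 -> R) : \sum_i F i = \sum_k F (w k).
Proof. exact: (reindex_inj perm_inj). Qed.

(** The sums over the pairs a_i, b_i and the total weight of the b_i are
    coordinates of the point. For cells j <= j' the weights of the b_i
    compare termwise; as their totals agree, they are equal. *)
Lemma stair_uniq (j j' : 'I_n.+1) d d' : (forall v, 0 <= d v) -> (forall v, 0 <= d' v) ->
  stair j d -> stair j' d' ->
  (forall i, d (i, true) + d (i, false) = d' (i, true) + d' (i, false)) ->
  \sum_i d (i, false) = \sum_i d' (i, false) -> forall v, d v = d' v.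
Proof.
have main (i i' : 'I_n.+1) c c' : (i <= i')%N -> (forall v, 0 <= c v) ->
  (forall v, 0 <= c' v) ->
  stair i c -> stair i' c' ->
  (forall k, c (k, true) + c (k, false) = c' (k, true) + c' (k, false)) ->
  \sum_k c (k, false) = \sum_k c' (k, false) -> forall k, c (w k, false) = c' (w k, false).
  move=> le c0 c0' sc sc' hy hz.
  have hle k : k != i -> c' (w k, false) <= c (w k, false).
    move=> nk; have [h1 h2] := sc k; have [h1' h2'] := sc' k.
    case: (ltngtP k i) => hk.
    - by rewrite h2' ?c0 //; lia.
    - have := hy (w k); rewrite h1 // add0r => ->.
      by rewrite lerDr.
    by move: nk; rewrite -val_eqE /= hk eqxx.
  (* the entry at the turn of the first staircase is settled by the total
     when both staircases turn at the same place *)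
  have hi : c' (w i, false) <= c (w i, false).
    have [lt|ge] := ltnP i i'; first by have [_ ->] := sc' i; rewrite ?c0.
    have ei : i' = i by apply: val_inj; apply/eqP; rewrite eqn_leq le ge.
    have same k : k != i -> c (w k, false) = c' (w k, false).
      move=> nk; have [h1 h2] := sc k; have [h1' h2'] := sc' k; rewrite ei in h1' h2'.
      case: (ltngtP k i) => hk.
      - by rewrite h2 // h2'.
      - by have := hy (w k); rewrite h1 // h1' // !add0r.
      by move: nk; rewrite -val_eqE /= hk eqxx.
    move: hz; rewrite (sum_perm (fun k => c (k, false))) (sum_perm (fun k => c' (k, false))).
    rewrite (bigD1 i) //= [in RHS](bigD1 i) //= (eq_bigr _ (fun k nk => same k nk)).
    by move=> /addIr ->.
  have hall k : 0 <= c (w k, false) - c' (w k, false).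
    by rewrite subr_ge0; have [->|/hle] := eqVneq k i.
  have : \sum_k (c (w k, false) - c' (w k, false)) = 0.
    rewrite big_split /= sumrN -(sum_perm (fun k => c (k, false))).
    by rewrite -(sum_perm (fun k => c' (k, false))) hz subrr.
  move/psumr_eq0P => H k; apply/eqP; rewrite -subr_eq0; apply/eqP; apply: H => //.
move=> d0 d0' sd sd' hy hz.
have hf k : d (w k, false) = d' (w k, false).
  have [le|/ltnW le] := leqP j j'; first exact: (main j j').
  by apply/esym; apply: (main j' j).
move=> [i b]; rewrite -[i](permKV w); case: b => //.
by have := hy (w ((w^-1)%g i)); rewrite hf => /addIr.
Qed.

Lemma perm_tri_simplex s : s \in perm_triangulation w -> s != set0 /\ aff_indep R s.
Proof.
rewrite inE => /andP[s0 /existsP[j ss]]; split=> // c c1 c2.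
pose d v := if v \in s then c v else 0.
have ds v : v \notin s -> d v = 0 by rewrite /d => /negPf ->.
have sd := stair_sub ss ds.
have wd : wsum d = 0.
  rewrite -[RHS]c2 /wsum [RHS]big_mkcond; apply: eq_bigr => v _.
  by rewrite /d; case: ifP; rewrite ?scale0r.
have hy i : d (i, true) + d (i, false) = 0 by rewrite -wsum_y wd mxE.
have hz : \sum_i d (i, false) = 0 by rewrite -(wsum_z d false) wd mxE.
have dk k : k != j -> d (w k, true) = 0 /\ d (w k, false) = 0.
  move=> nk; have [h1 h2] := sd k; have := hy (w k).
  case: (ltngtP k j) => hk.
  - by rewrite (h2 hk) addr0.
  - by rewrite (h1 hk) add0r.
  by move: nk; rewrite -val_eqE /= hk eqxx.
have djf : d (w j, false) = 0.
  move: hz; rewrite (sum_perm (fun i => d (i, false))) (bigD1 j) //= big1 ?addr0 // => k nk.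
  by have [] := dk k nk.
have djt : d (w j, true) = 0 by have := hy (w j); rewrite djf addr0.
move=> v vs; have -> : c v = d v by rewrite /d vs.
case: v vs => i b _; rewrite -[i](permKV w); set k := (w^-1)%g i.
by have [->|/dk[]] := eqVneq k j; case: b.
Qed.

Lemma discrete_ivt (f : nat -> R) z N : z <= f 0%N -> f N.+1 <= z ->
  exists j, (j <= N)%N /\ f j.+1 <= z <= f j.
Proof.
elim: N => [|N IH] h0 h1; first by exists 0%N; rewrite h1 h0.
have [le|gt] := leP (f N.+1) z; first by have [j [hj hz]] := IH h0 le; exists j; split=> //;
  lia.
by exists N.+1; rewrite h1 (ltW gt).
Qed.

(** The total weight of the letter b is redistributed greedily, starting
    from the last value of w. The cell is the one at which this total is
    used up. *)
Lemma perm_tri_cover x : in_prism x -> exists2 s, s \in perm_triangulation w & in_conv s x.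
Proof.
move=> /in_convP[c [c0 _ c1 ->]].
pose y k := c (w k, true) + c (w k, false).
have y0 k : 0 <= y k by rewrite addr_ge0.
pose z := \sum_k c (w k, false).
pose S j := \sum_(k < n.+1 | (j <= k)%N) y k.
have S1 (j : 'I_n.+1) : S j = y j + S j.+1.
  rewrite /S (bigD1 j) //=; congr (_ + _); apply: eq_bigl => k.
  by rewrite -val_eqE /=; lia.
(* S j is the weight of the positions from j on *)
have [j [hj /andP[z1 z2]]] : exists j, (j <= n)%N /\ S j.+1 <= z <= S j.
  apply: discrete_ivt; first by apply: ler_sum => k _; rewrite lerDr.
  rewrite /S big_pred0 => [|k]; last by have := ltn_ord k; lia.
  exact: sumr_ge0.
have {}hj : (j < n.+1)%N by lia.
pose jo := Ordinal hj.
pose g (k : 'I_n.+1) := if (k < j)%N then 0 else if (j < k)%N then y k else z - S j.+1.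
have g0 k : 0 <= g k by rewrite /g; case: ifP => // _; case: ifP => // _; rewrite subr_ge0.
have gy k : g k <= y k.
  rewrite /g; case: (ltngtP k j) => // hk.
  have -> : k = jo by apply: val_inj.
  by rewrite lerBlDr; have := S1 jo; rewrite /= => <-.
have gz : \sum_k g k = z.
  rewrite (bigD1 jo) //= {1}/g ltnn /= -[RHS](subrK (S j.+1)); congr (_ + _).
  rewrite [RHS]big_mkcond [LHS]big_mkcond; apply: eq_bigr => k _.
  by rewrite -val_eqE /= /g; case: (ltngtP k j).
pose d (v : pv) := let k := (w^-1)%g v.1 in if v.2 then y k - g k else g k.
have dE k b : d (w k, b) = if b then y k - g k else g k by rewrite /d /= permK.
have hy i : d (i, true) + d (i, false) = c (i, true) + c (i, false).
  by rewrite -[i](permKV w) !dE subrK.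
have hf : \sum_i d (i, false) = \sum_i c (i, false).
  rewrite (sum_perm (fun i => d (i, false))) (sum_perm (fun i => c (i, false))) -[RHS]/z -gz.
  by apply: eq_bigr => k _; rewrite dE.
have ht : \sum_i d (i, true) = \sum_i c (i, true).
  apply: (addIr (\sum_i d (i, false))); rewrite {2}hf -!big_split /=.
  by apply: eq_bigr => i _; apply: hy.
exists (perm_simplex w jo).
  rewrite inE; apply/andP; split; last by apply/existsP; exists jo.
  by apply/set0Pn; exists (w jo, true); rewrite mem_perm_simplex leqnn.
apply/in_convP; exists d; split.
- by move=> [i b]; rewrite -[i](permKV w) dE; case: b; rewrite ?subr_ge0.
- move=> [i b]; rewrite -[i](permKV w) mem_perm_simplex dE; set k := (w^-1)%g i.
  by case: b; rewrite -ltnNge /= => h; rewrite /g; case: (ltngtP k j) h; rewrite ?subrr //=;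
    lia.
- by rewrite sum_pv big_split /= ht hf -big_split /= -[LHS](sum_pv c).
exact: wsum_ext.
Qed.

Lemma perm_tri_inter s t x : s \in perm_triangulation w -> t \in perm_triangulation w ->
  in_conv s x -> in_conv t x -> in_conv (s :&: t) x.
Proof.
rewrite !inE => /andP[_ /existsP[j sj]] /andP[_ /existsP[j' tj]].
move=> /in_convP[d [d0 ds d1 ed]] /in_convP[d' [d0' ds' _ ed']].
have E : forall v, d v = d' v.
  apply: (stair_uniq d0 d0' (stair_sub sj ds) (stair_sub tj ds')).
    by move=> i; rewrite -(wsum_y d) -(wsum_y d') -ed -ed'.
  by rewrite -(wsum_z d false) -(wsum_z d' false) -ed -ed'.
apply/in_convP; exists d; split=> // v; rewrite inE negb_and => /orP[/ds //|].
by rewrite E; apply: ds'.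
Qed.

Lemma perm_triangulationP : triangulation R (perm_triangulation w).
Proof.
split; [exact: perm_tri_simplex | | exact: perm_tri_inter | exact: perm_tri_cover].
move=> s t; rewrite !inE => /andP[_ /existsP[j sj]] ts ->.
by apply/existsP; exists j; apply: subset_trans sj.
Qed.

(** The simplex of this word is the facet with vertices a at the first j
    values of w and b at the others, common to the cells j - 1 and j. *)
Definition cut_word (j : nat) : abword n := [ffun i => ((w^-1)%g i < j)%N].

Lemma cut_wordE j k : cut_word j (w k) = (k < j)%N.
Proof. by rewrite ffunE permK. Qed.

Lemma cut_both j : (0 < j <= n)%N -> both_letters (cut_word j).
Proof.
move=> hj; split; first by exists (w ord0); rewrite cut_wordE; case/andP: hj.
by exists (w ord_max); rewrite cut_wordE; apply/negbTE; rewrite /= -leqNgt; case/andP: hj.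
Qed.

Lemma mem_word_simplex (X : abword n) i b : ((i, b) \in word_simplex X) = (b == X i).
Proof.
apply/imsetP/eqP => [[k _ [-> ->]] //|->]; by exists i.
Qed.

Lemma cut_sub (j : 'I_n.+1) : word_simplex (cut_word j) \subset perm_simplex w j.
Proof.
apply/subsetP => -[i b]; rewrite mem_word_simplex -[i](permKV w) cut_wordE mem_perm_simplex.
by move=> /eqP ->; case: ltnP => //; lia.
Qed.

(** An internal n-simplex meets each of the n + 1 pairs a_i, b_i and
    contains only one vertex of each; inside a cell the only choice is the
    letter at the turn. *)
Lemma internal_cells s :
  (s \in perm_triangulation w /\ #|s| = n.+1 /\ internal_simplex R s) <->
  exists j, (0 < j <= n)%N /\ s = word_simplex (cut_word j).
Proof.
split=> [[]|[j [hj ->]]]; last first.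
  split; last by split; [exact: card_word | apply/internal_word/cut_both].
  have hj' : (j < n.+1)%N by lia.
  rewrite inE -card_gt0 card_word /=; apply/existsP; exists (Ordinal hj').
  exact: (cut_sub (Ordinal hj')).
rewrite inE => /andP[_ /existsP[j /subsetP sj]] [cs int].
have fst_onto : [set v.1 | v in s] = setT.
  apply/setP => i; rewrite inE; apply/imsetP.
  by have [b hb] := internal_index i int; exists (i, b).
have inj : {in s &, injective (fun v : pv => v.1)}.
  by apply/imset_injP; rewrite fst_onto cardsT card_ord cs.
have uniq i b b' : (i, b) \in s -> (i, b') \in s -> b = b'.
  by move=> h h'; have [] := inj _ _ h h' erefl.
have [it ht] := internal_letter true int; have [jf hf] := internal_letter false int.
have fin j' : (forall k b, (w k, b) \in s -> b = (k < j')%N) -> s = word_simplex (cut_word j').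
  move=> H; apply/eqP; rewrite eqEcard card_word cs leqnn andbT.
  apply/subsetP => -[i b]; rewrite mem_word_simplex -[i](permKV w) cut_wordE.
  by move=> /H ->.
have := sj _ ht; rewrite -[it](permKV w) mem_perm_simplex; set kt := (w^-1)%g it => lt.
have := sj _ hf; rewrite -[jf](permKV w) mem_perm_simplex; set kf := (w^-1)%g jf => lf.
have ht' : (w kt, true) \in s by rewrite permKV.
have hf' : (w kf, false) \in s by rewrite permKV.
have [b hb] := internal_index (w j) int; case: b hb => hb.
  exists j.+1; split.
    have ne : kf != j by apply/eqP => e; rewrite e in hf'; have := uniq _ _ _ hb hf'.
    by move: ne; rewrite -val_eqE /=; have := ltn_ord kf; lia.
  apply: fin => k b hk; have := sj _ hk; rewrite mem_perm_simplex.
  case: (ltngtP k j) => hkj; case: b hk => hk; rewrite ?ltnS; try lia.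
  by rewrite (_ : k = j) in hk; [have := uniq _ _ _ hb hk | apply: val_inj].
exists j; split.
  have ne : kt != j by apply/eqP => e; rewrite e in ht'; have := uniq _ _ _ hb ht'.
  by move: ne; rewrite -val_eqE /=; have := ltn_ord j; lia.
apply: fin => k b hk; have := sj _ hk; rewrite mem_perm_simplex.
case: (ltngtP k j) => hkj; case: b hk => hk; rewrite ?ltnS; try lia.
by rewrite (_ : k = j) in hk; [have := uniq _ _ _ hb hk | apply: val_inj].
Qed.

(** A set of vertices lies in a cell unless some b precedes some a in the
    order of w. *)
Lemma stair_cases s : (exists j, s \subset perm_simplex w j) \/
  exists k l : 'I_n.+1, [/\ (k < l)%N, (w k, false) \in s & (w l, true) \in s].
Proof.
have [|/existsP h] := boolP [exists k : 'I_n.+1, exists l : 'I_n.+1,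
    [&& (k < l)%N, (w k, false) \in s & (w l, true) \in s]].
  by move=> /existsP[k /existsP[l /and3P[]]]; right; exists k, l.
have H (k l : 'I_n.+1) : (w k, false) \in s -> (w l, true) \in s -> (l <= k)%N.
  move=> h1 h2; rewrite leqNgt; apply/negP => lt; apply: h; exists k; apply/existsP; exists l.
  by rewrite lt h1 h2.
left; have [/existsP[l0 hl0]|/existsPn none] := boolP [exists l, (w l, true) \in s].
  case: (@arg_maxnP _ l0 (fun l => (w l, true) \in s) (fun l => l) hl0) => j hj jmax.
  exists j; apply/subsetP => -[i b]; rewrite -[i](permKV w) mem_perm_simplex.
  by case: b => hb; [apply: jmax | apply: H].
exists ord0; apply/subsetP => -[i b]; rewrite -[i](permKV w) mem_perm_simplex.
by case: b => // hb; have := none ((w^-1)%g i); rewrite hb.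
Qed.

(** Suppose that a simplex contains b at w k and a at w l with k < l. The
    midpoint of this edge is also the midpoint of the edge joining a at w k
    and b at w l, which lies in the simplex of a cut word. The intersection
    of the two simplices contains the midpoint and so contains a at w k and
    b at w l; then the first simplex has the four corners of a parallelogram
    among its vertices, against affine independence. Conversely, the
    barycentre of each cell of T_w lies in some simplex of T, which is
    contained in a cell; by uniqueness of the weights it contains the whole
    cell. *)
Lemma triangulation_unique T : triangulation R T ->
  (forall j, (0 < j <= n)%N -> word_simplex (cut_word j) \in T) -> perm_triangulation w = T.
Proof.
move=> [Ts Tf Ti Tc] Tw.
have sub1 s : s \in T -> s \in perm_triangulation w.
  move=> sT; have [s0 ai] := Ts s sT; rewrite inE s0 /=; apply/existsP.
  case: (stair_cases s) => // -[k [l [lt hk hl]]]; exfalso.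
  have wne : w k != w l by rewrite (inj_eq perm_inj) -val_eqE /=; lia.
  have hk1 : (0 < k.+1 <= n)%N by have := ltn_ord l; lia.
  pose ind (a b : pv) (v : pv) : R := if (v == a) || (v == b) then 2^-1 else 0.
  have sum_ind a b : a != b -> \sum_v ind a b v = 1.
    move=> ab; rewrite (bigD1 a) //= (bigD1 b) 1?eq_sym //= big1 => [|v /andP[na nb]].
      by rewrite /ind !eqxx orbT /= addr0 -mulr2n -[2^-1 *+ 2]mulr_natr mulVf // pnatr_eq0.
    by rewrite /ind (negPf na) (negPf nb).
  have ind_ge a b v : 0 <= ind a b v by rewrite /ind; case: ifP => // _; rewrite invr_ge0 ler0n.
  have ind_conv a b t : a != b -> a \in t -> b \in t -> in_conv t (wsum (ind a b)).
    move=> ab ha hb; apply/in_convP; exists (ind a b); split=> //; last exact: sum_ind.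
    by move=> v nv; rewrite /ind ifF //; apply/negP => /orP[/eqP e|/eqP e];
      rewrite e ?ha ?hb in nv.
  have sumy b1 b2 (i : 'I_n.+1) :
      ind (w k, b1) (w l, b2) (i, true) + ind (w k, b1) (w l, b2) (i, false)
      = if (i == w k) || (i == w l) then 2^-1 else 0.
    rewrite /ind !xpair_eqE.
    have [->|nk] := eqVneq i (w k); first by rewrite (negPf wne); case: b1;
      rewrite /= ?addr0 ?add0r.
    by have [_|_] := eqVneq i (w l); case: b2; rewrite /= ?addr0 ?add0r.
  have sumz b b1 b2 : \sum_i ind (w k, b1) (w l, b2) (i, b) =
      (if b == b1 then 2^-1 else 0) + (if b == b2 then 2^-1 else 0).
    have wne' : (w l == w k) = false by rewrite eq_sym (negPf wne).
    rewrite (bigD1 (w k)) //= (bigD1 (w l)) ?wne' //= big1 ?addr0 => [|i /andP[nk nl]].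
      by rewrite /ind !xpair_eqE !eqxx wne' (negPf wne) /= orbF.
    by rewrite /ind !xpair_eqE (negPf nk) (negPf nl).
  have eqx : wsum (ind (w k, false) (w l, true)) = wsum (ind (w k, true) (w l, false)).
    by apply: wsum_ext => [i||]; rewrite ?sumy ?sumz //= addrC.
  have ne1 : (w k, false) != (w l, true) by rewrite xpair_eqE (negPf wne).
  have ne2 : (w k, true) != (w l, false) by rewrite xpair_eqE (negPf wne).
  have c1 := ind_conv _ _ s ne1 hk hl.
  have c2 : in_conv (word_simplex (cut_word k.+1)) (wsum (ind (w k, false) (w l, true))).
    rewrite eqx; apply: ind_conv => //; rewrite mem_word_simplex cut_wordE;
      first by rewrite ltnSn.
    by rewrite ltnS leqNgt lt.
  have /in_convP[d [_ ds _ ed]] := Ti _ _ _ sT (Tw _ hk1) c1 c2.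
  have dy (i : 'I_n.+1) :
      d (i, true) + d (i, false) = if (i == w k) || (i == w l) then 2^-1 else 0.
    by rewrite -(wsum_y d) -ed wsum_y sumy.
  have half : (2^-1 : R) != 0 by rewrite invr_eq0 pnatr_eq0.
  have hkt : (w k, true) \in s.
    have := dy (w k); rewrite eqxx (ds (w k, false)) ?addr0 => [/= e|].
      apply: contraT => nk; move: half; rewrite -e ds ?eqxx // inE negb_and nk //.
    by rewrite inE mem_word_simplex cut_wordE ltnSn andbF.
  have hlf : (w l, false) \in s.
    have := dy (w l); rewrite eqxx orbT (ds (w l, true)) ?add0r => [/= e|].
      apply: contraT => nl; move: half; rewrite -e ds ?eqxx // inE negb_and nl //.
    by rewrite inE mem_word_simplex cut_wordE ltnS leqNgt lt andbF.
  pose c (v : pv) : R := ind (w k, false) (w l, true) v - ind (w k, true) (w l, false) v.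
  have cs v : v \notin s -> c v = 0.
    move=> nv; rewrite /c /ind; have nev u : u \in s -> (v == u) = false.
      by move=> us; apply/negP => /eqP e; rewrite e us in nv.
    by rewrite !nev //= subrr.
  have extend (V : nmodType) (F : pv -> V) : (forall v, v \notin s -> F v = 0) ->
     \sum_(v in s) F v = \sum_v F v.
    by move=> F0; rewrite [RHS](bigID (mem s)) /= [X in _ = _ + X]big1 ?addr0 // => v /F0.
  have := ai c _ _ _ hk.
  rewrite extend // big_split /= sumrN !sum_ind // subrr => /(_ erefl).
  rewrite extend => [|v /cs ->]; last by rewrite scale0r.
  under eq_bigr do rewrite scalerBl.
  rewrite big_split /= sumrN -!/(wsum _) eqx subrr => /(_ erefl).
  rewrite /c /ind eqxx /= !xpair_eqE (negPf wne) !eqxx /= subr0 => /eqP.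
  by rewrite (negPf half).
apply/setP => s; apply/idP/idP; last exact: sub1.
rewrite inE => /andP[s0 /existsP[j sj]].
suff [t tT pt] : exists2 t, t \in T & perm_simplex w j \subset t.
  by apply: (Tf t) => //; apply: subset_trans pt.
pose q := perm_simplex w j; pose m : R := #|q|%:R^-1.
have q0 : (0 < #|q|)%N.
  by apply/card_gt0P; exists (w j, true); rewrite mem_perm_simplex leqnn.
have m0 : 0 < m by rewrite invr_gt0 ltr0n.
pose d (v : pv) := if v \in q then m else 0.
have d0 v : 0 <= d v by rewrite /d; case: ifP => // _; apply: ltW.
have dq v : v \notin q -> d v = 0 by rewrite /d => /negPf ->.
have pq : in_prism (wsum d).
  apply/in_convP; exists d; split=> // [v|]; first by rewrite inE.
  rewrite -big_mkcond sumr_const -mulr_natl mulfV // pnatr_eq0 -lt0n //.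
have [t tT /in_convP[d' [d0' dt _ ed]]] := Tc _ pq.
exists t => //; have := sub1 t tT; rewrite inE => /andP[_ /existsP[j' tj]].
have E : forall v, d v = d' v.
  apply: (stair_uniq d0 d0' (stair_sub (subxx q) dq) (stair_sub tj dt)).
    by move=> i; rewrite -(wsum_y d) -(wsum_y d') ed.
  by rewrite -(wsum_z d false) -(wsum_z d' false) ed.
apply/subsetP => v vq; apply: contraT => /dt; rewrite -E /d vq => /eqP.
by rewrite (gt_eqF m0).
Qed.

End Staircase.

(** * Words of the indecomposable summands *)

Section Words.
Variable n : nat.
Implicit Types (X Y : abword n).

Lemma prev_ixE (i : 'I_n) : prev_ix i = inord i.
Proof. by apply: val_inj; rewrite /= inordK // ltnS ltnW. Qed.
Lemma next_ixE (i : 'I_n) : next_ix i = inord i.+1.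
Proof. by apply: val_inj; rewrite /= inordK // ltnS. Qed.

Lemma word_gvectorE X i : word_gvector X i =
  (X (inord i) && ~~ X (inord i.+1))%:Z - (~~ X (inord i) && X (inord i.+1))%:Z.
Proof.
rewrite /word_gvector prev_ixE next_ixE.
by case: (X _); case: (X _).
Qed.

(** If the first letters agree, the g-vector determines the letters one
    after another. If they differ, no change of letter is compatible with
    both words, so both are constant. *)
Lemma word_gvector_inj X Y : both_letters X -> both_letters Y ->
  (forall i, word_gvector X i = word_gvector Y i) -> X = Y.
Proof.
move=> bX bY e; have [e0|ne0] := eqVneq (X (inord 0)) (Y (inord 0)).
  apply/ffunP => i; rewrite -[i]inord_val; have : (i <= n)%N by rewrite -ltnS.
  elim: (nat_of_ord i) => // u IH hu; have {}IH := IH (ltnW hu).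
  have := e (Ordinal hu); rewrite !word_gvectorE /= IH.
  by case: (Y (inord u)); case: (X (inord u.+1)); case: (Y (inord u.+1)).
have H u : (u <= n)%N -> X (inord u) = X (inord 0) /\ Y (inord u) = Y (inord 0).
  elim: u => // u IH hu; have [IHX IHY] := IH (ltnW hu).
  have := e (Ordinal hu); rewrite !word_gvectorE /= IHX IHY; move: ne0.
  by case: (X (inord 0)); case: (Y (inord 0)); case: (X (inord u.+1)); case: (Y (inord u.+1)).
have [[i hi] [k hk]] := bX.
have := (H i); rewrite inord_val -ltnS => /(_ (ltn_ord i))[].
have := (H k); rewrite inord_val -ltnS => /(_ (ltn_ord k))[].
by rewrite hi hk => <-.
Qed.

End Words.

Section Main.
Variables (K : fieldType) (n : nat) (w : 'S_n.+1) (s : seq 'I_n).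
Hypothesis hs : reduced_expression s w.
Local Notation A := (preproj K n).
Local Notation en := (vertex_idem K n).
Local Notation om := (socle_elt K n).
Local Notation rmod := (rmod A).
Local Notation reg := ((A^c)^o : rmod).
Local Notation PS := (proj_sum (@idem K n)).
Local Notation full := (unit_ideal A).
Local Notation U := (word_ideal (@idem K n) s : submodule reg).
Local Notation P0 := (PS (fun=> 0%N)).

Lemma U_supp (x : A) : U x <-> supp_in (in_filter w) x.
Proof.
have ew : w = word_perm s by case: hs.
by rewrite ew; apply: word_idealP; rewrite -ew.
Qed.

Lemma U_en j (x : A) : U x -> U (en j * x).
Proof.
move=> /U_supp Sx; apply/U_supp => c p q h; rewrite pcoef_en_l.
by case: ifP => // _; apply: Sx.
Qed.

(** The word indexed by natural numbers, as the lattice walk needs it. *)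
Definition cutX j (u : nat) : bool := cut_word w j (inord u).

(** Counting the values below c among the first j positions, or the
    positions below j among the first c values, is the same. *)
Lemma count_a_perm_rank j c : (j <= n.+1)%N -> (c <= n.+1)%N ->
  count_a (cutX j) c = perm_rank w j c.
Proof.
move=> hj; elim: c => [|c IH] hc; first by rewrite count_a0 perm_rankv0.
by rewrite count_aS perm_rank_stepv // (IH (ltnW hc)) /cutX ffunE.
Qed.

Lemma count_a_total j : (0 < j <= n)%N -> count_a (cutX j) n.+1 = j.
Proof. by move=> hj; rewrite count_a_perm_rank ?perm_rank_full //; lia. Qed.

Lemma part_supp j : (0 < j <= n)%N -> forall x : A, part U (en j) x <->
  supp_in (fun c p q => [&& c == j, in_bounds n j p q & j <= p + count_a (cutX j) (j + q - p)])%N x.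
Proof.
move=> hj x; have E p q : in_filter w j p q
  = in_bounds n j p q && (j <= p + count_a (cutX j) (j + q - p))%N.
  rewrite /in_filter; case hb : (in_bounds n j p q) => //=; move: hb; rewrite /in_bounds => hb.
  by rewrite count_a_perm_rank //; lia.
split=> [[/U_supp Sx ex] c p q|Sx].
  have [->|nc] := eqVneq c j; first by rewrite /= -E; apply: Sx.
  by move=> _; rewrite -ex pcoef_en_l eq_sym (negPf nc).
have Sj c p q : c != j -> pcoef c p q x = 0.
  by move=> nc; apply: Sx; rewrite (negPf nc).
split.
  apply/U_supp => c p q h; apply: Sx; apply: contra h => /and3P[/eqP -> h1 h2].
  by rewrite E h1 h2.
apply/eqP; rewrite -subr_eq0; apply/eqP/pcoef_ext => c p q _; rewrite pcoefB pcoef_en_l.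
have [_|nc] := eqVneq j c; first by rewrite subrr.
by rewrite (Sj c) ?subrr // eq_sym.
Qed.

Lemma word_gvector_cut j i : word_gvector (cut_word w j) i =
  (gens (cutX j) i)%:Z - (rels (cutX j) i)%:Z.
Proof. exact: word_gvectorE. Qed.

Lemma zero_gvector (M : rmod) : zero_mod M ->
  exists (f : {linear P0 -> P0}) (p : {linear P0 -> M}), minimal_presentation f p.
Proof.
move=> zM; have zP : zero_mod P0 := @zero_ps _ _ _.
have l0 : linear (fun _ : P0 => 0 : M) by move=> a x y; rewrite scaler0 addr0.
exists (mklin (f := (id : P0 -> P0)) (fun _ _ _ => erefl)), (mklin l0); split.
- by move=> y; exists 0; rewrite (zM y).
- by move=> x; split=> // _; exists x.
- by move=> L _ x; rewrite (zP x); apply: subm0.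
- by move=> L _ x; rewrite (zP x); apply: subm0.
Qed.

Lemma zero_iso_zero (M N : rmod) : zero_mod M -> zero_mod N -> iso_mod M N.
Proof.
move=> zM zN; have l0 : linear (fun _ : M => 0 : N) by move=> a x y; rewrite scaler0 addr0.
apply: (iso_can (f := mklin l0) (g := fun=> 0)) => x; first by rewrite (zM x).
by rewrite (zN x).
Qed.

(** The module e_j I_w is zero exactly when the first n + 1 - j letters of
    the word are b. Then the only change of letter is ba, at the end vertex
    of the socle element. *)
Lemma om_notin_cut j : (0 < j <= n)%N -> ~ U (om j) ->
  forall i : 'I_n, word_gvector (cut_word w j) i = - (i == (n - j)%N :> nat)%:Z.
Proof.
move=> hj nU i; have ht := count_a_total hj.
have A0 : count_a (cutX j) (n.+1 - j) = 0%N.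
  have hb := inb_om hj; apply: contra_notP nU => /eqP nz; apply/U_supp.
  apply: supp_mono; rewrite /in_filter hb /=.
  have e : (j + (n - j) - j.-1 = n.+1 - j)%N by lia.
  by rewrite e -count_a_perm_rank; lia.
have XE u : (u <= n)%N -> cutX j u = (n.+1 - j <= u)%N.
  move=> hu; have [h|h] := leqP (n.+1 - j) u.
    apply: contraT => nX; have lu : (u < n.+1)%N by lia.
    by have := count_b_lt h lu nX; rewrite A0 ht; lia.
  apply/negbTE/negP => Xu; have := count_a_lt (leq0n u) h Xu; rewrite A0; lia.
rewrite word_gvector_cut /gens /rels !XE ?(ltnW (ltn_ord i)) //.
have hi := ltn_ord i.
by case: eqP => e; case: (leqP (n.+1 - j) i); case: (leqP (n.+1 - j) i.+1) => //; lia.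
Qed.

Lemma nonzero_vertex j : (0 < j <= n)%N -> U (om j) -> om j * en (n.+1 - j) = om j.
Proof.
move=> hj _; rewrite /socle_elt mono_en ifT //; apply/eqP; lia.
Qed.

Section Pair.
Variable P : rmod.
Hypothesis hP : support_tau_tilting (preproj_ideal K s) P.

(** Hom(P_v, I_w) = 0. *)
Definition killed (v : 'I_n) : Prop := forall x : A, U x -> x * en v.+1 = 0.

(** Every element x of I_w gives a map e_v A -> I_w by left multiplication,
    and it vanishes because Hom(P, I_w) = 0. *)
Lemma indec_summand_P L : indecomposable L -> summand L P ->
  exists2 v : 'I_n, iso_mod L (part full (en v.+1)) & killed v.
Proof.
case: hP => -[_ fdP] _ [prP _ nohom] _ indL sL.
have prL := projective_summand prP sL; have fdL := summand_fin_dim fdP sL.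
have [v iL] := indec_projective prL fdL indL; exists v => // x Ux.
have [f [g fK gK]] := iL; have [i [p pi]] := summand_split sL.
have Ux' (y : part full (en v.+1)) : U (x * (submod_val y : A)).
  exact: (@sub_ract A reg U x (submod_val y) Ux).
have lU : linear (fun y : part full (en v.+1) => insub_mod (Ux' y)).
  apply: mk_lin => [y z|a y]; apply: submod_inj.
    by rewrite [RHS]submod_valD !insub_modK submod_valD mulrDr.
  by rewrite [RHS]ract_val !insub_modK ract_val !ract_reg mulrA.
pose o1 : part full (en v.+1) :=
  insub_mod (U := part full (en v.+1)) (x := en v.+1) (conj I (en_idem K n v.+1)).
have := nohom (mklin (comp_lin (mklin (comp_lin p f)) (mklin lU))) (i (g o1)).
move=> /(congr1 (@submod_val _ _ _)); rewrite submod_val0 => <-.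
by rewrite mklinE /= !mklinE /= pi gK.
Qed.

Lemma vertex_om (v : 'I_n) : killed v -> ~ U (om (n - v)).
Proof.
move=> kv Uo; have hj : (0 < n - v <= n)%N by have := ltn_ord v; lia.
have := kv _ Uo; have := nonzero_vertex hj Uo.
have -> : (n.+1 - (n - v) = v.+1)%N by have := ltn_ord v; lia.
by move=> -> /eqP; rewrite (negPf (om_neq0 K hj)).
Qed.

(** The summands of I_w embed into the set of vertices j with socle element
    in I_w, and those of P into the set of annihilating vertices v. By
    [vertex_om], the first set is mapped by j -> n + 1 - j into the
    complement of the second. Since the numbers of summands add up to n, all
    of these inclusions are equalities. *)
Lemma summand_P_exists j : (0 < j <= n)%N -> ~ U (om j) ->
  exists L (v : 'I_n), [/\ v = (n - j)%N :> nat, indecomposable L, summand L P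
    & iso_mod L (part full (en v.+1))].
Proof.
move=> hj nU; case: hP => _ _ _ [m [p [[N [hN Ninj _]] [N' [hN' Ninj' _]] emp]]].
pose Z := [set v : 'I_n | `[< killed v >]].
pose J := [set i : 'I_n | `[< U (om i.+1) >]].
have hJ k : exists i : 'I_n, U (om i.+1) /\ iso_mod (N k) (part U (en i.+1)).
  have [ind sm] := hN k; have [c [hc Uo iso]] := indec_summand_part U_en ind sm.
  have hc' : (c.-1 < n)%N by lia.
  by exists (Ordinal hc'); rewrite /= prednK //; case/andP: hc.
pose iota k := projT1 (cid (hJ k)).
have iotaP k : U (om (iota k).+1) /\ iso_mod (N k) (part U (en (iota k).+1)).
  by rewrite /iota; case: cid.
have mJ : (m <= #|J|)%N.
  rewrite -[m]card_ord -(card_imset predT (f := iota)) => [|k l e]; last first.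
    apply: Ninj; have [_ h1] := iotaP k; have [_ h2] := iotaP l.
    by apply: iso_trans h1 _; rewrite e; apply: iso_sym.
  apply: subset_leq_card; apply/subsetP => i /imsetP[k _ ->].
  by rewrite inE; apply/asboolP; case: (iotaP k).
have hZ k : exists v : 'I_n, killed v /\ iso_mod (N' k) (part full (en v.+1)).
  by have [ind sm] := hN' k; have [v h1 h2] := indec_summand_P ind sm; exists v.
pose kap k := projT1 (cid (hZ k)).
have kapP k : killed (kap k) /\ iso_mod (N' k) (part full (en (kap k).+1)).
  by rewrite /kap; case: cid.
have kinj : injective kap.
  move=> k l e; apply: Ninj'; have [_ h1] := kapP k; have [_ h2] := kapP l.
  by apply: iso_trans h1 _; rewrite e; apply: iso_sym.
have kZ : kap @: predT \subset Z.
  by apply/subsetP => v /imsetP[k _ ->]; rewrite inE; apply/asboolP; case: (kapP k).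
have JZ : (@rev_ord n) @: J \subset ~: Z.
  apply/subsetP => v /imsetP[i]; rewrite inE => /asboolP Ui ->; rewrite !inE.
  apply/asboolP => kr; apply: (vertex_om kr).
  by have -> : (n - rev_ord i = i.+1)%N by rewrite /=; have := ltn_ord i; lia.
have cJ : #|(@rev_ord n) @: J| = #|J| by apply/card_imset/rev_ord_inj.
have ck : #|kap @: predT| = p by rewrite card_imset // card_ord.
have cZ := cardsC Z; rewrite card_ord in cZ.
have l1 := subset_leq_card kZ; have l2 := subset_leq_card JZ.
have eJZ : (@rev_ord n) @: J = ~: Z by apply/eqP; rewrite eqEcard JZ; lia.
have ekZ : kap @: predT = Z by apply/eqP; rewrite eqEcard kZ; lia.
have hv : (n - j < n)%N by lia.
have vZ : Ordinal hv \in Z.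
  apply: contraT; rewrite -in_setC -eJZ => /imsetP[i]; rewrite inE => /asboolP Ui e.
  case: nU; have -> // : j = i.+1.
  by have := congr1 val e; rewrite /=; have := ltn_ord i; lia.
move: vZ; rewrite -ekZ => /imsetP[k _ e]; exists (N' k), (kap k).
have [ind sm] := hN' k; have [_ h] := kapP k; split=> //.
by rewrite -e.
Qed.

(** A summand of the pair is a nonzero e_j I_w or a projective at an
    annihilating vertex. Its g-vector is computed in either case, and the
    g-vector determines the word. *)
Lemma indec_summand_wordP (X : abword n) : indec_summand_word (preproj_ideal K s) P X <->
  exists j, (0 < j <= n)%N /\ X = cut_word w j.
Proof.
have zP : zero_mod P0 := @zero_ps _ _ _.
split=> [[N [L [sN sL hNL [bX [r [s' [s0 [f [p [mp iso hg]]]]]]]]]]|[j [hj ->]]].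
  case: hNL => [[indN zL]|[zN indL]].
    have [j [hj Uo iN]] := indec_summand_part U_en indN sN; exists j; split=> //.
    have nzV : ~ zero_mod (part U (en j)) by case: (part_indec hj Uo).
    have mp' := pres_minimal hj (count_a_total hj) (part_supp hj) nzV.
    apply: word_gvector_inj => // [|i]; first exact: cut_both.
    have [er es] := presentation_unique i iN mp mp'.
    have es' := iso_ps_mult i (iso_trans (iso_sym (iso_pair0l _ zL)) iso).
    by rewrite hg word_gvector_cut -er -es es'.
  have [v iL kv] := indec_summand_P indL sL.
  have [f0 [p0 mp0]] := zero_gvector zP.
  have eu i := presentation_unique i (zero_iso_zero zN zP) mp mp0.
  have hj : (0 < n - v <= n)%N by have := ltn_ord v; lia.
  exists (n - v)%N; split=> //; apply: word_gvector_inj => // [|i]; first exact: cut_both.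
  rewrite om_notin_cut //; last exact: vertex_om.
  have zs' : zero_mod (PS s') by apply: zero_iso zP; apply: iso_ps_eq => k; case: (eu k).
  have isoL : iso_mod (PS s0) (PS (fun i => (i == v) : nat)).
    apply: iso_trans (iso_part_ps K v); apply: iso_trans iL.
    by apply: iso_trans (iso_sym iso) _; apply: iso_pair0r.
  rewrite hg; have [-> _] := eu i; rewrite (iso_ps_mult i isoL) sub0r.
  by rewrite -val_eqE /= subKn //; apply: ltnW.
have bw := cut_both w hj.
have [zV|nzV] := pselect (zero_mod (part U (en j))); last first.
  have Uo := part_nonzero hj nzV.
  exists (part U (en j)), P0; split.
  - apply: part_summand; [exact: U_en | exact: en_idem].
  - exact: summand_zero.
  - by left; split=> //; apply: part_indec.
  split=> //; exists (gens (cutX j)), (rels (cutX j)), (rels (cutX j)).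
  have mp := pres_minimal hj (count_a_total hj) (part_supp hj) nzV.
  eexists; eexists; split; [exact: mp | exact: iso_pair0l | exact: word_gvector_cut].
have nU : ~ U (om j).
  by move=> Uo; case: (part_indec hj Uo) => h _; apply: h.
have [L [v [ev indL sL iL]]] := summand_P_exists hj nU.
exists P0, L; split=> //; first exact: summand_zero.
  by right.
split=> //; have [f0 [p0 mp0]] := zero_gvector zP.
exists (fun=> 0%N), (fun=> 0%N), (fun i => (i == v) : nat), f0, p0; split=> //.
  by apply: iso_trans (iso_part_ps K v); apply: iso_trans iL; apply: iso_pair0r.
by move=> i; rewrite om_notin_cut // sub0r -ev.
Qed.

End Pair.
End Main.

(* Read: for every reduced expression [s] of [w] and every [P] such that      *)
(* [(I_w, P)] is a (basic) support tau-tilting pair, T_w is the one and only  *)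
(* triangulation T(I_w, P).                                                   *)
Theorem proposition3p20 (R : realType) (K : fieldType) (n : nat) (hn : (1 <= n)%N)
    (w : 'S_n.+1) (s : seq 'I_n) (hs : reduced_expression s w)
    (P : rmod (preproj K n)) (hP : support_tau_tilting (preproj_ideal K s) P) :
  unique (triangulation_of_pair R (preproj_ideal K s) P) (perm_triangulation w).
Proof.
have H X := indec_summand_wordP hs hP X.
split=> [|T [triT hT]].
  split=> [|S]; first exact: perm_triangulationP.
  rewrite internal_cells; split=> [[j [hj ->]]|[X /H[j [hj ->]] ->]]; last by exists j.
  by exists (cut_word w j) => //; apply/H; exists j.
apply: (triangulation_unique triT) => j hj.
by case: (proj2 (hT (word_simplex (cut_word w j)))) => //; exists (cut_word w j) => //;
  apply/H; exists j.
Qed.
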